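(* Every weakly compact JB$^*$-triple $E$ satisfies the Mazur--Ulam property, that is, for every real Banach space $Y$, every surjective isometry from $S(E)$ onto $S(Y)$ admits a (unique) extension to a surjective real linear isometry from $E$ onto $Y$.
   Context: $S(X)$ denotes the unit sphere of a Banach space $X$ (with the metric induced by the norm). An isometry is a distance-preserving map; no linearity is assumed. A JB$^*$-triple is a complex Banach space $E$ with a continuous triple product $\{\cdot,\cdot,\cdot\}:E\times E\times E\to E$, bilinear and symmetric in the outer variables and conjugate linear in the middle one, such that, writing $L(a,b)(z)=\{a,b,z\}$: (a) $L(a,b)L(x,y)-L(x,y)L(a,b)=L(L(a,b)x,y)-L(x,L(b,a)y)$; (b) $L(a,a)$ is a hermitian operator with non-negative spectrum; (c) $\|\{a,a,a\}\|=\|a\|^3$. For $x\in E$, $Q(x):E\to E$ is the conjugate linear map $Q(x)(y)=\{x,y,x\}$. The JB$^*$-triple $E$ is weakly compact if $Q(x)$ is a weakly compact operator for every $x\in E$. (It is known that $E$ is weakly compact if and only if it is a $c_0$-sum of elementary JB$^*$-triples, i.e. of the analogues, formed by compact operators, of the Cartan factors.) *)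

(* Defs.v *)
From mathcomp Require Import all_boot all_order all_algebra.
From mathcomp Require Import complex.
From mathcomp Require Import all_classical all_reals all_analysis.
Set Implicit Arguments.
Unset Strict Implicit.
Unset Printing Implicit Defensive.
Import Order.TTheory GRing.Theory Num.Theory.
Import numFieldNormedType.Exports.
Local Open Scope classical_set_scope.
Local Open Scope ring_scope.
Local Open Scope complex_scope.

Section NormedSpaces.
Variable K : numFieldType.

Definition unit_sphere (E : normedModType K) : set E := [set x | `|x| = 1].

Definition closed_unit_ball (E : normedModType K) : set E := [set x | `|x| <= 1].

Definition continuous_dual (E : normedModType K) : Type :=
  {phi : {linear E -> K^o} | continuous phi}.

Definition dual_fun (E : normedModType K) (phi : continuous_dual E) : E -> K^o := sval phi.

(* The coarsest topology on [E] making every element of its dual continuous. *)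
Definition weak_space (E : normedModType K) : topologicalType :=
  sup_topology (fun phi : continuous_dual E =>
    Topological.class (initial_topology (dual_fun phi))).

(* The image of the closed unit ball is relatively weakly compact.  [T] is an
   arbitrary map, so as to cover conjugate linear operators. *)
Definition weakly_compact_operator (E F : normedModType K) (T : E -> F) : Prop :=
  precompact (T @` @closed_unit_ball E : set (weak_space F)).

(* Invertibility is meant in the algebra of bounded operators on [E]. *)
Definition spectrum (E : normedModType K) (T : E -> E) : set K :=
  [set lambda | ~ exists S : {linear E -> E},
     [/\ continuous S,
         forall x, S (T x - lambda *: x) = x &
         forall x, T (S x) - lambda *: S x = x]].

(* exp(z T) x, as the sum of the exponential series; the series converges when
   [E] is complete and [T] is bounded and linear. *)
Definition exp_operator (E : normedModType K) (z : K) (T : E -> E) (x : E) : E :=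
  lim (series (fun n => (z ^+ n / n`!%:R) *: iter n T x) @ \oo).

End NormedSpaces.

Section JBStarTriples.
Variables (R : realType) (E : completeNormedModType R[i]).

(* exp(i t T) is an isometry of [E] for every real t. *)
Definition hermitian_operator (T : E -> E) : Prop :=
  forall (t : R) (x : E), `|exp_operator (t *i) T x| = `|x|.

Variable tp : E -> E -> E -> E.

Definition tripleL (a b : E) : E -> E := fun z => tp a b z.

Definition tripleQ (x : E) : E -> E := fun y => tp x y x.

(* [0 <= lambda] in [R[i]] means that [lambda] is real and non-negative. *)
Record JBstar_triple : Prop := {
  JB_linear : forall b c, linear (fun a => tp a b c);
  JB_sym : forall a b c, tp a b c = tp c b a;
  JB_conj_linear : forall a c (k : R[i]) x y,
    tp a (k *: x + y) c = k^* *: tp a x c + tp a y c;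
  JB_continuous : continuous (fun p : E * E * E => tp p.1.1 p.1.2 p.2);
  JB_identity : forall a b x y z,
    tripleL a b (tripleL x y z) - tripleL x y (tripleL a b z) =
    tripleL (tripleL a b x) y z - tripleL x (tripleL b a y) z;
  JB_hermitian : forall a, hermitian_operator (tripleL a a);
  JB_positive : forall a lambda, spectrum (tripleL a a) lambda -> 0 <= lambda;
  JB_norm : forall a, `|tp a a a| = `|a| ^+ 3 }.

Definition weakly_compact_triple : Prop :=
  forall x, weakly_compact_operator (tripleQ x).

End JBStarTriples.

Section MazurUlam.
Variables (R : realType) (E : completeNormedModType R[i]).
Variable Y : completeNormedModType R.

(* The norm of a normed module over [R[i]] takes its values in [R[i]], whence the
   embeddings [%:C] of the norm of [Y]. *)
Definition isometry_on (A : set E) (f : E -> Y) : Prop :=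
  forall x y, A x -> A y -> `|f x - f y|%:C = `|x - y|.

Definition real_linear (T : E -> Y) : Prop :=
  forall (r : R) (x y : E), T (r%:C *: x + y) = r *: T x + T y.

End MazurUlam.

(* A map from S(E) to S(Y) is represented by a function on [E], of which only the
   values on S(E) matter. *)
Definition Mazur_Ulam_property (R : realType) (E : completeNormedModType R[i]) :
    Prop :=
  forall (Y : completeNormedModType R) (f : E -> Y),
    set_fun (@unit_sphere _ E) (@unit_sphere _ Y) f ->
    set_surj (@unit_sphere _ E) (@unit_sphere _ Y) f ->
    isometry_on (@unit_sphere _ E) f ->
  exists! T : E -> Y,
    [/\ real_linear T,
        isometry_on [set: E] T,
        set_surj [set: E] [set: Y] T &
        forall x, @unit_sphere _ E x -> T x = f x].

(* Main.v *)
(* A minimal tripotent e of E has a real functional phi_e = Re (coordinate in C e), and the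
   face {phi_e = 1} of the ball is e plus the ball of the Peirce space E_0(e). A surjective
   isometry f of the spheres sends this face onto a convex set, and - because e is a
   smooth point - sends the opposite face onto the opposite set. By Hahn-Banach there is
   a functional psi_e of norm one on Y equal to 1 on the image of the face. If
   psi_e (f x) = phi_e x on the sphere for all minimal e, the homogeneous extension of f
   is linear, as the psi_e norm the image.

   It suffices to treat finite real combinations of orthogonal minimal tripotents, on which
   f is linear, hence a single minimal x. The identity is preserved when f is known to be
   real linear on the span of e and x, since |e + t x| <= 1 + t phi_e x + O(t^2). Two
   orthogonal minimal tripotents e, e' span a spin factor E_2(e + e'), which is covered by
   spans of pairs of orthogonal minimal tripotents, so f is linear there; if x is not in
   such a factor one passes through a third minimal tripotent. In rank one E is a Hilbert
   space, and Y satisfies the parallelogram law by Day's theorem.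

   No classification is used. For |a| = 1 the powers T^n a of T = L(a,a) converge in norm
   to a tripotent: |T^n (1 - T^2) a| tends to 0, by writing T = (w - w')/2i and
   1 - T^2 = w + w' with commuting w, w' all of whose products are contractive on a, and
   weak compactness of Q(a) yields the limit. Weak compactness also excludes infinite
   orthogonal families below an element, which gives minimal tripotents and approximation by
   their finite combinations. *)
Require Import Defs.
From mathcomp Require Import all_boot all_order all_algebra.
From mathcomp Require Import complex.
From mathcomp Require Import all_classical all_reals all_analysis.
Import numFieldNormedType.Exports.
Local Open Scope ring_scope.
Local Open Scope complex_scope.
From HB Require Import structures.
From mathcomp Require Import ring lra zify.
Set Implicit Arguments.
Unset Strict Implicit.
Unset Printing Implicit Defensive.
Import Order.TTheory GRing.Theory Num.Theory.
Local Open Scope classical_set_scope.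
Local Open Scope ring_scope.

(** Since [f] is not known to be odd, let alone additive, every identity has to be extracted from
    distances. A point [c] of the sphere is identified in two moves. Faces containing [c], or
    distances from [c] to known points, show that the error [d] is orthogonal to all the minimal
    tripotents in play ([at_face], [metric_part]). The functionals of the minimal tripotents
    orthogonal to these vanish at [f c], whereas the one belonging to the leading tripotent of a
    nonzero [d] would take the value [|d|]. So each step only has to exhibit a candidate [c], and
    convexity of the images of faces provides it, usually as a midpoint.

    The metric part is stated for real spaces with the properties collected in [atomic], so that it
    never mentions the triple product.

    No sharp constant is available in [|{x,y,z}| <= K |x| |y| |z|]: continuity gives some [K]. Cubes
    have norm exactly the cube of the norm, so iterating them raises norms to the power [3 ^ k] and
    removes [K] from the contractive estimates for odd powers and orthogonal sums. *)

Section LinearCombinations.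
Variables (K : nzRingType) (V : lmodType K).

(** Linear expressions over numbered atoms. They are compared coefficient by coefficient, which
    reduces a vector identity to scalar ones within reach of [ring], [field] or [lra]. *)
Inductive lexp : Type :=
  | LVar of nat | LZero | LAdd of lexp & lexp | LOpp of lexp | LScale of K & lexp.

Fixpoint leval (env : seq V) (t : lexp) : V :=
  match t with
  | LVar i => nth 0 env i
  | LZero => 0
  | LAdd a b => leval env a + leval env b
  | LOpp a => - leval env a
  | LScale k a => k *: leval env a
  end.

Fixpoint lcoef (t : lexp) (i : nat) : K :=
  match t with
  | LVar j => if Nat.eqb i j then 1 else 0
  | LZero => 0
  | LAdd a b => lcoef a i + lcoef b i
  | LOpp a => - lcoef a i
  | LScale k a => k * lcoef a i
  end.

Lemma leval_coef (env : seq V) (t : lexp) :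
  leval env t = \sum_(i < size env) lcoef t i *: nth 0 env i.
Proof.
elim: t => [j||a IHa b IHb|a IHa|k a IHa] /=.
- have [js|js] := ltnP j (size env).
    rewrite (bigD1 (Ordinal js)) //= PeanoNat.Nat.eqb_refl scale1r big1 ?addr0 //.
    move=> i /eqP ij; case: PeanoNat.Nat.eqb_spec => [e|_]; last by rewrite scale0r.
    by case: ij; apply: val_inj.
  rewrite nth_default // big1 // => i _.
  case: PeanoNat.Nat.eqb_spec => [e|_]; last by rewrite scale0r.
  by move: (ltn_ord i); rewrite e ltnNge js.
- by rewrite big1 // => i _; rewrite scale0r.
- by rewrite IHa IHb -big_split; apply: eq_bigr => i _; rewrite scalerDl.
- by rewrite IHa -sumrN; apply: eq_bigr => i _; rewrite scaleNr.
- by rewrite IHa scaler_sumr; apply: eq_bigr => i _; rewrite scalerA.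
Qed.

(** A nested conjunction instead of a quantifier: after simplification [repeat split] turns it into
    one scalar goal per atom. *)
Fixpoint coefs_agree (n : nat) (a b : lexp) : Prop :=
  if n is m.+1 then coefs_agree m a b /\ lcoef a m = lcoef b m else True.

Lemma leval_eq (env : seq V) (a b : lexp) :
  coefs_agree (size env) a b -> leval env a = leval env b.
Proof.
move=> H; rewrite !leval_coef; apply: eq_bigr => i _; congr (_ *: _).
elim: (size env) i H => [[]//|n IH] i [H1 H2].
have [->|ne] := eqVneq (i : nat) n; first exact: H2.
have ltin : (i < n)%N by rewrite ltn_neqAle ne -ltnS ltn_ord.
exact: (IH (Ordinal ltin) H1).
Qed.

End LinearCombinations.

(* Atoms are compared up to conversion: canonical instances may differ syntactically. *)
Ltac lmod_mem x env :=
  match env with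
  | nil => constr:(false)
  | ?y :: _ => let _ := match goal with _ => unify x y end in constr:(true)
  | _ :: ?e => lmod_mem x e
  end.
Ltac lmod_atoms t env :=
  lazymatch t with
  | ?a + ?b => let e := lmod_atoms a env in lmod_atoms b e
  | - ?a => lmod_atoms a env
  | _ *: ?a => lmod_atoms a env
  | 0 => env
  | _ => match lmod_mem t env with
         | true => env
         | false => constr:(t :: env)
         end
  end.
Ltac lmod_index x env :=
  match env with
  | ?y :: _ => let _ := match goal with _ => unify x y end in constr:(0%N)
  | _ :: ?e => let n := lmod_index x e in constr:(S n)
  end.
Ltac lmod_reify K t env :=
  lazymatch t with
  | ?a + ?b => let u := lmod_reify K a env in let v := lmod_reify K b env in
               constr:(@LAdd K u v)
  | - ?a => let u := lmod_reify K a env in constr:(@LOpp K u)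
  | ?k *: ?a => let u := lmod_reify K a env in constr:(@LScale K k u)
  | 0 => constr:(@LZero K)
  | _ => let n := lmod_index t env in constr:(@LVar K n)
  end.
(* Reduces an equality between linear combinations to the equalities of the
   coefficients of each atom. *)
Ltac lmod_with V K :=
  lazymatch goal with
  | |- @eq _ ?a ?b =>
    let e0 := constr:(@nil V) in
    let e1 := lmod_atoms a e0 in
    let env := lmod_atoms b e1 in
    let u := lmod_reify K a env in
    let v := lmod_reify K b env in
    change (@leval K V env u = @leval K V env v);
    apply: leval_eq; rewrite /=; repeat split
  end.

(** * The Hahn-Banach theorem for sublinear functionals *)

Section HahnBanach.
Variables (R : realType) (V : lmodType R).

Definition sublinear (p : V -> R) : Prop :=
  (forall x y, p (x + y) <= p x + p y) /\
  (forall t x, 0 < t -> p (t *: x) <= t * p x).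

Lemma sublinear0 p : sublinear p -> 0 <= p 0.
Proof. by case=> pD _; have := pD 0 0; rewrite addr0; lra. Qed.

Lemma sublinearZ p t x : sublinear p -> 0 < t -> p (t *: x) = t * p x.
Proof.
case=> _ pZ t0; apply/eqP; rewrite eq_le pZ //=.
rewrite -ler_pdivlMl //.
by have := pZ t^-1 (t *: x); rewrite scalerA mulVf ?gt_eqF // scale1r invr_gt0; apply.
Qed.

(** Such infima give the lowered functional and the chain bound in the Hahn-Banach proof, the
    functional supporting the image of a face, and the distance to a subspace. *)
Lemma sublinear_inf (I : Type) (P : set I) (F : I -> V -> R) (m : V -> R) :
  P !=set0 -> (forall i x, P i -> m x <= F i x) ->
  (forall i j x y, P i -> P j -> exists2 k, P k & F k (x + y) <= F i x + F j y) ->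
  (forall i t x, P i -> 0 < t -> exists2 k, P k & F k (t *: x) <= t * F i x) ->
  sublinear (fun x => inf [set F i x | i in P]).
Proof.
move=> P0 mF FD FZ.
have lbF x : has_lbound [set F i x | i in P].
  by exists (m x) => _ [i Pi <-]; exact: mF.
have F0 x : [set F i x | i in P] !=set0 by case: P0 => i Pi; exists (F i x); exists i.
have infF i x : P i -> inf [set F i x | i in P] <= F i x.
  by move=> Pi; apply: ge_inf => //; exists i.
split=> [x y|t x t0].
  rewrite -lerBlDl; apply: lb_le_inf => // _ [j Pj <-].
  rewrite lerBlDl -lerBlDr; apply: lb_le_inf => // _ [i Pi <-].
  rewrite lerBlDr; have [k Pk H] := FD i j x y Pi Pj.
  exact: le_trans (infF _ _ Pk) H.
rewrite -ler_pdivrMl //; apply: lb_le_inf => // _ [i Pi <-].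
rewrite ler_pdivrMl //; have [k Pk H] := FZ i t x Pi t0.
exact: le_trans (infF _ _ Pk) H.
Qed.

Let two_gt0 : 0 < 2 :> R. Proof. lra. Qed.

(** Lowering along the ray of [x0]: the result is sublinear and below [q], and its value at [- x0]
    drops to [- q x0] or less. *)
Let lowered (q : V -> R) (x0 : V) (x : V) : R :=
  inf [set q (x + t *: x0) - t * q x0 | t in [set t | 0 <= t]].

Let loweredP q x0 : sublinear q ->
  [/\ sublinear (lowered q x0), (forall x, lowered q x0 x <= q x)
    & lowered q x0 (- x0) <= - q x0].
Proof.
move=> sq; have [qD qZ] := sq.
have q0 : q 0 = 0.
  by have := @sublinearZ q 2 0 sq two_gt0; rewrite scaler0; lra.
have m t x : 0 <= t -> - q (- x) <= q (x + t *: x0) - t * q x0.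
  rewrite le_eqVlt => /predU1P[<-|t0].
    by rewrite scale0r addr0 mul0r subr0; have := qD x (- x); rewrite subrr q0; lra.
  rewrite -(sublinearZ x0 sq t0).
  by have := qD (x + t *: x0) (- x); rewrite addrAC subrr add0r; lra.
have le1 t x : 0 <= t -> lowered q x0 x <= q (x + t *: x0) - t * q x0.
  move=> t0; apply: ge_inf; last by exists t.
  by exists (- q (- x)) => _ [s s0 <-]; exact: m.
split.
- apply: (@sublinear_inf _ _ (fun t x => q (x + t *: x0) - t * q x0) (fun x => - q (- x))).
  + by exists 0 => /=.
  + by move=> t x; exact: m.
  + move=> s t x y /= s0 t0; exists (s + t) => /=; first exact: addr_ge0.
    have := qD (x + s *: x0) (y + t *: x0).
    have -> : x + s *: x0 + (y + t *: x0) = x + y + (s + t) *: x0 by lmod_with V R; ring.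
    lra.
  + move=> s t x /= s0 t0; exists (t * s) => /=; first by rewrite mulr_ge0 // ltW.
    by have := qZ t (x + s *: x0) t0; rewrite scalerDr scalerA mulrBr mulrA; lra.
- by move=> x; have := le1 0 x (lexx _); rewrite scale0r addr0 mul0r subr0.
- by have := le1 1 (- x0) ler01; rewrite scale1r addNr q0 mul1r sub0r.
Qed.

(** No functional is extended from a subspace: Zorn's lemma is applied to the sublinear functionals
    below [lowered p x0], and a minimal one is linear. Starting from [lowered p x0] instead of [p]
    forces the value at [x0]. *)
Theorem hahn_banach (p : V -> R) (x0 : V) : sublinear p ->
  exists f : V -> R, [/\ forall a x y, f (a *: x + y) = a * f x + f y,
    forall x, f x <= p x & f x0 = p x0].
Proof.
move=> sp; have [sp1 p1p p1x0] := loweredP x0 sp.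
pose S := {q : V -> R | sublinear q /\ forall x, q x <= lowered p x0 x}.
pose mkS q (sq : sublinear q) (h : forall x, q x <= lowered p x0 x) : S :=
  exist (fun q => sublinear q /\ forall x, q x <= lowered p x0 x) q (conj sq h).
pose Rel (a b : S) := `[< forall x, sval b x <= sval a x >].
have bottom x (s : S) : - lowered p x0 (- x) <= sval s x.
  case: s => q /= [sq qp]; have [qD _] := sq; have := qD x (- x); rewrite subrr.
  by have := sublinear0 sq; have := qp (- x); lra.
have [|r s t /asboolP rs /asboolP st|s t /asboolP st /asboolP ts|A totA|q0 minq0] :=
    @Zorn S Rel.
- by move=> t; apply/asboolP => x.
- by apply/asboolP => x; exact: le_trans (st x) (rs x).
- move: s t st ts => [s Ps] [t Pt] /= st ts; apply: eq_exist.
  by apply/funext => x; apply/eqP; rewrite eq_le ts st.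
- have [[a0 Aa0]|/set0P/negP/negPn/eqP A0] := pselect (A !=set0); last first.
    by exists (mkS _ sp1 (fun x => lexx _)) => s; rewrite A0.
  pose F (s : S) := sval s.
  have sF : sublinear (fun x => inf [set F s x | s in A]).
    apply: (@sublinear_inf _ _ _ (fun x => - lowered p x0 (- x))).
    + by exists a0.
    + by move=> s x _; exact: bottom.
    + move=> i j x y Ai Aj; have [/asboolP ij|/asboolP ji] := totA i j Ai Aj.
        exists j => //; have [[jD _] _] := svalP j; apply: le_trans (jD x y) _.
        by rewrite lerD2r; exact: ij.
      exists i => //; have [[iD _] _] := svalP i; apply: le_trans (iD x y) _.
      by rewrite lerD2l; exact: ji.
    + by move=> i t x Ai t0; exists i => //; have [[_ iZ] _] := svalP i; exact: iZ.
  have inf_le s x : A s -> inf [set F s x | s in A] <= F s x.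
    move=> As; apply: ge_inf; last by exists s.
    by exists (- lowered p x0 (- x)) => _ [r _ <-]; exact: bottom.
  have Fp x : inf [set F s x | s in A] <= lowered p x0 x.
    by apply: le_trans (inf_le _ _ Aa0) _; have [_] := svalP a0; apply.
  by exists (mkS _ sF Fp) => s As; apply/asboolP => x; exact: inf_le.
case: q0 minq0 => q [sq qp] minq; have [qD qZ] := sq.
(* Lowering a minimal [q] along [x] cannot change it. So [q] is odd, and subadditivity becomes
   additivity. *)
have qN x : q (- x) <= - q x.
  have [sq' q'q q'x] := loweredP x sq.
  have q'p y : lowered q x y <= lowered p x0 y by exact: le_trans (q'q y) (qp y).
  have /minq [e] : Rel (mkS q sq qp) (mkS _ sq' q'p) by apply/asboolP.
  by rewrite -{1}e.
have q00 : q 0 = 0.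
  by have := @sublinearZ q 2 0 sq two_gt0; rewrite scaler0; lra.
have qNe x : q (- x) = - q x.
  by apply/eqP; rewrite eq_le qN /=; have := qD x (- x); rewrite subrr q00; lra.
have qDe x y : q (x + y) = q x + q y.
  apply/eqP; rewrite eq_le qD /=.
  by have := qD (- x) (- y); rewrite -opprD !qNe; lra.
have qZe a x : q (a *: x) = a * q x.
  have [a0|a0|->] := ltgtP a 0; last by rewrite scale0r q00 mul0r.
    have -> : a *: x = - (- a *: x) by rewrite scaleNr opprK.
    by rewrite qNe sublinearZ ?oppr_gt0 // mulNr opprK.
  exact: sublinearZ.
exists q; split=> [a x y|x|]; first by rewrite qDe qZe.
  exact: le_trans (qp x) (p1p x).
apply/eqP; rewrite eq_le (le_trans (qp x0) (p1p x0)) /=.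
by have := le_trans (qp (- x0)) p1x0; rewrite qNe lerN2.
Qed.

End HahnBanach.

Section RealNorms.
Variables (R : realType) (V : lmodType R).

(** A predicate on real-valued functions, so that the same lemmas serve [Y] and a complex space
    restricted to real scalars, whose own norm has values in [R[i]]. *)
Record is_norm (n : V -> R) : Prop := {
  is_normD : forall x y, n (x + y) <= n x + n y;
  is_normZ : forall a x, n (a *: x) = `|a| * n x;
  is_norm0_eq : forall x, n x = 0 -> x = 0 }.

Variable n : V -> R.
Hypothesis Hn : is_norm n.

Lemma norm_opp x : n (- x) = n x.
Proof. by rewrite -scaleN1r (is_normZ Hn) normrN1 mul1r. Qed.

Lemma norm_zero : n 0 = 0.
Proof. by rewrite -(scale0r (0 : V)) (is_normZ Hn) normr0 mul0r. Qed.

Lemma norm_pos x : 0 <= n x.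
Proof. by have := is_normD Hn x (- x); rewrite subrr norm_zero norm_opp; lra. Qed.

Lemma norm_gt0 x : x <> 0 -> 0 < n x.
Proof.
by move=> x0; rewrite lt_neqAle norm_pos andbT eq_sym; apply/eqP => /(is_norm0_eq Hn).
Qed.

Lemma norm_sub x y : n (x - y) = n (y - x).
Proof. by rewrite -norm_opp opprB. Qed.

Lemma norm_leD x y : n x <= n (x - y) + n y.
Proof. by have := is_normD Hn (x - y) y; rewrite subrK. Qed.

(* Subtract the smaller multiple of [a + b] and use the triangle inequality. *)
Lemma norm_additive_cone a b s t : n a <= 1 -> n b <= 1 -> n (a + b) = 2 ->
  0 <= s -> 0 <= t -> n (s *: a + t *: b) = s + t.
Proof.
move=> na nb nab s0 t0; apply/eqP; rewrite eq_le; apply/andP; split.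
  apply: le_trans (is_normD Hn _ _) _; rewrite !(is_normZ Hn) !ger0_norm //; nra.
have [st|/ltW ts] := lerP s t.
  have e : t *: (a + b) = (s *: a + t *: b) + (t - s) *: a by lmod_with V R; ring.
  have := is_normD Hn (s *: a + t *: b) ((t - s) *: a).
  rewrite -e !(is_normZ Hn) nab !ger0_norm ?subr_ge0 //.
  have : (t - s) * n a <= t - s by rewrite ler_piMr // subr_ge0.
  lra.
have e : s *: (a + b) = (s *: a + t *: b) + (s - t) *: b by lmod_with V R; ring.
have := is_normD Hn (s *: a + t *: b) ((s - t) *: b).
rewrite -e !(is_normZ Hn) nab !ger0_norm ?subr_ge0 //.
have : (s - t) * n b <= s - t by rewrite ler_piMr // subr_ge0.
lra.
Qed.

End RealNorms.

(** * Isometries between spheres *)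

Section SphereIsometry.
Variables (R : realType) (V Y : lmodType R) (nv : V -> R) (ny : Y -> R).
Hypotheses (HV : is_norm nv) (HY : is_norm ny).

Ltac lv := lmod_with V R; try ring.
Ltac ly := lmod_with Y R; try ring.

(* In the application [M] is the set of minimal tripotents, [Z e] the Peirce 0-space of
   [e], and [phi e] the real part of the coordinate in the Peirce 2-space [C e]. *)
Record atomic (M : V -> Prop) (phi : V -> V -> R) (Z : V -> V -> Prop) : Prop := {
  at_lin : forall e a x y, M e -> phi e (a *: x + y) = a * phi e x + phi e y;
  at_norm : forall e, M e -> nv e = 1;
  at_phi1 : forall e, M e -> phi e e = 1;
  at_phi_le : forall e x, M e -> phi e x <= nv x;
  at_Z0 : forall e, M e -> Z e 0;
  at_Zlin : forall e a x y, M e -> Z e x -> Z e y -> Z e (a *: x + y);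
  at_phiZ : forall e x, M e -> Z e x -> phi e x = 0;
  at_face : forall e x, M e -> nv x <= 1 -> phi e x = 1 -> Z e (x - e);
  at_Znorm : forall e a z, M e -> Z e z -> `|a| <= 1 -> nv z <= 1 ->
    nv (a *: e + z) <= 1;
  at_Zproj : forall e a z, M e -> Z e z -> nv z <= nv (a *: e + z);
  at_opp : forall e, M e -> M (- e);
  at_phiN : forall e x, M e -> phi (- e) x = - phi e x;
  at_ZN : forall e x, M e -> Z e x -> Z (- e) x;
  at_sym : forall e g, M e -> M g -> Z e g -> Z g e;
  at_top : forall x, x <> 0 -> exists e, [/\ M e, Z e (x - nv x *: e)
    & forall g, M g -> Z g x -> Z g e];
  at_smooth : forall e y, M e -> nv y <= 1 -> nv (e + y) = 2 -> phi e y = 1;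
  at_quad : forall e y, M e -> exists C, forall t, `|t| <= 1 ->
    nv (e + t *: y) <= 1 + t * phi e y + C * t ^+ 2 }.

Variables (M : V -> Prop) (phi : V -> V -> R) (Z : V -> V -> Prop).
Hypothesis HA : atomic M phi Z.

Variable D : V -> Y.
Hypothesis D_sphere : forall x, nv x = 1 -> ny (D x) = 1.
Hypothesis D_onto : forall y, ny y = 1 -> exists2 x, nv x = 1 & D x = y.
Hypothesis D_iso : forall x y, nv x = 1 -> nv y = 1 -> ny (D x - D y) = nv (x - y).

(* By [at_face] this is [e] plus the unit ball of [Z e]. *)
Definition face e x := nv x = 1 /\ phi e x = 1.

Lemma D_inj x y : nv x = 1 -> nv y = 1 -> D x = D y -> x = y.
Proof.
move=> nx n1 e; apply/eqP; rewrite -subr_eq0; apply/eqP/(is_norm0_eq HV).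
by rewrite -D_iso // e subrr (norm_zero HY).
Qed.

Lemma phiD e x y : M e -> phi e (x + y) = phi e x + phi e y.
Proof. by move=> Me; rewrite -[x in LHS]scale1r (at_lin HA) // mul1r. Qed.

Lemma phi0 e : M e -> phi e 0 = 0.
Proof. by move=> Me; have := phiD 0 0 Me; rewrite addr0; lra. Qed.

Lemma phiZ e a x : M e -> phi e (a *: x) = a * phi e x.
Proof. by move=> Me; rewrite -[_ *: _]addr0 (at_lin HA) // phi0 // addr0. Qed.

Lemma phiB e x y : M e -> phi e (x - y) = phi e x - phi e y.
Proof. by move=> Me; rewrite phiD // -scaleN1r phiZ // mulN1r. Qed.

Lemma phiN e x : M e -> phi e (- x) = - phi e x.
Proof. by move=> Me; have := phiB 0 x Me; rewrite sub0r phi0 // sub0r. Qed.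

Lemma ZD e x y : M e -> Z e x -> Z e y -> Z e (x + y).
Proof. by move=> Me Zx Zy; rewrite -[x]scale1r; apply: (at_Zlin HA). Qed.

Lemma ZZ e a x : M e -> Z e x -> Z e (a *: x).
Proof.
by move=> Me Zx; rewrite -[_ *: _]addr0; apply: (at_Zlin HA) => //; apply: (at_Z0 HA).
Qed.

Lemma ZB e x y : M e -> Z e x -> Z e y -> Z e (x - y).
Proof. by move=> Me Zx Zy; apply: ZD => //; rewrite -scaleN1r; apply: ZZ. Qed.

Lemma ZN e x : M e -> Z e x -> Z e (- x).
Proof. by move=> Me Zx; rewrite -sub0r; apply: ZB => //; apply: (at_Z0 HA). Qed.

Lemma face_opp e x : M e -> face e x -> face (- e) (- x).
Proof.
move=> Me [nx px]; split; first by rewrite norm_opp.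
by rewrite (at_phiN HA) // phiN // px opprK.
Qed.

Lemma face_of_le e x : M e -> nv x <= 1 -> phi e x = 1 -> face e x.
Proof.
move=> Me nx px; split=> //; apply/eqP; rewrite eq_le nx /=.
by rewrite -px; exact: (at_phi_le HA).
Qed.

Lemma face_add e x y : M e -> face e x -> face e y -> nv (x + y) = 2.
Proof.
move=> Me [nx px] [n1 py]; apply/eqP; rewrite eq_le; apply/andP; split.
  by apply: le_trans (is_normD HV _ _) _; rewrite nx n1; lra.
by apply: le_trans (at_phi_le HA _ Me); rewrite phiD // px py; lra.
Qed.

Lemma face_mem e : M e -> face e e.
Proof. by move=> Me; split; [exact: (at_norm HA)|exact: (at_phi1 HA)]. Qed.

Lemma face_smooth e y : M e -> nv y = 1 -> nv (e + y) = 2 -> face e y.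
Proof. by move=> Me n1 n2; split=> //; apply: (at_smooth HA) => //; rewrite n1. Qed.

Lemma face_Z e z : M e -> Z e z -> nv z <= 1 -> face e (e + z).
Proof.
move=> Me Zz nz; apply: face_of_le => //.
  by have := at_Znorm HA (a := 1) Me Zz; rewrite normr1 scale1r; apply.
by rewrite phiD // (at_phi1 HA) // (at_phiZ HA) // addr0.
Qed.

(** The preimage [y] of [- D e] is at distance 2 from [e], so by smoothness [- y] is in the face.
    The distance from [x] to [y] is then the norm of a sum of two points of the face. *)
Lemma image_face_add_center e x : M e -> face e x -> ny (D x + D e) = 2.
Proof.
move=> Me Fx; have [y ny1 Dy] : exists2 y, nv y = 1 & D y = - D e.
  by apply: D_onto; rewrite norm_opp // D_sphere // (at_norm HA).
have Fy : face e (- y).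
  apply: face_smooth => //; first by rewrite norm_opp.
  rewrite -D_iso ?(at_norm HA Me) // Dy opprK -mulr2n -scaler_nat (is_normZ HY).
  by rewrite D_sphere ?(at_norm HA Me) // normr_nat mulr1.
by rewrite -[D e]opprK -Dy D_iso //; [exact: face_add Fx Fy | case: Fx].
Qed.

(** The point [x'] is not claimed to be [x]: opposite faces are seen to have opposite images as sets
    only. *)
Lemma opp_image_face e x : M e -> face e x -> exists2 x', face e x' & D (- x') = - D x.
Proof.
move=> Me Fx; have [y ny1 Dy] : exists2 y, nv y = 1 & D y = - D x.
  by apply: D_onto; rewrite norm_opp // D_sphere //; case: Fx.
exists (- y); last by rewrite opprK.
apply: face_smooth => //; first by rewrite norm_opp.
rewrite -D_iso ?(at_norm HA Me) // Dy opprK addrC.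
exact: image_face_add_center.
Qed.

Lemma image_face_opp e x : M e -> face e x -> exists2 x', face e x' & D (- x) = - D x'.
Proof.
move=> Me Fx; have MNe := at_opp HA Me.
have [x' Fx' Dx'] := opp_image_face MNe (face_opp Me Fx).
exists (- x'); last by rewrite Dx' opprK.
by have := face_opp MNe Fx'; rewrite opprK.
Qed.

Lemma image_face_add e x y : M e -> face e x -> face e y -> ny (D x + D y) = 2.
Proof.
move=> Me Fx Fy; have [y' Fy' Dy'] := opp_image_face Me Fy.
rewrite -[D y]opprK -Dy' D_iso; last by rewrite norm_opp //; case: Fy'.
  by rewrite opprK; exact: face_add Fx Fy'.
by case: Fx.
Qed.

(** Converse of [image_face_add_center]: the image of the face is now described by the norm of [Y]
    and the point [D e] alone. *)
Lemma image_face_of_star e y : M e -> ny y = 1 -> ny (y + D e) = 2 ->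
  exists2 x, face e x & D x = y.
Proof.
move=> Me ny1 ny2; have [z nz Dz] : exists2 z, nv z = 1 & D z = - y.
  by apply: D_onto; rewrite norm_opp.
have Fz : face e (- z).
  apply: face_smooth => //; first by rewrite norm_opp.
  by rewrite -D_iso ?(at_norm HA Me) // Dz opprK addrC.
have [x Fx Dx] := image_face_opp Me Fz.
by exists x => //; apply: oppr_inj; rewrite -Dx opprK.
Qed.

(** By [image_face_of_star] the sum of the combination and [D e] must have norm 2. This involves
    three points, while [norm_additive_cone] handles two: the midpoints of [D x1] and [D x2] with
    [D e] are first shown to be in the image, and the sum is a positive combination of these. *)
Lemma image_face_convex e x1 x2 s t : M e -> face e x1 -> face e x2 ->
  0 <= s -> 0 <= t -> s + t = 1 -> exists2 c, face e c & D c = s *: D x1 + t *: D x2.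
Proof.
move=> Me F1 F2 s0 t0 st1.
have nD x : face e x -> ny (D x) <= 1 by case=> nx _; rewrite D_sphere.
have nDe : ny (D e) <= 1 by apply: nD; exact: face_mem.
have half x : face e x -> exists2 x', face e x' & D x' = 2^-1 *: D x + 2^-1 *: D e.
  move=> Fx; apply: image_face_of_star => //.
    rewrite (norm_additive_cone HY (nD _ Fx) nDe (image_face_add_center Me Fx)); lra.
  have -> : 2^-1 *: D x + 2^-1 *: D e + D e = 2^-1 *: D x + (2^-1 + 1) *: D e by ly.
  rewrite (norm_additive_cone HY (nD _ Fx) nDe (image_face_add_center Me Fx)); lra.
have [y1 G1 E1] := half _ F1; have [y2 G2 E2] := half _ F2.
apply: image_face_of_star => //.
  by rewrite (norm_additive_cone HY (nD _ F1) (nD _ F2) (image_face_add Me F1 F2)).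
have -> : s *: D x1 + t *: D x2 + D e = (2 * s) *: D y1 + (2 * t) *: D y2.
  rewrite E1 E2; transitivity (s *: D x1 + t *: D x2 + (s + t) *: D e).
    by rewrite st1 scale1r.
  by lmod_with Y R; field.
rewrite (norm_additive_cone HY (nD _ G1) (nD _ G2) (image_face_add Me G1 G2)); lra.
Qed.

Definition supports e (psi : Y -> R) : Prop :=
  [/\ forall a x y, psi (a *: x + y) = a * psi x + psi y,
      forall y, psi y <= ny y & forall x, face e x -> psi (D x) = 1].

(** Hahn-Banach for the infimum of [ny (y + t *: D x) - t] over [x] in the face and [t >= 0].
    Convexity of the image makes it subadditive, [t = 0] bounds it by the norm, and [t = 1] bounds
    it by [- 1] at [- D x]. *)
Lemma supports_exists e : M e -> exists psi, supports e psi.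
Proof.
move=> Me.
pose P := [set p : V * R | face e p.1 /\ 0 <= p.2].
pose F (p : V * R) y := ny (y + p.2 *: D p.1) - p.2.
have nD x : face e x -> ny (D x) <= 1 by case=> nx _; rewrite D_sphere.
have mF p y : P p -> - ny y <= F p y.
  case: p => x t [/= Fx t0]; rewrite /F /=.
  have := norm_leD HY (t *: D x) (- y); rewrite opprK [_ + y]addrC norm_opp //.
  rewrite (is_normZ HY) ger0_norm // (D_sphere (x := x)) ?mulr1; last by case: Fx.
  lra.
have [|psi [psil psip _]] := @hahn_banach R Y (fun y => inf [set F p y | p in P]) 0.
  apply: (@sublinear_inf R Y (V * R)%type P F (fun y => - ny y)) => //.
  - by exists (e, 0); split=> //; exact: face_mem.
  - move=> [x s] [x' t] y y' [/= Fx s0] [/= Fx' t0].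
    have [st0|st0] := eqVneq (s + t) 0.
      have [-> ->] : s = 0 /\ t = 0 by split; lra.
      exists (x, 0); first by split.
      by rewrite /F /= !scale0r !addr0 !subr0; exact: (is_normD HY).
    have st : 0 < s + t by rewrite lt_neqAle eq_sym st0 addr_ge0.
    have [|||c Fc Dc] := @image_face_convex e x x' (s / (s + t)) (t / (s + t)) Me Fx Fx'.
    + by rewrite divr_ge0 // addr_ge0.
    + by rewrite divr_ge0 // addr_ge0.
    + by rewrite -mulrDl divff.
    exists (c, s + t); first by split=> //=; exact: addr_ge0.
    rewrite /F /= Dc.
    have -> : y + y' + (s + t) *: ((s / (s + t)) *: D x + (t / (s + t)) *: D x')
            = (y + s *: D x) + (y' + t *: D x') by lmod_with Y R; field.
    by have := is_normD HY (y + s *: D x) (y' + t *: D x'); lra.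
  - move=> [x s] t y [/= Fx s0] t0; exists (x, t * s).
      by split=> //=; rewrite mulr_ge0 // ltW.
    rewrite /F /=; have -> : t *: y + (t * s) *: D x = t *: (y + s *: D x) by ly.
    by rewrite (is_normZ HY) gtr0_norm // mulrBr.
have psiF p y : P p -> psi y <= F p y.
  move=> Pp; apply: le_trans (psip y) _; apply: ge_inf; last by exists p.
  by exists (- ny y) => _ [q Pq <-]; exact: mF.
have psi_le y : psi y <= ny y.
  have := @psiF (e, 0) y; rewrite /F /= scale0r addr0 subr0; apply.
  by split=> //; exact: face_mem.
have psi0 : psi 0 = 0.
  by have := psil 1 0 0; rewrite scaler0 addr0; lra.
exists psi; split=> // x Fx.
have := @psiF (x, 1) (- D x) (conj Fx ler01); rewrite /F /= scale1r addNr.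
rewrite (norm_zero HY) -scaleN1r -[_ *: _]addr0 psil psi0.
by have := psi_le (D x); have := nD _ Fx; lra.
Qed.

Section Support.
Variables (e : V) (psi : Y -> R).
Hypotheses (Me : M e) (Spsi : supports e psi).

Lemma supD x y : psi (x + y) = psi x + psi y.
Proof. by have [l _ _] := Spsi; rewrite -[x in LHS]scale1r l mul1r. Qed.

Lemma sup0 : psi 0 = 0.
Proof. by have := supD 0 0; rewrite addr0; lra. Qed.

Lemma supZ a x : psi (a *: x) = a * psi x.
Proof. by have [l _ _] := Spsi; rewrite -[_ *: _]addr0 l sup0 addr0. Qed.

Lemma supB x y : psi (x - y) = psi x - psi y.
Proof. by rewrite supD -scaleN1r supZ mulN1r. Qed.

Lemma supN x : psi (- x) = - psi x.
Proof. by have := supB 0 x; rewrite sub0r sup0 sub0r. Qed.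

Lemma sup_le y : psi y <= ny y. Proof. by case: Spsi. Qed.

Lemma sup_lower x y : nv x = 1 -> face e y -> 1 - nv (x - y) <= psi (D x).
Proof.
move=> nx Fy; have [_ _ p1] := Spsi; have := sup_le (D y - D x).
rewrite supB p1 // D_iso //; last by case: Fy.
by rewrite (norm_sub HV); lra.
Qed.

Lemma sup_upper x y : nv x = 1 -> face e y -> psi (D x) <= nv (x + y) - 1.
Proof.
move=> nx Fy; have [_ _ p1] := Spsi; have [y' Fy' Dy'] := image_face_opp Me Fy.
have := sup_le (D x - D (- y)).
rewrite D_iso ?(norm_opp HV) //; last by case: Fy.
by rewrite opprK Dy' supB supN (p1 _ Fy'); lra.
Qed.

(** The points [e + z] and [e - z] of the face squeeze the value: subtracting the first from
    [a *: e + z], or adding the second, leaves a multiple of [e]. *)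
Lemma sup_coord a z : Z e z -> `|a| <= 1 -> nv (a *: e + z) = 1 ->
  psi (D (a *: e + z)) = a.
Proof.
move=> Zz a1 n1; have nz : nv z <= 1 by rewrite -n1; exact: (at_Zproj HA).
have /andP[am aM] : -1 <= a <= 1 by rewrite -ler_norml.
apply/eqP; rewrite eq_le; apply/andP; split.
  have ZNz : Z e (- z) by exact: ZN.
  have Fy : face e (e - z) by apply: face_Z; rewrite ?(norm_opp HV).
  have := sup_upper n1 Fy.
  have -> : a *: e + z + (e - z) = (a + 1) *: e by lv.
  by rewrite (is_normZ HV) (at_norm HA) // ger0_norm; lra.
have := sup_lower n1 (face_Z Me Zz nz).
have -> : a *: e + z - (e + z) = (a - 1) *: e by lv.
by rewrite (is_normZ HV) (at_norm HA) // ler0_norm; lra.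
Qed.

Lemma sup_orth x : Z e x -> nv x = 1 -> psi (D x) = 0.
Proof.
move=> Zx nx; have := @sup_coord 0 x Zx; rewrite scale0r add0r normr0.
exact.
Qed.

End Support.

(* Otherwise the functional of the leading atom of [d] would see [nv d]. *)
Lemma orthogonal_part_eq0 (G : V -> Prop) x d :
  nv (x + d) = 1 -> (forall g, G g -> M g) -> (forall g, G g -> Z g d) ->
  (forall k, M k -> (forall g, G g -> Z k g) -> Z k x) ->
  (forall k psi, M k -> supports k psi -> (forall g, G g -> Z k g) ->
     psi (D (x + d)) = 0) -> d = 0.
Proof.
move=> n1 GM GZ Gx Gpsi; apply: contrapT => d0.
have [k [Mk Zk kg]] := at_top HA d0.
have kG g : G g -> Z k g.
  by move=> Gg; apply: (at_sym HA) => //; [exact: GM|apply: kg; [exact: GM|exact: GZ]].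
have [psi Spsi] := supports_exists Mk.
have e : x + d = nv d *: k + (x + (d - nv d *: k)) by lv.
have Zr : Z k (x + (d - nv d *: k)) by apply: ZD => //; exact: Gx.
have d1 : `|nv d| <= 1.
  rewrite ger0_norm ?norm_pos // -n1; apply: le_trans (at_phi_le HA _ Mk).
  by rewrite e phiD // phiZ // (at_phi1 HA) // (at_phiZ HA) // addr0 mulr1.
have := Gpsi k psi Mk Spsi kG; rewrite {1}e.
rewrite (sup_coord Mk Spsi) // -?e // => /(is_norm0_eq HV) //.
Qed.

(** The two bounds force [phi g d = a], and then [(g - d) / (1 - a)] is in the face of [g], to which
    [at_face] applies. The hypotheses are distances, so they can be carried through [D]. *)
Lemma metric_part g d a : M g -> a <= 1 -> nv (d - g) <= 1 - a -> nv (d + g) <= 1 + a ->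
  Z g (d - a *: g).
Proof.
move=> Mg a1 n1 n2.
have pd : phi g d = a.
  apply/eqP; rewrite eq_le; apply/andP; split.
    by have := at_phi_le HA (d + g) Mg; rewrite phiD // (at_phi1 HA) //; lra.
  have := at_phi_le HA (- (d - g)) Mg; rewrite (norm_opp HV) phiN //.
  by rewrite phiB // (at_phi1 HA) //; lra.
have [a1'|a1'] := eqVneq a 1.
  have /(is_norm0_eq HV)/eqP : nv (d - g) = 0.
    by apply/eqP; rewrite eq_le norm_pos // andbT; lra.
  rewrite subr_eq0 => /eqP ->; rewrite a1' scale1r subrr; exact: (at_Z0 HA).
have a0 : 0 < 1 - a by rewrite subr_gt0 lt_neqAle a1'.
have := at_face HA (e := g) (x := (1 - a)^-1 *: (g - d)) Mg.
rewrite (is_normZ HV) (norm_sub HV) phiZ // phiB // (at_phi1 HA) // pd.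
rewrite mulVf ?gt_eqF // gtr0_norm ?invr_gt0 // ler_pdivrMl // mulr1.
move=> /(_ n1 erefl) H.
have -> : d - a *: g = - (1 - a) *: ((1 - a)^-1 *: (g - d) - g).
  by lmod_with V R; field; rewrite gt_eqF.
exact: ZZ.
Qed.

Lemma halves_sup k psi y1 y2 : supports k psi -> psi y1 = 0 -> psi y2 = 0 ->
  psi (2^-1 *: y1 + 2^-1 *: y2) = 0.
Proof. by move=> S p1 p2; rewrite (supD S) !(supZ S) p1 p2 !mulr0 addr0. Qed.

Definition orthos (l : seq V) : Prop :=
  [/\ uniq l, forall x, x \in l -> M x
    & forall x y, x \in l -> y \in l -> x <> y -> Z x y].

Lemma Z_irr g : M g -> ~ Z g g.
Proof. by move=> Mg /(at_phiZ HA Mg); rewrite (at_phi1 HA) // => /eqP; rewrite oner_eq0. Qed.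

Lemma orthos_cons g l : orthos (g :: l) ->
  [/\ M g, forall h, h \in l -> Z g h & orthos l].
Proof.
move=> [/= /andP[gl ul] Ml Zl]; split.
- by apply: Ml; rewrite mem_head.
- move=> h hl; apply: Zl; rewrite ?mem_head ?in_cons ?hl ?orbT //.
  by move=> gh; rewrite gh hl in gl.
- split=> // [x xl|x y xl yl]; first by apply: Ml; rewrite in_cons xl orbT.
  by apply: Zl; rewrite in_cons ?xl ?yl orbT.
Qed.

Lemma orthos_consI g l : M g -> (forall h, h \in l -> Z g h) -> orthos l ->
  orthos (g :: l).
Proof.
move=> Mg Zg [ul Ml Zl]; split=> /=.
- by rewrite ul andbT; apply/negP => /Zg; exact: Z_irr.
- by move=> x; rewrite in_cons => /predU1P[->|/Ml].
- move=> x y; rewrite !in_cons => /predU1P[->|xl] /predU1P[->|yl] xy //.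
  + exact: Zg.
  + by apply: (at_sym HA) => //; [exact: Ml|exact: Zg].
  + exact: Zl.
Qed.

Lemma orthos_sum g l : M g -> (forall h, h \in l -> Z g h) -> Z g (\sum_(h <- l) h).
Proof.
move=> Mg Zg; rewrite big_seq; elim/big_ind: _ => //; first exact: (at_Z0 HA).
by move=> x y; exact: ZD.
Qed.

Lemma orthos_rest g l : orthos l -> g \in l -> Z g (\sum_(h <- l) h - g).
Proof.
move=> [ul Ml Zl] gl; have Mg := Ml _ gl.
rewrite (big_rem g) //= addrAC subrr add0r; apply: orthos_sum => // h.
rewrite mem_rem_uniq // inE => /andP[/eqP hg hl]; apply: Zl => //.
exact/nesym.
Qed.

Lemma orthos_face g l : orthos l -> g \in l -> face g (\sum_(h <- l) h).
Proof.
elim: l g => [//|h l IH] g ol gl.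
have n1 : nv (\sum_(h0 <- (h :: l)) h0) <= 1.
  have [Mh Zh ol'] := orthos_cons ol; rewrite big_cons -[h in h + _]scale1r.
  apply: (at_Znorm HA) => //; rewrite ?normr1 //; first exact: orthos_sum.
  case: l IH ol' {ol gl Zh} => [|k l] IH ol'; first by rewrite big_nil norm_zero.
  by have [-> _] := IH k ol' (mem_head _ _).
have Mg : M g by case: ol => _ + _; apply.
apply: face_of_le => //.
have -> : \sum_(h0 <- (h :: l)) h0 = g + (\sum_(h0 <- (h :: l)) h0 - g) by lv.
by rewrite phiD // (at_phi1 HA) // (at_phiZ HA) ?addr0 //; exact: orthos_rest.
Qed.

Lemma orthos_far l k : M k -> (forall g, g \in l -> Z k g) -> Z k (\sum_(h <- l) h).
Proof. exact: orthos_sum. Qed.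

(** The point [c] with [D (- v) = - D c] lies in the face of every member of [l], because [D] is
    injective; hence [c - v] is orthogonal to all of them, and [orthogonal_part_eq0] applies. *)
Lemma D_opp_tripotent l : orthos l -> l <> [::] ->
  D (- \sum_(h <- l) h) = - D (\sum_(h <- l) h).
Proof.
move=> ol l0; set v := \sum_(h <- l) h.
have [g0 gl0] : exists g, g \in l by case: l l0 {ol v} => // g l; exists g; rewrite mem_head.
have Ml g : g \in l -> M g by case: ol => _ + _; apply.
have im g : g \in l -> exists2 x, face g x & D (- v) = - D x.
  by move=> gl; apply: image_face_opp; [exact: Ml|exact: orthos_face].
have [c Fc Dc] := im _ gl0.
have cZ g : g \in l -> Z g (c - v).
  move=> gl; have [x Fx Dx] := im _ gl.
  have -> : c = x.
    apply: D_inj; [by case: Fc|by case: Fx|].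
    by apply: oppr_inj; rewrite -Dc -Dx.
  have -> : x - v = (x - g) - (v - g) by lv.
  apply: ZB; first exact: Ml.
    by case: Fx => nx px; apply: (at_face HA) => //; [exact: Ml|rewrite nx].
  exact: orthos_rest.
have nv1 : nv v = 1 by case: (orthos_face ol gl0).
have /eqP : c - v = 0.
  have e : v + (c - v) = c by lv.
  apply: (@orthogonal_part_eq0 (fun g => g \in l) v).
  - by rewrite e; case: Fc.
  - exact: Ml.
  - exact: cZ.
  - by move=> k Mk Zk; exact: orthos_far.
  - move=> k psi Mk Sp Zk; rewrite e -[D c]opprK -Dc (supN Sp).
    rewrite (sup_orth Mk Sp) ?oppr0 ?(norm_opp HV) //.
    by apply: ZN => //; exact: orthos_far.
by rewrite subr_eq0 Dc => /eqP ->.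
Qed.

Lemma D_opp_atom g : M g -> D (- g) = - D g.
Proof.
move=> Mg; have := @D_opp_tripotent [:: g]; rewrite big_seq1; apply=> //.
split=> // [x|x y]; rewrite inE => /eqP -> //.
by rewrite inE => /eqP ->.
Qed.

(** [D v] is the midpoint of [D (g + v)] and [D (- g + v)], and [D g] that of [D (g + v)] and
    [D (g - v)]. Adding up, [D (- g + v)] and [D (g - v)] cancel by [D_opp_tripotent]. *)
Lemma D_add_tripotent g l : orthos (g :: l) -> l <> [::] ->
  D (g + \sum_(h <- l) h) = D g + D (\sum_(h <- l) h).
Proof.
move=> ogl l0; set v := \sum_(h <- l) h.
have [Mg Zg ol] := orthos_cons ogl.
have oNgl : orthos (- g :: l).
  by apply: orthos_consI => //; [exact: (at_opp HA)|move=> h /Zg; exact: (at_ZN HA)].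
have Ml h : h \in l -> M h by case: ol => _ + _; apply.
have [g0 gl0] : exists g, g \in l.
  by case: (l) l0 => // h l' _; exists h; rewrite mem_head.
have Fp h : h \in g :: l -> face h (g + v).
  by move=> hl; have := orthos_face ogl hl; rewrite big_cons.
have Fm h : h \in - g :: l -> face h (- g + v).
  by move=> hl; have := orthos_face oNgl hl; rewrite big_cons.
have Zgv : Z g v by exact: orthos_sum.
have np : nv (g + v) = 1 by case: (Fp g (mem_head _ _)).
have nm : nv (- g + v) = 1 by case: (Fm (- g) (mem_head _ _)).
have Fl h : h \in l -> face h v by move=> hl; exact: orthos_face.
have nvv : nv v = 1 by case: (Fl _ gl0).
have hsum : 2^-1 + 2^-1 = 1 :> R by lra.
have h0 : 0 <= 2^-1 :> R by lra.
pose G h := h = g \/ h \in l.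
have GM h : G h -> M h by case=> [->//|/Ml].
have farv k : M k -> (forall h, G h -> Z k h) -> Z k v /\ Z k g.
  by move=> Mk H; split; [apply: orthos_far => // h hl|]; apply: H; [right|left].
have farp k psi a : M k -> supports k psi -> (forall h, G h -> Z k h) ->
    nv (a *: g + v) = 1 -> psi (D (a *: g + v)) = 0.
  move=> Mk Sp H n1; have [Zv Zg'] := farv _ Mk H.
  by apply: (sup_orth Mk Sp) => //; apply: (at_Zlin HA).
have eqv : D v = 2^-1 *: D (g + v) + 2^-1 *: D (- g + v).
  have im h : h \in l -> exists2 c, face h c & D c = 2^-1 *: D (g + v) + 2^-1 *: D (- g + v).
    move=> hl; apply: image_face_convex => //; first exact: Ml.
      by apply: Fp; rewrite in_cons hl orbT.
    by apply: Fm; rewrite in_cons hl orbT.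
  have [c Fc Dc] := im _ gl0; have nc : nv c = 1 by case: Fc.
  have e : v + (c - v) = c by lv.
  suff /eqP : c - v = 0 by rewrite subr_eq0 -Dc => /eqP ->.
  apply: (@orthogonal_part_eq0 G v) => //; rewrite ?e //.
  (* For [g] itself: [D c] is a midpoint, so [c] is within 1 of both [g + v] and [- g + v]. This is
     [metric_part] with coefficient 0. *)
  - move=> h [->|hl].
      rewrite -[c - v]subr0 -[X in _ - X](scale0r g); apply: metric_part => //.
        rewrite subr0; have -> : c - v - g = c - (g + v) by lv.
        rewrite -D_iso // Dc.
        have -> : 2^-1 *: D (g + v) + 2^-1 *: D (- g + v) - D (g + v)
            = 2^-1 *: (D (- g + v) - D (g + v)) by lmod_with Y R; field.
        rewrite (is_normZ HY) D_iso //.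
        have -> : - g + v - (g + v) = (- 2) *: g by lv.
        by rewrite (is_normZ HV) (at_norm HA) // normrN !ger0_norm; lra.
      rewrite addr0; have -> : c - v + g = c - (- g + v) by lv.
      rewrite -D_iso // Dc.
      have -> : 2^-1 *: D (g + v) + 2^-1 *: D (- g + v) - D (- g + v)
            = 2^-1 *: (D (g + v) - D (- g + v)) by lmod_with Y R; field.
      rewrite (is_normZ HY) D_iso //.
      have -> : g + v - (- g + v) = 2 *: g by lv.
      by rewrite (is_normZ HV) (at_norm HA) // !ger0_norm; lra.
    have [x Fx Dx] := im _ hl.
    have -> : c = x by apply: D_inj => //; [by case: Fx|rewrite Dx].
    have -> : x - v = (x - h) - (v - h) by lv.
    apply: ZB; [exact: Ml| |exact: orthos_rest].
    by case: Fx => nx px; apply: (at_face HA) => //; [exact: Ml|rewrite nx].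
  - by move=> k Mk H; case: (farv k Mk H).
  - move=> k psi Mk Sp H; rewrite Dc; apply: (halves_sup Sp).
      by have := farp k psi 1 Mk Sp H; rewrite scale1r; apply.
    by have := farp k psi (-1) Mk Sp H; rewrite scaleN1r; apply.
have nm' : nv (g - v) = 1 by rewrite (norm_sub HV) addrC.
have eqg : D g = 2^-1 *: D (g + v) + 2^-1 *: D (g - v).
  have Fgm : face g (g - v).
    apply: face_Z => //; first exact: ZN.
    by rewrite norm_opp // nvv.
  have [c Fc Dc] : exists2 c, face g c & D c = 2^-1 *: D (g + v) + 2^-1 *: D (g - v).
    by apply: image_face_convex => //; apply: Fp; rewrite mem_head.
  have nc : nv c = 1 by case: Fc.
  have n1 : nv (c - g - v) <= 1.
    have -> : c - g - v = c - (g + v) by lv.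
    rewrite -D_iso // Dc.
    have -> : 2^-1 *: D (g + v) + 2^-1 *: D (g - v) - D (g + v)
            = 2^-1 *: (D (g - v) - D (g + v)) by lmod_with Y R; field.
    rewrite (is_normZ HY) D_iso //.
    have -> : g - v - (g + v) = (- 2) *: v by lv.
    by rewrite (is_normZ HV) nvv normrN !ger0_norm; lra.
  have n2 : nv (c - g + v) <= 1.
    have -> : c - g + v = c - (g - v) by lv.
    rewrite -D_iso // Dc.
    have -> : 2^-1 *: D (g + v) + 2^-1 *: D (g - v) - D (g - v)
            = 2^-1 *: (D (g + v) - D (g - v)) by lmod_with Y R; field.
    rewrite (is_normZ HY) D_iso //.
    have -> : g + v - (g - v) = 2 *: v by lv.
    by rewrite (is_normZ HV) nvv !ger0_norm; lra.
  have e : g + (c - g) = c by lv.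
  suff /eqP : c - g = 0 by rewrite subr_eq0 -Dc => /eqP ->.
  apply: (@orthogonal_part_eq0 G g) => //; rewrite ?e //.
  - move=> h [->|hl].
      by case: Fc => _ pc; apply: (at_face HA) => //; rewrite nc.
    have Mh := Ml _ hl; have [_ pv] := Fl _ hl.
    have p0 : phi h (c - g) = 0.
      have := at_phi_le HA (c - g + v) Mh; rewrite phiD // pv.
      have := at_phi_le HA (- (c - g - v)) Mh.
      by rewrite (norm_opp HV) phiN // phiB // pv; lra.
    have -> : c - g = (c - g + v - h) - (v - h) by lv.
    apply: ZB => //; last exact: orthos_rest.
    by apply: (at_face HA) => //; rewrite phiD // p0 pv add0r.
  - by move=> k Mk H; case: (farv k Mk H).
  - move=> k psi Mk Sp H; rewrite Dc; apply: (halves_sup Sp).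
      by have := farp k psi 1 Mk Sp H; rewrite scale1r; apply.
    have [Zv Zg'] := farv k Mk H.
    by apply: (sup_orth Mk Sp) => //; apply: ZB.
have opp : D (- g + v) = - D (g - v).
  have := D_opp_tripotent oNgl; rewrite big_cons -/v.
  rewrite opprD opprK => ->; first by rewrite opprK.
  by [].
by rewrite {1}eqg {1}eqv opp; lmod_with Y R; field.
Qed.


Lemma unit_atom a g : `|a| = 1 -> M g ->
  [/\ M (a *: g), forall x, Z g x -> Z (a *: g) x,
      forall x, Z (a *: g) x -> Z g x & D (a *: g) = a *: D g].
Proof.
move=> a1 Mg; have [a0|a0] := lerP 0 a.
  move: a1; rewrite ger0_norm // => ->; rewrite !scale1r; split=> // x.
move: a1; rewrite ltr0_norm // => a1; have -> : a = -1 by lra.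
rewrite !scaleN1r; split=> [|x|x|].
- exact: (at_opp HA).
- exact: (at_ZN HA).
- by have MN := at_opp HA Mg; move/(at_ZN HA MN); rewrite opprK.
- exact: D_opp_atom.
Qed.

Lemma orthos_perm s t : perm_eq s t -> orthos s -> orthos t.
Proof.
move=> st [us Ms Zs]; have mst := perm_mem st; split.
- by rewrite -(perm_uniq st).
- by move=> x; rewrite -mst; exact: Ms.
- by move=> x y; rewrite -!mst; exact: Zs.
Qed.

Definition comb (l : seq (R * V)) : V := \sum_(p <- l) p.1 *: p.2.
Definition combD (l : seq (R * V)) : Y := \sum_(p <- l) p.1 *: D p.2.

Lemma comb_Z g l : M g -> (forall p, p \in l -> Z g p.2) -> Z g (comb l).
Proof.
move=> Mg Zg; rewrite /comb big_seq; elim/big_ind: _ => //; first exact: (at_Z0 HA).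
  by move=> x y; exact: ZD.
by move=> p pl; apply: ZZ => //; exact: Zg.
Qed.

Lemma comb_norm l : orthos (unzip2 l) -> (forall p, p \in l -> `|p.1| <= 1) ->
  nv (comb l) <= 1.
Proof.
elim: l => [|p l IH] ol bl; first by rewrite /comb big_nil norm_zero.
have [Mp Zp ol'] := orthos_cons ol.
rewrite /comb big_cons; apply: (at_Znorm HA) => //.
- by apply: comb_Z => // q ql; apply: Zp; exact: map_f.
- by apply: bl; rewrite mem_head.
- by apply: IH => // q ql; apply: bl; rewrite in_cons ql orbT.
Qed.

Definition crem (p : R * V) l : seq (R * V) := rem p l.

Lemma comb_rem p l : p \in l -> orthos (unzip2 l) ->
  [/\ perm_eq l (p :: crem p l), comb l = p.1 *: p.2 + comb (crem p l),
      combD l = p.1 *: D p.2 + combD (crem p l), M p.2 &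
      orthos (unzip2 (crem p l)) /\ forall q, q \in crem p l -> Z p.2 q.2].
Proof.
move=> pl ol; have pe := perm_to_rem pl.
have [Mp Zp ol'] : [/\ M p.2, forall h, h \in unzip2 (crem p l) -> Z p.2 h
    & orthos (unzip2 (crem p l))].
  by apply: orthos_cons; apply: orthos_perm ol; exact: (perm_map (@snd R V) pe).
split=> //.
- by rewrite /comb (perm_big _ pe) big_cons.
- by rewrite /combD (perm_big _ pe) big_cons.
- by split=> // q qr; apply: Zp; exact: map_f.
Qed.

Lemma comb_face p l : p \in l -> orthos (unzip2 l) -> (forall q, q \in l -> `|q.1| <= 1) ->
  `|p.1| = 1 -> face (p.1 *: p.2) (comb l).
Proof.
move=> pl ol bl p1; have [pe -> _ Mp [ol' Zp]] := comb_rem pl ol.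
have [Mu Zu _ _] := unit_atom p1 Mp.
apply: face_Z => //; first by apply: Zu; exact: comb_Z.
by apply: comb_norm => // q qr; apply: bl; rewrite (mem_rem qr).
Qed.

Lemma sup_combD k psi l : M k -> supports k psi ->
  orthos (unzip2 l) -> (forall p, p \in l -> Z k p.2) -> psi (combD l) = 0.
Proof.
move=> Mk Sp [_ Ml _] Zl; rewrite /combD big_seq.
elim/big_ind: _ => [|x y px py|p pl]; first exact: (sup0 Sp).
  by rewrite (supD Sp) px py addr0.
rewrite (supZ Sp) (sup_orth Mk Sp) ?mulr0 //; first exact: Zl.
by apply: (at_norm HA); apply: Ml; exact: map_f.
Qed.

Lemma D_comb_unit l : orthos (unzip2 l) -> (forall p, p \in l -> `|p.1| = 1) ->
  l <> [::] -> D (comb l) = combD l.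
Proof.
elim: l => // p l IH ol bl _; have [Mp Zp ol'] := orthos_cons ol.
have bl' q : q \in l -> `|q.1| = 1 by move=> ql; apply: bl; rewrite in_cons ql orbT.
have p1 : `|p.1| = 1 by apply: bl; rewrite mem_head.
have [Mu Zu Zu' Du] := unit_atom p1 Mp.
rewrite /comb /combD !big_cons; have [->|/eqP l0] := eqVneq l [::].
  by rewrite !big_nil !addr0.
rewrite -Du -/(comb l) -/(combD l) -IH //.
pose scaled l := [seq q.1 *: q.2 | q : R * V <- l].
have os : orthos (scaled l).
  elim: l ol' bl' {IH ol bl Zp l0} => [|q l IH] ol bl; first by split.
  have [Mq Zq ol'] := orthos_cons ol.
  have [Mq' Zq' _ _] : [/\ M (q.1 *: q.2), forall x, Z q.2 x -> Z (q.1 *: q.2) x,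
      forall x, Z (q.1 *: q.2) x -> Z q.2 x & D (q.1 *: q.2) = q.1 *: D q.2].
    by apply: unit_atom => //; apply: bl; rewrite mem_head.
  apply: orthos_consI => //; last first.
    by apply: IH => // r rl; apply: bl; rewrite in_cons rl orbT.
  by move=> _ /mapP[r rl ->]; apply: Zq'; apply: ZZ => //; apply: Zq; exact: map_f.
have := @D_add_tripotent (p.1 *: p.2) (scaled l); rewrite /scaled big_map; apply.
  apply: orthos_consI => // _ /mapP[r rl ->]; apply: Zu; apply: ZZ => //; apply: Zp.
  exact: map_f.
by case: (l) l0.
Qed.

(* The coefficients that are not [1] or [-1] are convex combinations of them;
   moving one such coefficient at a time stays in a face. *)
Lemma D_comb l : orthos (unzip2 l) -> (forall p, p \in l -> `|p.1| <= 1) ->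
  (exists2 p, p \in l & `|p.1| = 1) -> D (comb l) = combD l.
Proof.
move En : (count (fun p : R * V => `|p.1| != 1) l) => n.
elim: n l En => [|n IH] l En ol bl [q0 ql0 q01].
  apply: D_comb_unit => // [p pl|l0]; last by rewrite l0 in ql0.
  apply/eqP; apply/negPn/negP => np.
  have : has (fun p : R * V => `|p.1| != 1) l by apply/hasP; exists p.
  by rewrite has_count En.
(* Changing the coefficient of [p] to [1] or [-1] leaves one non-unit coefficient fewer, so the
   induction hypothesis holds at both ends; [q0] keeps them on the sphere. *)
have ends p : p \in l -> `|p.1| != 1 ->
  let w := comb (crem p l) in
  [/\ D (p.2 + w) = D p.2 + combD (crem p l), D (- p.2 + w) = - D p.2 + combD (crem p l),
      forall q, q \in l -> `|q.1| = 1 ->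
        face (q.1 *: q.2) (p.2 + w) /\ face (q.1 *: q.2) (- p.2 + w)
    & M p.2 /\ Z p.2 w].
  move=> pl p1 /=; have [pe ce cDe Mp [ol' Zp]] := comb_rem pl ol.
  have qr q : q \in l -> `|q.1| = 1 -> q \in crem p l.
    move=> ql q1; move: ql; rewrite (perm_mem pe) in_cons => /predU1P[qp|//].
    by rewrite -qp q1 eqxx in p1.
  have br q : q \in crem p l -> `|q.1| <= 1 by move=> /mem_rem; exact: bl.
  pose ls a := (a, p.2) :: crem p l.
  have os a : orthos (unzip2 (ls a)).
    apply: orthos_consI => //= h /mapP[r rr ->]; exact: Zp.
  have bs a : `|a| = 1 -> forall q, q \in ls a -> `|q.1| <= 1.
    by move=> a1 q; rewrite in_cons => /predU1P[->|/br //]; rewrite /= a1.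
  have cs a : `|a| = 1 -> count (fun p : R * V => `|p.1| != 1) (ls a) = n.
    move=> a1; rewrite /= a1 eqxx add0n; apply/eqP; rewrite -eqSS -En.
    by rewrite (permP pe) /= p1.
  have Ds a : `|a| = 1 -> D (comb (ls a)) = combD (ls a).
    move=> a1; apply: IH => //; [exact: cs|exact: bs|].
    by exists q0; rewrite // in_cons qr ?orbT.
  have Fs a q : `|a| = 1 -> q \in l -> `|q.1| = 1 -> face (q.1 *: q.2) (comb (ls a)).
    by move=> a1 ql q1; apply: comb_face => //; [rewrite in_cons qr ?orbT|exact: bs].
  have e1 : comb (ls 1) = p.2 + comb (crem p l) by rewrite /comb big_cons scale1r.
  have e2 : comb (ls (-1)) = - p.2 + comb (crem p l) by rewrite /comb big_cons scaleN1r.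
  split.
  - by rewrite -e1 Ds ?normr1 // /combD big_cons scale1r.
  - by rewrite -e2 Ds ?normrN1 // /combD big_cons scaleN1r.
  - by move=> q ql q1; rewrite -e1 -e2; split; apply: Fs; rewrite ?normr1 ?normrN1.
  - by split=> //; exact: comb_Z.
have [p0 pl0 p01] : exists2 p, p \in l & `|p.1| != 1.
  by apply/hasP; rewrite has_count En.
pose y := combD l.
(* [y] is the combination of the two end images with weights [(1 + p0.1) / 2] and
   [(1 - p0.1) / 2]. *)
have imy q : q \in l -> `|q.1| = 1 -> exists2 c, face (q.1 *: q.2) c & D c = y.
  move=> ql q1; have [E1 E2 F _] := ends p0 pl0 p01; have [F1 F2] := F q ql q1.
  have [Mu _ _ _] : [/\ M (q.1 *: q.2), forall x, Z q.2 x -> Z (q.1 *: q.2) x,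
      forall x, Z (q.1 *: q.2) x -> Z q.2 x & D (q.1 *: q.2) = q.1 *: D q.2].
    by apply: unit_atom => //; have [_ _ _ ? _] := comb_rem ql ol.
  have /andP[am aM] : -1 <= p0.1 <= 1 by rewrite -ler_norml; exact: bl.
  have [|||c Fc Dc] := @image_face_convex _ _ _ (2^-1 * (1 + p0.1)) (2^-1 * (1 - p0.1))
      Mu F1 F2; [lra|lra|lra|].
  exists c => //; rewrite Dc E1 E2 /y; have [_ _ -> _ _] := comb_rem pl0 ol.
  by lmod_with Y R; field.
have [c Fc Dc] := imy _ ql0 q01; have nc : nv c = 1 by case: Fc.
have cZ p : p \in l -> Z p.2 (c - comb l).
  move=> pl; have [_ ce cDe Mp [ol' Zp]] := comb_rem pl ol.
  have [p1|p1] := eqVneq `|p.1| 1.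
    have [Mu Zu Zu' _] := unit_atom p1 Mp.
    have [x Fx Dx] := imy _ pl p1.
    have -> : c = x by apply: D_inj => //; [case: Fx|rewrite Dx].
    apply: Zu'; rewrite ce.
    have -> : x - (p.1 *: p.2 + comb (crem p l)) = (x - p.1 *: p.2) - comb (crem p l) by lv.
    apply: ZB => //; last by apply: Zu; exact: comb_Z.
    by case: Fx => nx px; apply: (at_face HA) => //; rewrite nx.
  (* The distances from [c] to the two ends are [1 - p.1] and [1 + p.1], exactly what [metric_part]
     requires for the coefficient [p.1]. *)
  have [E1 E2 F [_ Zw]] := ends p pl p1; have [Fp Fm] := F _ ql0 q01.
  have /andP[am aM] : -1 <= p.1 <= 1 by rewrite -ler_norml; exact: bl.
  have n1 : nv (p.2 + comb (crem p l)) = 1 by case: Fp.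
  have n2 : nv (- p.2 + comb (crem p l)) = 1 by case: Fm.
  rewrite ce; have -> : c - (p.1 *: p.2 + comb (crem p l))
    = (c - comb (crem p l)) - p.1 *: p.2 by lv.
  have nDp : ny (D p.2) = 1 by rewrite D_sphere // (at_norm HA).
  apply: metric_part => //.
    have -> : c - comb (crem p l) - p.2 = c - (p.2 + comb (crem p l)) by lv.
    rewrite -D_iso // Dc E1 /y cDe.
    have -> : p.1 *: D p.2 + combD (crem p l) - (D p.2 + combD (crem p l))
      = (p.1 - 1) *: D p.2 by ly.
    by rewrite (is_normZ HY) nDp ler0_norm; lra.
  have -> : c - comb (crem p l) + p.2 = c - (- p.2 + comb (crem p l)) by lv.
  rewrite -D_iso // Dc E2 /y cDe.
  have -> : p.1 *: D p.2 + combD (crem p l) - (- D p.2 + combD (crem p l))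
    = (p.1 + 1) *: D p.2 by ly.
  by rewrite (is_normZ HY) nDp ger0_norm; lra.
have e : comb l + (c - comb l) = c by lv.
suff /eqP : c - comb l = 0 by rewrite subr_eq0 -/y -Dc => /eqP ->.
apply: (@orthogonal_part_eq0 (fun g => g \in unzip2 l) (comb l)) => //; rewrite ?e //.
- by case: ol.
- by move=> _ /mapP[p pl ->]; exact: cZ.
- by move=> k Mk H; apply: comb_Z => // p pl; apply: H; exact: map_f.
- move=> k psi Mk Sp H; rewrite Dc; apply: (sup_combD Mk Sp) => // p pl.
  by apply: H; exact: map_f.
Qed.

Lemma comb_unit_norm l : orthos (unzip2 l) -> (forall p, p \in l -> `|p.1| <= 1) ->
  (exists2 p, p \in l & `|p.1| = 1) -> nv (comb l) = 1.
Proof. by move=> ol bl [p pl p1]; case: (comb_face pl ol bl p1). Qed.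

Definition ext (x : V) : Y := nv x *: D ((nv x)^-1 *: x).

Lemma ext_sphere x : nv x = 1 -> ext x = D x.
Proof. by move=> nx; rewrite /ext nx invr1 !scale1r. Qed.

Lemma ext0 : ext 0 = 0.
Proof. by rewrite /ext norm_zero // scale0r. Qed.

Lemma extZ_pos a x : 0 <= a -> ext (a *: x) = a *: ext x.
Proof.
rewrite le_eqVlt => /predU1P[<-|a0]; first by rewrite !scale0r ext0.
have [->|/eqP x0] := eqVneq x 0; first by rewrite scaler0 ext0 scaler0.
have nx := norm_gt0 HV x0.
rewrite /ext (is_normZ HV) gtr0_norm // !scalerA; congr (_ *: D (_ *: _)).
by field; rewrite !gt_eqF.
Qed.

Lemma norm_unit x : x <> 0 -> nv ((nv x)^-1 *: x) = 1.
Proof.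
move=> x0; have nx := norm_gt0 HV x0.
by rewrite (is_normZ HV) ger0_norm ?invr_ge0 ?norm_pos // mulVf ?gt_eqF.
Qed.

Lemma ext_norm x : ny (ext x) = nv x.
Proof.
have [->|/eqP x0] := eqVneq x 0; first by rewrite ext0 (norm_zero HV) norm_zero.
by rewrite /ext (is_normZ HY) D_sphere ?norm_unit // mulr1 ger0_norm ?norm_pos.
Qed.

Lemma ext_comb2 g h a b : M g -> M h -> Z g h ->
  ext (a *: g + b *: h) = a *: D g + b *: D h.
Proof.
move=> Mg Mh Zgh; pose m := Num.max `|a| `|b|.
have [m0|m0] := lerP m 0.
  have /andP[] : (a == 0) && (b == 0).
    move: m0; rewrite /m ge_max !normr_le0 => /andP[/eqP -> /eqP ->].
    by rewrite !eqxx.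
  by move=> /eqP -> /eqP ->; rewrite !scale0r !addr0 ext0.
pose l := [:: (m^-1 * a, g); (m^-1 * b, h)].
have ol : orthos (unzip2 l).
  apply: orthos_consI => //= [k|]; first by rewrite inE => /eqP ->.
  by split=> // [x|x y]; rewrite inE => /eqP -> //; rewrite inE => /eqP ->.
have bl p : p \in l -> `|p.1| <= 1.
  rewrite !inE => /orP[] /eqP -> /=; rewrite normrM (@gtr0_norm _ m^-1) ?invr_gt0 //;
    by rewrite ler_pdivrMl // mulr1 /m le_max lexx ?orbT.
have ul : exists2 p, p \in l & `|p.1| = 1.
  have mm : m = `|a| \/ m = `|b|.
    by rewrite /m /Num.max; case: ifP => _; [right|left].
  case: mm => mE; [exists (m^-1 * a, g)|exists (m^-1 * b, h)]; rewrite ?inE ?eqxx ?orbT //=;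
    by rewrite normrM (@gtr0_norm _ m^-1) ?invr_gt0 // -mE mulVf ?gt_eqF.
have e : a *: g + b *: h = m *: comb l.
  by rewrite /comb !big_cons big_nil /=; lmod_with V R; field; rewrite gt_eqF.
rewrite e extZ_pos ?ltW // ext_sphere ?comb_unit_norm // D_comb //.
by rewrite /combD !big_cons big_nil /=; lmod_with Y R; field; rewrite gt_eqF.
Qed.

(** In the application [h] is ['i *: g], and the circle consists of the unimodular multiples of
    [g]. *)
Definition circle g h : Prop := forall a b, a ^+ 2 + b ^+ 2 = 1 ->
  [/\ M (a *: g + b *: h), forall x, Z g x -> Z (a *: g + b *: h) x
    & forall x, Z (a *: g + b *: h) x -> Z g x].

Lemma circle_scale g h a b : circle g h ->
  exists r u, [/\ a *: g + b *: h = r *: u, 0 <= r, M u, (forall x, Z g x -> Z u x)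
    & (forall x, Z u x -> Z g x) /\ r <= `|a| + `|b|].
Proof.
move=> cgh; have Mg : M g.
  have [] := cgh 1 0; last by rewrite scale1r scale0r addr0.
  by rewrite expr1n expr0n /= addr0.
have [ab0|ab0] := eqVneq (a ^+ 2 + b ^+ 2) 0.
  have [a0 b0] : a = 0 /\ b = 0.
    by have := sqr_ge0 a; have := sqr_ge0 b; split; apply/eqP; rewrite -sqrf_eq0; apply/eqP; lra.
  have e0 : a *: g + b *: h = 0 *: g by rewrite a0 b0 !scale0r addr0.
  by exists 0, g; do !split=> //; rewrite addr_ge0.
pose r := Num.sqrt (a ^+ 2 + b ^+ 2).
have r2 : r ^+ 2 = a ^+ 2 + b ^+ 2 by rewrite sqr_sqrtr // addr_ge0 ?sqr_ge0.
have r0 : 0 < r by rewrite sqrtr_gt0 lt_neqAle eq_sym ab0 addr_ge0 ?sqr_ge0.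
exists r, ((a / r) *: g + (b / r) *: h).
have [] := cgh (a / r) (b / r).
  by rewrite !expr_div_n -mulrDl -r2 divff // expf_eq0 /= gt_eqF.
move=> Mu Zu Zu'; have r0' := ltW r0.
have e0 : a *: g + b *: h = r *: ((a / r) *: g + (b / r) *: h).
  by lmod_with V R; field; rewrite gt_eqF.
do !split=> //; rewrite -(@ler_pXn2r _ 2) // ?nnegrE ?addr_ge0 // ?(ltW r0) //.
rewrite r2 sqrrD !real_normK ?num_real // lerD2r lerDl.
by apply: mulrn_wge0; apply: mulr_ge0.
Qed.

(** Adding [k] moves the plane of [g] and [h] into the face of [k], whose image is convex. The
    midpoint of [D (k + c *: g)] and [D (k + d *: h)] is shown to be the image of the midpoint [w],
    and [ext_comb2] splits [k] off again. *)
Lemma ext_circle g h k a b : M k -> Z k g -> circle g h ->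
  ext (a *: g + b *: h) = a *: D g + b *: D h.
Proof.
move=> Mk Zkg cgh.
have Mg : M g.
  have [] := cgh 1 0; last by rewrite scale1r scale0r addr0.
  by rewrite expr1n expr0n /= addr0.
have [Mh Zh Zh'] : [/\ M h, forall x, Z g x -> Z h x & forall x, Z h x -> Z g x].
  have [] := cgh 0 1; last by rewrite scale1r scale0r add0r.
  by rewrite expr1n expr0n /= add0r.
have Zkh : Z k h by apply: (at_sym HA) => //; apply: Zh; exact: (at_sym HA).
suff small c d : `|c| <= 1 -> `|d| <= 1 ->
    ext (c *: g + d *: h) = c *: D g + d *: D h.
  pose m := 1 + `|a| + `|b|.
  have m0 : 0 < m by rewrite /m; have := normr_ge0 a; have := normr_ge0 b; lra.
  have sm x : `|x| <= m -> `|x / m| <= 1.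
    by move=> xm; rewrite normrM normfV (gtr0_norm m0) ler_pdivrMr // mul1r.
  have := small (a / m) (b / m).
  move=> /(_ (sm _ _) (sm _ _)) H.
  have -> : a *: g + b *: h = m *: ((a / m) *: g + (b / m) *: h).
    by lmod_with V R; field; rewrite gt_eqF.
  rewrite extZ_pos ?ltW // H; first by lmod_with Y R; field; rewrite gt_eqF.
    by rewrite /m; have := normr_ge0 b; lra.
  by rewrite /m; have := normr_ge0 a; lra.
move=> c1 d1; have [r [u [eu r0 Mu Zu [Zu' rcd]]]] := circle_scale c d cgh.
have [s [v [ev s0 Mv Zv [Zv' scd]]]] := circle_scale c (- d) cgh.
have r2 : 2^-1 * r <= 1 by lra.
have s2 : 2^-1 * s <= 1 by move: scd; rewrite normrN; lra.
have Zku : Z k u by apply: (at_sym HA) => //; apply: Zu; exact: (at_sym HA).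
have Fz x : Z k x -> nv x <= 1 -> face k (k + x) by move=> *; exact: face_Z.
have nh t y : M y -> `|t| <= 1 -> nv (t *: y) <= 1.
  by move=> My t1; rewrite (is_normZ HV) (at_norm HA) // mulr1.
have F1 : face k (k + c *: g) by apply: Fz; [exact: ZZ|exact: nh].
have F2 : face k (k + d *: h) by apply: Fz; [exact: ZZ|exact: nh].
have hr : `|2^-1 * r| <= 1 by rewrite ger0_norm; lra.
have F3 : face k (k + (2^-1 * r) *: u) by apply: Fz; [exact: ZZ|exact: nh].
have Dk t y : M y -> Z k y -> `|t| <= 1 -> D (k + t *: y) = D k + t *: D y.
  move=> My Zky t1; have := ext_comb2 1 t Mk My Zky; rewrite !scale1r => <-.
  by rewrite ext_sphere //; case: (Fz (t *: y)) => //; [exact: ZZ|exact: nh].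
have [|||x Fx Dx] := @image_face_convex _ _ _ 2^-1 2^-1 Mk F1 F2; [lra|lra|lra|].
have [n1 _] := F1; have [n2 _] := F2; have [nx px] := Fx.
pose w := k + (2^-1 * r) *: u.
have wE : w = k + 2^-1 *: (c *: g + d *: h) by rewrite /w eu scalerA.
have ZgE : Z k (x - k) by apply: (at_face HA) => //; rewrite nx.
have ZV y : Z k y -> Z k (2^-1 *: y) by exact: ZZ.
have e : w + (x - w) = x by lv.
have nD1 : nv (x - (k + c *: g)) <= 2^-1 * s.
  rewrite -D_iso // Dx.
  have -> : 2^-1 *: D (k + c *: g) + 2^-1 *: D (k + d *: h) - D (k + c *: g)
    = 2^-1 *: (D (k + d *: h) - D (k + c *: g)) by lmod_with Y R; field.
  rewrite (is_normZ HY) D_iso // (norm_sub HV).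
  have -> : k + c *: g - (k + d *: h) = c *: g + (- d) *: h by lv.
  by rewrite ev (is_normZ HV) (at_norm HA) // !ger0_norm; lra.
have nD2 : nv (x - (k + d *: h)) <= 2^-1 * s.
  rewrite -D_iso // Dx.
  have -> : 2^-1 *: D (k + c *: g) + 2^-1 *: D (k + d *: h) - D (k + d *: h)
    = 2^-1 *: (D (k + c *: g) - D (k + d *: h)) by lmod_with Y R; field.
  rewrite (is_normZ HY) D_iso //.
  have -> : k + c *: g - (k + d *: h) = c *: g + (- d) *: h by lv.
  by rewrite ev (is_normZ HV) (at_norm HA) // !ger0_norm; lra.
have ev2 : 2^-1 *: (c *: g) - 2^-1 *: (d *: h) = (2^-1 * s) *: v.
  by rewrite -[(2^-1 * s) *: v]scalerA -ev; lv.
(* The two ends are [w + (s/2) v] and [w - (s/2) v], and [x] is within [s/2] of both. After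
   rescaling this is [metric_part] at [v] with coefficient 0; the case [s = 0] cannot be
   rescaled. *)
have Zgx : Z g (x - w).
  have [s00|s00] := eqVneq s 0.
    have /(is_norm0_eq HV)/eqP : nv (x - (k + c *: g)) = 0.
      by apply/eqP; rewrite eq_le norm_pos // andbT; move: nD1; rewrite s00 mulr0.
    rewrite subr_eq0 wE => /eqP ->.
    have -> : k + c *: g - (k + 2^-1 *: (c *: g + d *: h))
        = 2^-1 *: (c *: g) - 2^-1 *: (d *: h) by lmod_with V R; field.
    by rewrite ev2 s00 mulr0 scale0r; exact: (at_Z0 HA).
  have sp : 0 < 2^-1 * s by rewrite mulr_gt0 ?invr_gt0 // ?ltr0n // lt_neqAle eq_sym s00.
  have scale y : nv y <= 2^-1 * s -> nv ((2^-1 * s)^-1 *: y) <= 1.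
    move=> yn; rewrite (is_normZ HV) ger0_norm ?invr_ge0 ?(ltW sp) //.
    by rewrite ler_pdivrMl // mulr1.
  apply: Zv'; have -> : x - w = (2^-1 * s) *: ((2^-1 * s)^-1 *: (x - w) - 0 *: v).
    by lmod_with V R; field; rewrite gt_eqF // -(pmulr_rgt0 s (x := 2^-1)) ?invr_gt0 ?ltr0n.
  apply: ZZ => //; apply: metric_part => //.
    have -> : (2^-1 * s)^-1 *: (x - w) - v = (2^-1 * s)^-1 *: (x - (k + c *: g)).
      have -> : v = (2^-1 * s)^-1 *: ((2^-1 * s) *: v).
        by rewrite scalerA mulVf ?scale1r // gt_eqF.
      by rewrite -ev2 wE; lmod_with V R; field; rewrite ?s00.
    by rewrite subr0; exact: scale.
  have -> : (2^-1 * s)^-1 *: (x - w) + v = (2^-1 * s)^-1 *: (x - (k + d *: h)).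
    have -> : v = (2^-1 * s)^-1 *: ((2^-1 * s) *: v).
      by rewrite scalerA mulVf ?scale1r // gt_eqF.
    by rewrite -ev2 wE; lmod_with V R; field; rewrite ?s00.
  by rewrite addr0; exact: scale.
have xw : x - w = 0.
  apply: (@orthogonal_part_eq0 (fun y => y = k \/ y = g) w); rewrite ?e //.
  - by move=> y [] ->.
  - move=> y [] -> //.
    have -> : x - w = (x - k) - (2^-1 * r) *: u by rewrite /w; lv.
    by apply: ZB => //; exact: ZZ.
  - move=> l Ml H; have Zlk : Z l k by apply: H; left.
    have Zlg : Z l g by apply: H; right.
    apply: ZD => //; apply: ZZ => //; apply: (at_sym HA) => //; apply: Zu.
    exact: (at_sym HA).
  - move=> l psi Ml Sp H; have Zlk : Z l k by apply: H; left.
    have Zlg : Z l g by apply: H; right.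
    have Zlh : Z l h by apply: (at_sym HA) => //; apply: Zh; exact: (at_sym HA).
    rewrite Dx; apply: (halves_sup Sp); apply: (sup_orth Ml Sp) => //;
      by apply: ZD => //; exact: ZZ.
move: xw => /eqP; rewrite subr_eq0 => /eqP xw.
move: Dx; rewrite xw /w !Dk // => H.
rewrite eu extZ_pos // ext_sphere ?(at_norm HA) //.
have -> : r *: D u = 2 *: ((D k + (2^-1 * r) *: D u) - D k) by lmod_with Y R; field.
by rewrite H; lmod_with Y R; field.
Qed.

Lemma ext_flat g g' h h' a a' b b' : M g -> M h -> Z g h -> circle g g' -> circle h h' ->
  ext (a *: g + a' *: g' + (b *: h + b' *: h')) =
  a *: D g + a' *: D g' + (b *: D h + b' *: D h').
Proof.
move=> Mg Mh Zgh cg ch.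
have [r [u [eu r0 Mu Zu [Zu' _]]]] := circle_scale a a' cg.
have [s [v [ev s0 Mv Zv [Zv' _]]]] := circle_scale b b' ch.
have Zhg := at_sym HA Mg Mh Zgh.
have Zuv : Z u v.
  by apply: Zu; apply: (at_sym HA) => //; apply: Zv; exact: (at_sym HA).
rewrite -(ext_circle a a' Mh Zhg cg) -(ext_circle b b' Mg Zgh ch).
by rewrite eu ev ext_comb2 // !extZ_pos // !ext_sphere // (at_norm HA).
Qed.

(* Two functions of [t] touching at [0] up to [O(t^2)] have the same slope. *)
Lemma quadratic_slope (a b C : R) :
  (forall t, `|t| <= 1 -> t * a <= t * b + C * t ^+ 2) -> a = b.
Proof.
move=> H; apply/eqP; rewrite -subr_eq0; apply/negPn/negP => ab.
(* [k] exceeds [C], so that the quadratic term cannot make up for the difference of slopes, and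
   [|a - b|], so that [|t| <= 1]. *)
pose k := `|C| + `|a - b| + 1; pose t := (a - b) / k.
have k0 : 0 < k by rewrite /k; have := normr_ge0 C; have := normr_ge0 (a - b); lra.
have t1 : `|t| <= 1.
  rewrite /t normrM normfV (gtr0_norm k0) ler_pdivrMr // mul1r /k.
  by have := normr_ge0 C; lra.
have := H t t1; rewrite -subr_ge0.
have -> : t * b + C * t ^+ 2 - t * a = (a - b) ^+ 2 / k ^+ 2 * (C - k).
  by rewrite /t; field; rewrite gt_eqF.
apply/negP; rewrite -ltNge pmulr_rlt0 ?subr_lt0.
  by rewrite /k; have := ler_norm C; have := normr_ge0 (a - b); lra.
by apply: divr_gt0; [rewrite lt_neqAle eq_sym sqrf_eq0 ab sqr_ge0|exact: exprn_gt0].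
Qed.

Lemma support_of_additive e psi f : M e -> supports e psi ->
  (forall t, `|t| <= 1 -> ext (e + t *: f) = D e + t *: ext f) ->
  psi (ext f) = phi e f.
Proof.
move=> Me Sp H; have [C HC] := at_quad HA f Me.
apply: (@quadratic_slope _ _ C) => t t1.
have := sup_le Sp (ext (e + t *: f)); rewrite ext_norm H // (supD Sp) (supZ Sp).
have -> : psi (D e) = 1 by case: Sp => _ _; apply; exact: face_mem.
by have := HC t t1; lra.
Qed.

(** Additivity is known for [g] and [f] but not for [e] and [f]. The point [g + t *: f] is compared
    with the point [e - g] of the face of [e]: their sum is [e + t *: f], and [psi] vanishes at
    [D g]. *)
Lemma support_of_common_orth e f g psi : M e -> M f -> M g -> Z g e -> Z g f ->
  supports e psi -> psi (D f) = phi e f.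
Proof.
move=> Me Mf Mg Zge Zgf Sp; have [C HC] := at_quad HA f Me.
apply: (@quadratic_slope _ _ C) => t t1.
have ng : nv (t *: f) <= 1 by rewrite (is_normZ HV) (at_norm HA) // mulr1.
have [n1 _] : face g (g + t *: f) by apply: face_Z => //; exact: ZZ.
have Zeg := at_sym HA Mg Me Zge.
have Fe : face e (e - g).
  apply: face_Z; rewrite ?(norm_opp HV) ?(at_norm HA) //; exact: ZN.
have := sup_upper Me Sp n1 Fe.
have -> : g + t *: f + (e - g) = e + t *: f by lv.
have := ext_comb2 1 t Mg Mf Zgf; rewrite !scale1r ext_sphere // => ->.
rewrite (supD Sp) (supZ Sp) (sup_orth Me Sp Zeg) ?(at_norm HA Mg) //.
by have := HC t t1; lra.
Qed.

Definition compatible : Prop := forall e f psi, M e -> M f -> supports e psi ->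
  psi (D f) = phi e f.

Hypothesis approx : forall x eps, nv x = 1 -> 0 < eps -> exists l,
  [/\ orthos (unzip2 l), forall p, p \in l -> `|p.1| <= 1,
      exists2 p, p \in l & `|p.1| = 1 & nv (x - comb l) <= eps].

Lemma compatible_sphere e psi x : compatible -> M e -> supports e psi -> nv x = 1 ->
  psi (D x) = phi e x.
Proof.
move=> cpt Me Sp nx; apply/eqP; rewrite -subr_eq0 -normr_eq0; apply/negPn/negP => n0.
have n1 : 0 < `|psi (D x) - phi e x| by rewrite lt_neqAle eq_sym n0 normr_ge0.
(* Both sides are 1-Lipschitz, so the two errors add up to at most two thirds of the gap. *)
have [|l [ol bl ul xl]] := @approx x (`|psi (D x) - phi e x| / 3) nx.
  by rewrite divr_gt0 // ltr0n.
have nl := comb_unit_norm ol bl ul.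
have E : psi (D (comb l)) = phi e (comb l).
  rewrite D_comb // /combD /comb; have [_ Ml _] := ol.
  elim: (l) Ml => [|p l' IH] Ml; first by rewrite !big_nil (sup0 Sp) phi0.
  rewrite !big_cons (supD Sp) (supZ Sp) (cpt e) // ?IH ?phiD ?phiZ //.
    by move=> y yl; apply: Ml; rewrite inE yl orbT.
  by apply: Ml; rewrite inE eqxx.
have b1 := sup_le Sp (D x - D (comb l)); have b2 := sup_le Sp (D (comb l) - D x).
move: b1 b2; rewrite !(supB Sp) !D_iso // [nv (comb l - x)]norm_sub //.
have := at_phi_le HA (x - comb l) Me; have := at_phi_le HA (comb l - x) Me.
rewrite [nv (comb l - x)]norm_sub // !phiB // E.
set A := psi (D x); set B := phi e x; set C := phi e (comb l); set n := nv _ => h1 h2 h3 h4.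
have : `|A - B| <= 2 * n by rewrite ler_norml; lra.
by move: xl n1; rewrite -/n -/A -/B; lra.
Qed.

Theorem ext_linear : compatible ->
  [/\ forall a x y, ext (a *: x + y) = a *: ext x + ext y,
      forall x y, ny (ext x - ext y) = nv (x - y),
      forall y, exists x, ext x = y & forall x, nv x = 1 -> ext x = D x].
Proof.
move=> cpt.
have E e psi x : M e -> supports e psi -> psi (ext x) = phi e x.
  move=> Me Sp; have [->|/eqP x0] := eqVneq x 0; first by rewrite ext0 (sup0 Sp) phi0.
  rewrite /ext (supZ Sp) (compatible_sphere cpt Me Sp) ?norm_unit // phiZ //.
  by rewrite mulrA divff ?mul1r // gt_eqF // norm_gt0.
have onto y : exists x, ext x = y.
  have [->|/eqP y0] := eqVneq y 0; first by exists 0; exact: ext0.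
  have ny0 := norm_gt0 HY y0.
  have [x nx Dx] : exists2 x, nv x = 1 & D x = (ny y)^-1 *: y.
    apply: D_onto; rewrite (is_normZ HY) ger0_norm ?invr_ge0 ?norm_pos //.
    by rewrite mulVf // gt_eqF.
  exists (ny y *: x); rewrite extZ_pos ?norm_pos // ext_sphere // Dx scalerA.
  by rewrite divff ?scale1r // gt_eqF.
(* [y] is some [ext x], and the functional of the leading atom of [x] takes the value [nv x]
   there. *)
have sep y : (forall e psi, M e -> supports e psi -> psi y = 0) -> y = 0.
  move=> H; have [x xy] := onto y; apply: contrapT => y0.
  have x0 : x <> 0 by move=> x0; apply: y0; rewrite -xy x0 ext0.
  have [e [Me Ze _]] := at_top HA x0.
  have [psi Sp] := supports_exists Me.
  have := H e psi Me Sp; rewrite -xy (E e) //.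
  have := at_phiZ HA Me Ze; rewrite phiB // phiZ // (at_phi1 HA) //.
  by have := norm_gt0 HV x0; lra.
have lin a x y : ext (a *: x + y) = a *: ext x + ext y.
  apply/eqP; rewrite -subr_eq0; apply/eqP; apply: sep => e psi Me Sp.
  by rewrite (supB Sp) (supD Sp) (supZ Sp) !(E e) // phiD // phiZ // subrr.
split=> // [x y|x nx]; last exact: ext_sphere.
have <- : ext (x - y) = ext x - ext y.
  by have := lin (-1) y x; rewrite !scaleN1r addrC [- _ + _ in RHS]addrC.
exact: ext_norm.
Qed.

End SphereIsometry.

(** * Day's theorem on the parallelogram law *)

Section DayTheorem.
Variables (R : realType) (V : lmodType R) (n : V -> R).
Hypothesis Hn : is_norm n.
Hypothesis par : forall u v, n u = 1 -> n v = 1 -> n (u + v) ^+ 2 + n (u - v) ^+ 2 = 4.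

Ltac lv := lmod_with V R; try ring.

Section Plane.
Variables p q : V.
Hypotheses (np : n p = 1) (nq : n q = 1) (npq : n (p + q) = n (p - q)).

Let P (t : R) := cos t *: p + sin t *: q.
Let m (t : R) := n (P t) ^+ 2.

Let mDpi t : m (t + pi) = m t.
Proof.
rewrite /m /P cosDpi sinDpi; have -> : - cos t *: p + - sin t *: q = - (cos t *: p + sin t *: q).
  by lv.
by rewrite (norm_opp Hn).
Qed.

Let unitP t : m t = 1 -> n (P t) = 1.
Proof.
move=> mt; apply/eqP; rewrite -(@eqrXn2 _ 2) ?ler01 ?(norm_pos Hn) //.
by rewrite expr1n; apply/eqP.
Qed.

(** Sum and difference of the points at [t - d] and [t + d] are multiples of the points at [t] and
    [t + pi / 2]. *)
Let bisect t d : m (t - d) = 1 -> m (t + d) = 1 ->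
  cos d ^+ 2 * m t + sin d ^+ 2 * m (t + pi / 2) = 1.
Proof.
move=> /unitP m1 /unitP m2; have := par m1 m2.
have -> : P (t - d) + P (t + d) = (2 * cos d) *: P t.
  by rewrite /P cosB cosD sinB sinD; lv.
have -> : P (t - d) - P (t + d) = (- 2 * sin d) *: P (t + pi / 2).
  by rewrite /P cosB cosD sinB sinD cosDpihalf sinDpihalf; lv.
rewrite !(is_normZ Hn) !exprMn !real_normK ?num_real // /m.
by set A := n _ ^+ 2; set B := n _ ^+ 2 => H; lra.
Qed.

Let theta k : R := pi / 2 / 2 ^+ k.

Let theta_gt0 k : 0 < theta k.
Proof. by rewrite /theta !divr_gt0 ?pi_gt0 ?exprn_gt0. Qed.

Let thetaS k : theta k = theta k.+1 + theta k.+1.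
Proof. by rewrite /theta exprS; field; rewrite expf_neq0 ?pnatr_eq0. Qed.

Let theta_le k : theta k.+1 < pi / 2.
Proof.
elim: k => [|k IH].
  by rewrite /theta expr1; have := pi_gt0 R; lra.
by have := thetaS k.+1; have := theta_gt0 k.+2; lra.
Qed.

Let grid1 (j : nat) : m (j%:R * theta 1) = 1.
Proof.
have p4 : m (theta 1) = 1 /\ m (theta 1 + pi / 2) = 1.
  have t1 : theta 1 + theta 1 = pi / 2 by rewrite -thetaS /theta expr0 divr1.
  have m0 : m (theta 1 - theta 1) = 1.
    by rewrite subrr /m /P cos0 sin0 scale1r scale0r addr0 np expr1n.
  have m2 : m (theta 1 + theta 1) = 1.
    by rewrite t1 /m /P cos_pihalf sin_pihalf scale1r scale0r add0r nq expr1n.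
  have H := bisect m0 m2.
  have c0 : cos (theta 1) = sin (theta 1).
    rewrite -cosBpihalf -cosN; congr cos; rewrite -t1; ring.
  have c1 : cos (theta 1) ^+ 2 = 2^-1.
    by have := cos2Dsin2 (theta 1); rewrite -c0; lra.
  have s1 : sin (theta 1) ^+ 2 = 2^-1 by rewrite -c0.
  (* At the angle [pi / 4] bisection only gives the sum of these two values; their equality comes
     from [npq]. *)
  have E : m (theta 1) = m (theta 1 + pi / 2).
    have cp : 0 < cos (theta 1).
      by apply: cos_gt0_pihalf; have := theta_gt0 1; have := theta_le 0; lra.
    have e1 : p + q = (2 * cos (theta 1)) *: P (theta 1).
      by rewrite /P -c0; lmod_with V R; lra.
    have e2 : p - q = (- 2 * cos (theta 1)) *: P (theta 1 + pi / 2).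
      by rewrite /P cosDpihalf sinDpihalf -c0; lmod_with V R; lra.
    have : n (p + q) = n (p - q) by [].
    rewrite e1 e2 !(is_normZ Hn) mulNr normrN => HE.
    rewrite /m; congr (_ ^+ 2); apply: mulfI HE.
    by rewrite normr_eq0 mulf_neq0 ?pnatr_eq0 // gt_eqF.
  by move: H; rewrite c1 s1 -E; lra.
have pi4 : pi = 4 * theta 1 by rewrite /theta expr1; field.
suff : [/\ m (j%:R * theta 1) = 1, m (j.+1%:R * theta 1) = 1,
    m (j.+2%:R * theta 1) = 1 & m (j.+3%:R * theta 1) = 1] by case.
elim: j => [|j [H1 H2 H3 H4]].
  rewrite mul0r mul1r; case: p4 => p1 p2; split=> //.
  - by rewrite /m /P cos0 sin0 scale1r scale0r addr0 np expr1n.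
  - have -> : 2 * theta 1 = pi / 2 by rewrite pi4; field.
    by rewrite /m /P cos_pihalf sin_pihalf scale1r scale0r add0r nq expr1n.
  - by have <- : theta 1 + pi / 2 = 3 * theta 1 by rewrite pi4; field.
split=> //; have -> : j.+4%:R * theta 1 = j%:R * theta 1 + pi.
  by rewrite pi4 -addn4 natrD; ring.
by rewrite mDpi.
Qed.

(** Bisection at [t] and at [t + pi / 2] gives two linear equations for [m t] and [m (t + pi / 2)],
    of determinant [cos (2 d)], which is positive once [d < pi / 4]. *)
Let grid k (j : nat) : m (j%:R * theta k.+1) = 1.
Proof.
elim: k j => [|k IH] j; first exact: grid1.
have [jo|je] := boolP (odd j); last first.
  have -> : j%:R * theta k.+2 = j./2%:R * theta k.+1.
    by rewrite [theta k.+1]thetaS -{1}(odd_double_half j) (negbTE je) add0n -muln2 natrM; ring.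
  exact: IH.
set t := _ * _; set d := theta k.+2.
have tE : t = j./2%:R * theta k.+1 + d.
  by rewrite /t [theta k.+1]thetaS -/d -{1}(odd_double_half j) jo /= -muln2 natrD natrM; ring.
have q2 : pi / 2 = (2 ^ k.+1)%:R * theta k.+1.
  by rewrite /theta natrX; field; rewrite expf_neq0 ?pnatr_eq0.
have g1 : m (t - d) = 1 by rewrite tE addrK.
have g2 : m (t + d) = 1.
  have -> : t + d = (j./2.+1)%:R * theta k.+1 by rewrite tE [theta k.+1]thetaS -/d -natr1; ring.
  exact: IH.
have g3 : m (t + pi / 2 - d) = 1.
  have -> : t + pi / 2 - d = (j./2 + 2 ^ k.+1)%:R * theta k.+1.
    by rewrite tE q2 natrD; ring.
  exact: IH.
have g4 : m (t + pi / 2 + d) = 1.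
  have -> : t + pi / 2 + d = (j./2.+1 + 2 ^ k.+1)%:R * theta k.+1.
    by rewrite tE q2 natrD -natr1 [theta k.+1]thetaS -/d; ring.
  exact: IH.
have H1 := bisect g1 g2; have H2 := bisect g3 g4.
have tpi : t + pi / 2 + pi / 2 = t + pi by field.
rewrite tpi mDpi in H2.
have c : cos (d + d) = cos d ^+ 2 - sin d ^+ 2 by rewrite cosD !expr2.
have c0 : 0 < cos (d + d).
  rewrite -thetaS; apply: cos_gt0_pihalf.
  by have := theta_gt0 k.+1; have := theta_le k; lra.
have E : m t = m (t + pi / 2).
  apply/eqP; rewrite -subr_eq0 -(mulrI_eq0 _ (mulfI (lt0r_neq0 c0))).
  by rewrite c; apply/eqP; lra.
by rewrite -E -mulrDl cos2Dsin2 mul1r in H1.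
Qed.

Let m1_ge0 t : 0 <= t -> m t = 1.
Proof.
move=> t0; suff H : n (P t) = 1 by rewrite /m H expr1n.
apply/eqP; rewrite -subr_eq0 -normr_eq0; apply/negPn/negP => ne.
have e0 : 0 < `|n (P t) - 1| / 2 by rewrite divr_gt0 // lt_neqAle eq_sym ne normr_ge0.
have /cvgrPdist_lt/(_ _ e0) /nbhs_ballP[d1 /= d10 H1] := @continuous_cos R t.
have /cvgrPdist_lt/(_ _ e0) /nbhs_ballP[d2 /= d20 H2] := @continuous_sin R t.
pose d := Num.min d1 d2; have d0 : 0 < d by rewrite lt_min d10.
pose k := Num.truncn (pi / 2 / d).
have kP : theta k.+1 < d.
  rewrite /theta ltr_pdivrMr ?exprn_gt0 // -ltr_pdivrMl // mulrC.
  have := truncnS_gt (pi / 2 / d); rewrite -/k => /lt_le_trans; apply.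
  by rewrite -natrX ler_nat ltnW // ltn_expl.
pose j := Num.truncn (t / theta k.+1).
have th := theta_gt0 k.+1.
have jt : `|t - j%:R * theta k.+1| < d.
  have /andP[j1 j2] : j%:R <= t / theta k.+1 < j.+1%:R.
    by apply: truncn_itv; rewrite divr_ge0 // ltW.
  rewrite ler_pdivlMr // in j1; rewrite ltr_pdivrMr // -natr1 mulrDl mul1r in j2.
  by rewrite ger0_norm; lra.
have b1 : `|cos t - cos (j%:R * theta k.+1)| < `|n (P t) - 1| / 2.
  by apply: H1; rewrite /ball /= (lt_le_trans jt) // ge_min lexx.
have b2 : `|sin t - sin (j%:R * theta k.+1)| < `|n (P t) - 1| / 2.
  by apply: H2; rewrite /ball /= (lt_le_trans jt) // ge_min lexx orbT.
have nj := unitP (grid k j).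
have eP : P t - P (j%:R * theta k.+1) =
    (cos t - cos (j%:R * theta k.+1)) *: p + (sin t - sin (j%:R * theta k.+1)) *: q.
  by rewrite /P; lv.
have b3 : n (P t - P (j%:R * theta k.+1)) < `|n (P t) - 1|.
  rewrite eP; apply: le_lt_trans (is_normD Hn _ _) _.
  by rewrite !(is_normZ Hn) np nq !mulr1; lra.
have := norm_leD Hn (P t) (P (j%:R * theta k.+1)).
have := norm_leD Hn (P (j%:R * theta k.+1)) (P t).
rewrite [n (P (j%:R * theta k.+1) - _)](norm_sub Hn) nj => b4 b5.
by move: b3; rewrite real_ltNge ?num_real // => /negP; apply; rewrite ler_norml; lra.
Qed.

Lemma plane_norm a b : n (a *: p + b *: q) ^+ 2 = a ^+ 2 + b ^+ 2.
Proof.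
have circ c d : c ^+ 2 + d ^+ 2 = 1 -> n (c *: p + d *: q) ^+ 2 = 1.
  move=> cd; have c1 : -1 <= c <= 1.
    by rewrite -ler_norml -(@ler_pXn2r _ 2) ?nnegrE // expr1n real_normK ?num_real // -cd lerDl sqr_ge0.
  pose t := acos c.
  have ct : cos t = c by rewrite /t acosK // in_itv.
  have t0 : 0 <= t by rewrite acos_ge0.
  have tp : t <= pi by rewrite acos_lepi.
  have st : sin t ^+ 2 = d ^+ 2 by have := cos2Dsin2 t; rewrite ct; lra.
  move/eqP: st; rewrite eqf_sqr => /orP[/eqP st|/eqP st].
    by have := m1_ge0 t0; rewrite /m /P ct st.
  have t1 : 0 <= pi - t by lra.
  have := m1_ge0 t1; rewrite /m /P cosB sinB cospi sinpi ct st.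
  rewrite -(norm_opp Hn); congr (n _ ^+ 2 = _); lv.
have [ab|ab] := eqVneq (a ^+ 2 + b ^+ 2) 0.
  have [-> ->] : a = 0 /\ b = 0.
    by have := sqr_ge0 a; have := sqr_ge0 b; split; apply/eqP; rewrite -sqrf_eq0; apply/eqP; lra.
  by rewrite !scale0r addr0 (norm_zero Hn) expr0n /= addr0.
have ab0 : 0 < a ^+ 2 + b ^+ 2 by rewrite lt_neqAle eq_sym ab addr_ge0 ?sqr_ge0.
pose r := Num.sqrt (a ^+ 2 + b ^+ 2).
have r2 : r ^+ 2 = a ^+ 2 + b ^+ 2 by rewrite sqr_sqrtr // ltW.
have r0 : 0 < r by rewrite sqrtr_gt0.
have -> : a *: p + b *: q = r *: ((a / r) *: p + (b / r) *: q).
  by lmod_with V R; field; rewrite gt_eqF.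
rewrite (is_normZ Hn) exprMn circ ?mulr1 ?real_normK ?num_real //.
by rewrite !expr_div_n -mulrDl -r2 divff // expf_eq0 /= gt_eqF.
Qed.

End Plane.

Lemma lipschitz_continuous_real (f : R -> R) (C : R) :
  (forall x y, `|f x - f y| <= C * `|x - y|) -> continuous f.
Proof.
move=> H x; apply/cvgrPdist_lt => e e0.
have C0 : 0 < `|C| + 1 by have := normr_ge0 C; lra.
apply/nbhs_ballP; exists (e / (`|C| + 1)) => /=; first exact: divr_gt0.
move=> y /= xy; apply: le_lt_trans (H x y) _.
move: xy; rewrite /ball /= ltr_pdivlMr // => xy.
apply: le_lt_trans _ xy; rewrite mulrC ler_wpM2l //.
by have := ler_norm C; lra.
Qed.

(* Day's theorem: the parallelogram law on the unit sphere makes the norm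
   Euclidean on each plane. *)
Lemma day_norm u v t : n u = 1 -> n v = 1 ->
  n (u + t *: v) ^+ 2 = 1 + t ^+ 2 + t * (n (u + v) ^+ 2 - 2).
Proof.
move=> nu nv.
have dep s : v = s *: u -> n (u + t *: v) ^+ 2 = 1 + t ^+ 2 + t * (n (u + v) ^+ 2 - 2).
  move=> vE; have s2 : s ^+ 2 = 1.
    move: nv; rewrite vE (is_normZ Hn) nu mulr1 => s1.
    by rewrite -[s ^+ 2]real_normK ?num_real // s1 expr1n.
  have lin c : u + c *: v = (1 + c * s) *: u by rewrite vE; lv.
  have -> : u + v = (1 + s) *: u by have := lin 1; rewrite scale1r mul1r.
  rewrite lin !(is_normZ Hn) nu !mulr1 !real_normK ?num_real //; ring: s2.
have [[s /dep //]|indep] := pselect (exists s, v = s *: u).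
(* [plane_norm] requires a unit vector [q] with [n (u + q) = n (u - q)]. It is sought among the
   normalised [v + s *: u] by the intermediate value theorem; [g] is the difference of the two norms
   multiplied by [n (d s)]. *)
pose d s := v + s *: u.
pose g s := n (n (d s) *: u + d s) - n (n (d s) *: u - d s).
have dE s : d s = v + s *: u by [].
have dB s s' : d s - d s' = (s - s') *: u by rewrite /d; lv.
have nB x y : `|n x - n y| <= n (x - y).
  rewrite ler_norml; have := norm_leD Hn x y; have := norm_leD Hn y x.
  by rewrite [n (y - x)](norm_sub Hn); lra.
have ndB s s' : `|n (d s) - n (d s')| <= `|s - s'|.
  by apply: le_trans (nB _ _) _; rewrite dB (is_normZ Hn) nu mulr1.
have gc : continuous g.
  apply: (@lipschitz_continuous_real _ 4) => s s'; rewrite /g.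
  have e1 : `|n (n (d s) *: u + d s) - n (n (d s') *: u + d s')| <= 2 * `|s - s'|.
    apply: le_trans (nB _ _) _.
    have -> : n (d s) *: u + d s - (n (d s') *: u + d s') =
        (n (d s) - n (d s')) *: u + (s - s') *: u by rewrite -(dB s s'); lv.
    apply: le_trans (is_normD Hn _ _) _.
    by rewrite !(is_normZ Hn) nu; have := ndB s s'; lra.
  have e2 : `|n (n (d s) *: u - d s) - n (n (d s') *: u - d s')| <= 2 * `|s - s'|.
    apply: le_trans (nB _ _) _.
    have -> : n (d s) *: u - d s - (n (d s') *: u - d s') =
        (n (d s) - n (d s')) *: u - (s - s') *: u by rewrite -(dB s s'); lv.
    apply: le_trans (is_normD Hn _ _) _.
    by rewrite (norm_opp Hn) !(is_normZ Hn) nu; have := ndB s s'; lra.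
  move: e1 e2; set A := n _; set B := n _; set C := n _; set E := n _.
  rewrite !ler_norml; lra.
(* At [s = 3] and [s = -3] the norm of [d s] is within 1 of 3, so of the two terms of [g] one is at
   least 4 and the other at most 2. *)
have n3 (s : R) : `|s| = 3 -> 2 <= n (d s) /\ n (d s) <= 4.
  move=> s3; have := is_normD Hn v (s *: u); have := norm_leD Hn (s *: u) (- v).
  rewrite opprK [s *: u + v]addrC (norm_opp Hn) !(is_normZ Hn) nu nv s3 -/(d s); lra.
have g3 : 0 <= g 3.
  have [h1 h2] := n3 3 (ger0_norm (ler0n R 3)); rewrite /g.
  have -> : n (d 3) *: u + d 3 = (n (d 3) + 3) *: u + v by rewrite {2}(dE 3); lv.
  have -> : n (d 3) *: u - d 3 = (n (d 3) - 3) *: u - v by rewrite {2}(dE 3); lv.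
  have := norm_leD Hn ((n (d 3) + 3) *: u) (- v).
  have := is_normD Hn ((n (d 3) - 3) *: u) (- v).
  rewrite opprK (norm_opp Hn) !(is_normZ Hn) nu nv !mulr1 [`|n (d 3) + 3|]ger0_norm; last lra.
  have : `|n (d 3) - 3| <= 1 by rewrite ler_norml; lra.
  lra.
have gN3 : g (-3) <= 0.
  have [h1 h2] : 2 <= n (d (-3)) /\ n (d (-3)) <= 4.
    by apply: n3; rewrite normrN ger0_norm.
  rewrite /g.
  have -> : n (d (-3)) *: u + d (-3) = (n (d (-3)) - 3) *: u + v by rewrite {2}(dE (-3)); lv.
  have -> : n (d (-3)) *: u - d (-3) = (n (d (-3)) + 3) *: u - v by rewrite {2}(dE (-3)); lv.
  have := norm_leD Hn ((n (d (-3)) + 3) *: u) v.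
  have := is_normD Hn ((n (d (-3)) - 3) *: u) v.
  rewrite !(is_normZ Hn) nu nv !mulr1 [`|n (d (-3)) + 3|]ger0_norm; last lra.
  have : `|n (d (-3)) - 3| <= 1 by rewrite ler_norml; lra.
  lra.
have [|||s _ gs] := @IVT R g (-3) 3 0.
- lra.
- exact: continuous_subspaceT.
- by rewrite ge_min gN3 le_max g3 orbT.
have d0 : d s <> 0.
  move=> /eqP; rewrite /d addr_eq0 => /eqP vE; apply: indep; exists (- s).
  by rewrite vE scaleNr.
have nd := norm_gt0 Hn d0; set r := n (d s) in nd.
pose q := r^-1 *: d s.
have nq : n q = 1 by rewrite /q (is_normZ Hn) ger0_norm ?invr_ge0 ?(ltW nd) // mulVf // gt_eqF.
have npq : n (u + q) = n (u - q).
  have e1 : u + q = r^-1 *: (r *: u + d s) by rewrite /q; lmod_with V R; field; rewrite gt_eqF.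
  have e2 : u - q = r^-1 *: (r *: u - d s) by rewrite /q; lmod_with V R; field; rewrite gt_eqF.
  rewrite e1 e2 !(is_normZ Hn); congr (_ * _).
  by move/eqP: gs; rewrite /g -/r subr_eq0 => /eqP.
have vE : v = (- s) *: u + r *: q.
  by rewrite /q scalerA divff ?gt_eqF // scale1r /d; lv.
have N a b : n (a *: u + b *: v) ^+ 2 = (a - b * s) ^+ 2 + (b * r) ^+ 2.
  rewrite -(plane_norm nu nq npq); congr (n _ ^+ 2); rewrite [in LHS]vE; lv.
have := N 0 1; rewrite scale0r scale1r add0r nv => H1.
have := N 1 1; rewrite !scale1r => ->; have := N 1 t; rewrite scale1r => ->.
have r2 : r ^+ 2 = 1 - s ^+ 2 by move: H1; rewrite expr1n !mul1r sub0r sqrrN; lra.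
by rewrite !exprMn r2; ring.
Qed.

(** The slope of [f] is the derivative of the norm at [u], which [day_norm] computes. The constant
    [2^-1] comes from [n <= (1 + n ^+ 2) / 2]. *)
Lemma support_eq (f : V -> R) u v : n u = 1 -> n v = 1 ->
  (forall t, f (u + t *: v) = 1 + t * f v) -> (forall x, f x <= n x) ->
  f v = (n (u + v) ^+ 2 - 2) / 2.
Proof.
move=> nu nv lin le; set B := _ / 2.
apply: (@quadratic_slope _ _ _ 2^-1) => t t1.
have := le (u + t *: v); rewrite lin => h.
have := day_norm t nu nv; have -> : n (u + v) ^+ 2 - 2 = 2 * B by rewrite /B; field.
move=> N2; have n0 := norm_pos Hn (u + t *: v).
have : 0 <= (n (u + t *: v) - 1) ^+ 2 by exact: sqr_ge0.
by rewrite sqrrB1 N2 -mulr_natr; lra.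
Qed.

End DayTheorem.

(** * The rank one case *)

Section RankOne.
Variables (R : realType) (V Y : lmodType R) (nv : V -> R) (ny : Y -> R).
Hypotheses (HV : is_norm nv) (HY : is_norm ny).
Variables (M : V -> Prop) (phi : V -> V -> R) (Z : V -> V -> Prop).
Hypothesis HA : atomic nv M phi Z.
Variable D : V -> Y.
Hypothesis D_sphere : forall x, nv x = 1 -> ny (D x) = 1.
Hypothesis D_onto : forall y, ny y = 1 -> exists2 x, nv x = 1 & D x = y.
Hypothesis D_iso : forall x y, nv x = 1 -> nv y = 1 -> ny (D x - D y) = nv (x - y).
Hypothesis rank1 : forall e z, M e -> Z e z -> z = 0.
Hypothesis parV : forall u v, nv u = 1 -> nv v = 1 -> nv (u + v) ^+ 2 + nv (u - v) ^+ 2 = 4.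

(** Every unit vector is an atom, so [D] is odd and preserves norms of sums too. [Y] inherits the
    parallelogram law, and [support_eq] expresses both functionals through the same number
    [nv (e + f)]. *)
Lemma compatible_rank_one : compatible nv ny M phi D.
Proof.
move=> e f psi Me Mf Sp.
have ne := at_norm HA Me; have nf := at_norm HA Mf.
have Mu x : nv x = 1 -> M x.
  move=> nx; have x0 : x <> 0.
    by move=> x0; move: nx; rewrite x0 (norm_zero HV) => /esym/eqP; rewrite oner_eq0.
  have [g [Mg /(rank1 Mg)/eqP]] := at_top HA x0.
  by rewrite nx scale1r subr_eq0 => /eqP ->.
have DN x : nv x = 1 -> D (- x) = - D x.
  by move=> nx; apply: (D_opp_atom HV HY HA D_sphere D_onto D_iso); exact: Mu.
have nYD x y : nv x = 1 -> nv y = 1 -> ny (D x + D y) = nv (x + y).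
  by move=> nx n1; rewrite -[D y]opprK -DN // D_iso ?(norm_opp HV) // opprK.
have parY u v : ny u = 1 -> ny v = 1 -> ny (u + v) ^+ 2 + ny (u - v) ^+ 2 = 4.
  move=> nu nw; have [x nx <-] := D_onto nu; have [y n1 <-] := D_onto nw.
  by rewrite nYD // D_iso // parV.
have pe : psi (D e) = 1 by case: Sp => _ _; apply; exact: (face_mem HA).
rewrite (@support_eq _ _ _ HY parY psi (D e) (D f)) ?D_sphere //; first last.
- by move=> y; exact: (sup_le Sp).
- by move=> t; rewrite (supD Sp) (supZ Sp) pe.
rewrite (@support_eq _ _ _ HV parV (phi e) e f) ?nYD //; last first.
  by move=> x; exact: (at_phi_le HA).
by move=> t; rewrite (phiD HA) // (phiZ HA) // (at_phi1 HA).
Qed.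

End RankOne.

(** * Peirce calculus *)

Section JordanTriples.
Variables (C : numClosedFieldType) (V : lmodType C) (tp : V -> V -> V -> V).

Record jordan_triple : Prop := {
  jt_lin : forall b c k x y, tp (k *: x + y) b c = k *: tp x b c + tp y b c;
  jt_sym : forall a b c, tp a b c = tp c b a;
  jt_conj : forall a c k x y, tp a (k *: x + y) c = k^* *: tp a x c + tp a y c;
  jt_id : forall a b x y z, tp a b (tp x y z) =
    tp (tp a b x) y z - tp x (tp b a y) z + tp x y (tp a b z) }.

Hypothesis J : jordan_triple.

Ltac lv := lmod_with V C; try ring.
Ltac lf := lmod_with V C; try by field.

Lemma tpDl a a' b c : tp (a + a') b c = tp a b c + tp a' b c.
Proof. by rewrite -[a in LHS]scale1r (jt_lin J) scale1r. Qed.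

Lemma tp0l b c : tp 0 b c = 0.
Proof. by apply: (addrI (tp 0 b c)); rewrite -tpDl !addr0. Qed.

Lemma tpZl k a b c : tp (k *: a) b c = k *: tp a b c.
Proof. by rewrite -[_ *: _ in LHS]addr0 (jt_lin J) tp0l addr0. Qed.

Lemma tpDr a b c c' : tp a b (c + c') = tp a b c + tp a b c'.
Proof. by rewrite (jt_sym J) tpDl !(jt_sym J _ b a). Qed.

Lemma tp0r a b : tp a b 0 = 0.
Proof. by rewrite (jt_sym J) tp0l. Qed.

Lemma tpZr k a b c : tp a b (k *: c) = k *: tp a b c.
Proof. by rewrite (jt_sym J) tpZl (jt_sym J). Qed.

Lemma tpDm a b b' c : tp a (b + b') c = tp a b c + tp a b' c.
Proof. by rewrite -[b in LHS]scale1r (jt_conj J) rmorph1 scale1r. Qed.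

Lemma tp0m a c : tp a 0 c = 0.
Proof. by apply: (addrI (tp a 0 c)); rewrite -tpDm !addr0. Qed.

Lemma tpZm k a b c : tp a (k *: b) c = k^* *: tp a b c.
Proof. by rewrite -[_ *: _ in LHS]addr0 (jt_conj J) tp0m addr0. Qed.

Lemma tpNl a b c : tp (- a) b c = - tp a b c.
Proof. by rewrite -scaleN1r tpZl scaleN1r. Qed.

Lemma tpNr a b c : tp a b (- c) = - tp a b c.
Proof. by rewrite -scaleN1r tpZr scaleN1r. Qed.

Lemma tpNm a b c : tp a (- b) c = - tp a b c.
Proof. by rewrite -scaleN1r tpZm rmorphN1 scaleN1r. Qed.

Definition tpE := (tpDl, tpDm, tpDr, tpNl, tpNm, tpNr, tpZl, tpZm, tpZr, tp0l, tp0m, tp0r).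

Lemma tp_mid a b x y z : tp x (tp b a y) z =
  tp (tp a b x) y z + tp x y (tp a b z) - tp a b (tp x y z).
Proof. by rewrite (jt_id J a b x y z); lv. Qed.

(** Strong induction on [i + j + k]. The Jordan identity for [L(a,a)] relates the products of the
    next degree; the identity for [L(A i, A j)] acting on [{a,a,a}] is a second relation, and
    together they determine [{a, A m, a}]. The remaining products follow by shifting indices. *)
Lemma odd_powers_tp a i j k : let A n := iter n (tp a a) a in
  tp (A i) (A j) (A k) = A (i + j + k).+1.
Proof.
move=> A; have AS n : A n.+1 = tp a a (A n) by [].
suff H m : forall i j k, (i + j + k = m)%N -> tp (A i) (A j) (A k) = A m.+1.
  exact: (H _ _ _ _ erefl).
elim/ltn_ind: m => m IH {i j k}.
case: m IH => [|m] IH i j k.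
  by move=> /eqP; rewrite !addn_eq0 => /andP[/andP[/eqP -> /eqP ->] /eqP ->].
have rel i' j' k' : (i' + j' + k' = m)%N ->
    tp (A i'.+1) (A j') (A k') + tp (A i') (A j') (A k'.+1) =
    A m.+2 + tp (A i') (A j'.+1) (A k').
  move=> e; have := jt_id J a a (A i') (A j') (A k').
  by rewrite (IH m) // -!AS => ->; lv.
have one i' j' : (i' + j' = m)%N -> tp (A i') (A j') (A 1%N) = 2 *: A m.+2 - tp a (A m.+1) a.
  move=> e; have h1 : tp (A i') (A j') a = A m.+1.
    by have := IH m (ltnSn m) i' j' 0; apply; rewrite addn0.
  have h2 : tp (A j') (A i') a = A m.+1.
    by have := IH m (ltnSn m) j' i' 0; apply; rewrite addn0 addnC.
  rewrite [A 1%N](AS 0) (jt_id J) [A 0]/= h1 h2 [tp (A m.+1) _ _](jt_sym J) -AS; lv.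
have mid : tp a (A m.+1) a = A m.+2.
  have := rel 0 m 0 (addn0 _); rewrite [A 0]/= => r1.
  have := one 0 m erefl; rewrite [A 0]/= => r2.
  rewrite [tp (A 1) _ _](jt_sym J) r2 in r1.
  have r3 : 3 *: tp a (A m.+1) a = 3 *: A m.+2.
    transitivity ((A m.+2 + tp a (A m.+1) a) - ((2 *: A m.+2 - tp a (A m.+1) a) +
      (2 *: A m.+2 - tp a (A m.+1) a)) + 3 *: A m.+2); first by lv.
    by rewrite -r1; lv.
  by have := congr1 (fun x => 3^-1 *: x) r3; rewrite !scalerA mulVf ?pnatr_eq0 // !scale1r.
have {}one i' j' : (i' + j' = m)%N -> tp (A i') (A j') (A 1%N) = A m.+2.
  by move=> e; rewrite one // mid; lv.
have zero i' j' : (i' + j' = m.+1)%N -> tp (A i') (A j') a = A m.+2.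
  elim: i' j' => [|i' IHi] j' e; first by rewrite -e add0n in mid *; exact: mid.
  have e' : (i' + j' = m)%N by move: e; rewrite addSn => -[].
  have := rel i' j' 0 (etrans (addn0 _) e'); rewrite [A 0]/= one // (IHi j'.+1) ?addnS ?e' //.
  by move=> /addIr.
elim: k i j => [|k IHk] i j e; first by apply: zero; rewrite -e addn0.
have e' : (i + j + k = m)%N by move: e; rewrite addnS => -[].
have := rel i j k e'; rewrite (IHk i.+1 j) ?(IHk i j.+1) ?addSn ?addnS ?addSn ?e' //.
by move=> /addrI.
Qed.

Section Tripotent.
Variable e : V.
Hypothesis trip : tp e e e = e.

Lemma peirce_DQ x : tp e e (tp e x e) = tp e x e.
Proof.
have r1 := jt_id J e e e x e; have r2 := jt_id J e x e e e.
rewrite trip in r1; rewrite trip [tp (tp e x e) e e](jt_sym J) [tp x e e](jt_sym J) in r2.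
have r3 : 3 *: tp e e (tp e x e) = 3 *: tp e x e.
  transitivity (tp e e (tp e x e) + (tp e e (tp e x e) - tp e (tp e e x) e +
    tp e e (tp e x e)) + tp e (tp e e x) e); first by lv.
  by rewrite -r2 r1; lv.
by have := congr1 (fun y => 3^-1 *: y) r3; rewrite !scalerA mulVf ?pnatr_eq0 // !scale1r.
Qed.

Lemma peirce_QD x : tp e (tp e e x) e = tp e x e.
Proof.
have := jt_id J e e e x e; rewrite trip peirce_DQ => H.
transitivity (tp e x e + tp e x e - (tp e x e - tp e (tp e e x) e + tp e x e)); first by lv.
by rewrite -H; lv.
Qed.

Lemma peirce_QQ x : tp e (tp e x e) e = 2 *: tp e e (tp e e x) - tp e e x.
Proof.
have := jt_id J x e e e e; rewrite trip [tp x e e](jt_sym J) [tp (tp e e x) e e](jt_sym J) => H.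
transitivity (2 *: tp e e (tp e e x) - (tp e e (tp e e x) - tp e (tp e x e) e +
  tp e e (tp e e x))); first by lv.
by rewrite -H.
Qed.

Lemma peirce_cubic x :
  2 *: tp e e (tp e e (tp e e x)) - 3 *: tp e e (tp e e x) + tp e e x = 0.
Proof.
have H := peirce_DQ (tp e x e); rewrite peirce_QQ !tpE in H.
transitivity ((2 *: tp e e (tp e e (tp e e x)) - tp e e (tp e e x)) -
  (2 *: tp e e (tp e e x) - tp e e x)); first by lv.
by rewrite H subrr.
Qed.

(** The Peirce projections. By [peirce_cubic] the eigenvalues of [L(e,e)] are among 0, 1/2, 1; [P1]
    and [P0] are the Lagrange polynomials of 1/2 and 0 in this operator, and by [peirce_QQ] the
    square of [Q(e)] is the one of 1. *)
Definition P2 x := tp e (tp e x e) e.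
Definition P1 x := 4 *: (tp e e x - tp e e (tp e e x)).
Definition P0 x := x - 3 *: tp e e x + 2 *: tp e e (tp e e x).

Lemma peirce_sum x : x = P2 x + P1 x + P0 x.
Proof. by rewrite /P2 peirce_QQ /P1 /P0; lv. Qed.

Lemma D_P2 x : tp e e (P2 x) = P2 x. Proof. exact: peirce_DQ. Qed.

Lemma D_P1 x : tp e e (P1 x) = 2^-1 *: P1 x.
Proof.
apply/eqP; rewrite -subr_eq0; apply/eqP.
transitivity ((- 2) *: (2 *: tp e e (tp e e (tp e e x)) - 3 *: tp e e (tp e e x) + tp e e x)).
  by rewrite /P1 !tpE; lf.
by rewrite peirce_cubic scaler0.
Qed.

Lemma D_P0 x : tp e e (P0 x) = 0.
Proof. by rewrite -(peirce_cubic x) /P0 !tpE; lv. Qed.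

(* Products of Peirce eigenvectors: L(e,e) is a derivation up to the sign of the
   middle variable. *)
Lemma peirce_tp a b c x y z : b^* = b -> tp e e x = a *: x -> tp e e y = b *: y ->
  tp e e z = c *: z -> tp e e (tp x y z) = (a - b + c) *: tp x y z.
Proof. by move=> rb hx hy hz; rewrite (jt_id J) hx hy hz !tpE rb; lv. Qed.

(** With [peirce_tp] this is the Peirce rule: a product whose weight is not 0, 1/2 or 1 vanishes. *)
Lemma peirce_eigen0 a x : tp e e x = a *: x -> 2 * a ^+ 3 - 3 * a ^+ 2 + a != 0 -> x = 0.
Proof.
move=> hx a0; have := peirce_cubic x; rewrite !(hx, tpE).
have -> : 2 *: (a *: (a *: (a *: x))) - 3 *: (a *: (a *: x)) + a *: x =
  (2 * a ^+ 3 - 3 * a ^+ 2 + a) *: x by lv.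
by move=> /eqP; rewrite scaler_eq0 (negbTE a0) => /eqP.
Qed.

Lemma peirce2_Q x : tp e e x = x -> tp e (tp e x e) e = x.
Proof. by move=> hx; rewrite peirce_QQ !hx; lv. Qed.

Lemma peirce_Q1 x : tp e e x = 2^-1 *: x -> tp e x e = 0.
Proof.
move=> hx; apply: (@peirce_eigen0 (3 / 2)); last by rewrite (_ : _ + _ = 3 / 2) ?mulf_neq0 ?invr_neq0 ?pnatr_eq0 //; field.
have := @peirce_tp 1 2^-1 1 e x e; rewrite !scale1r => -> //.
  by congr (_ *: _); field.
by rewrite fmorphV rmorph_nat.
Qed.

Lemma peirce_Q0 x : tp e e x = 0 -> tp e x e = 0.
Proof.
move=> hx; have := peirce_QD x; rewrite hx tp0m; exact: esym.
Qed.

(** The commutator of [L(e,e)] and [L(e,x)] is [L(e,x)] when the Jordan identity is read in one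
    order, and 0 in the other. *)
Lemma peirce0_l x z : tp e e x = 0 -> tp e x z = 0.
Proof.
move=> hx; have := jt_id J e e e x z; rewrite trip hx tp0m.
have := jt_id J e x e e z; rewrite [tp x e e](jt_sym J) hx peirce_Q0 // !tpE => ->.
by rewrite !(subr0, add0r) => H; apply: (addIr (tp e e (tp e x z))); rewrite add0r -H.
Qed.

Lemma peirce0_m x z : tp e e x = 0 -> tp x e z = 0.
Proof.
move=> hx; have := jt_id J e e x e z; rewrite trip hx tp0l.
have := jt_id J x e e e z; rewrite [tp x e e](jt_sym J) hx peirce_Q0 // !tpE => ->.
rewrite !(subr0, sub0r, add0r) => H; apply: (addIr (tp e e (tp x e z))).
by rewrite {1}H add0r addrA subrr add0r.
Qed.

End Tripotent.

Lemma peirce20_r v x b z : tp v v v = v -> tp v v x = x -> tp v v b = 0 -> tp b x z = 0.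
Proof.
move=> tv hx hb; rewrite -(peirce2_Q tv hx) tp_mid.
rewrite [tp _ v b](jt_sym J) !(peirce0_m tv _ hb) !tpE; lv.
Qed.

Lemma peirce20_l v x b z : tp v v v = v -> tp v v x = x -> tp v v b = 0 -> tp x b z = 0.
Proof.
move=> tv hx hb; rewrite -(peirce2_Q tv hx).
have := jt_id J v (tp v x v) v b z.
rewrite !(peirce0_l tv _ hb) [tp (tp v x v) v b](jt_sym J) (peirce0_m tv _ hb) !tpE.
by rewrite subr0 addr0 => <-.
Qed.

Lemma orth_sym e f : tp e e e = e -> tp e e f = 0 -> tp f f e = 0.
Proof. by move=> te ef; rewrite (jt_sym J) (peirce0_l te _ ef). Qed.

Lemma cube_orth x y : (forall z, tp x y z = 0) -> (forall z, tp y x z = 0) ->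
  tp (x + y) (x + y) (x + y) = tp x x x + tp y y y.
Proof.
move=> c1 c2; have c3 z : tp z y x = 0 by rewrite (jt_sym J).
have c4 z : tp z x y = 0 by rewrite (jt_sym J).
by rewrite !tpE !(c1, c2, c3, c4) !(add0r, addr0).
Qed.

(** * The Jordan algebra of a tripotent *)

Section SelfAdjoint.
Variable v : V.
Hypothesis tv : tp v v v = v.
(** The Peirce 2-space of [v] is a Jordan algebra with unit [v], product [{x,v,y}] and involution
    [Q(v)]; these are its self-adjoint elements. *)
Definition selfadjoint x := tp v x v = x.

Lemma sa_D x : selfadjoint x -> tp v v x = x.
Proof. by move=> hx; rewrite -hx (peirce_DQ tv). Qed.

Lemma sa_mul x y : selfadjoint x -> selfadjoint y -> tp x y v = tp x v y.
Proof.
move=> hx hy; rewrite -{1}hy tp_mid.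
have hw : tp v v (tp y v x) = tp y v x.
  have := @peirce_tp v 1 1 1 y v x; rewrite subrr add0r !scale1r; apply => //.
  - exact: rmorph1.
  - exact: sa_D.
  - exact: sa_D.
rewrite [tp (tp y v x) v v](jt_sym J) hw [tp y v v](jt_sym J) [tp x v v](jt_sym J).
by rewrite !sa_D // addrAC subrr add0r.
Qed.

Lemma sa_square_mul y b : selfadjoint y -> tp y y b = tp b v (tp y v y).
Proof.
move=> hy; rewrite (jt_sym J) -{1}hy tp_mid [tp (tp y v b) v y](jt_sym J).
by rewrite [tp y v (tp b v y)](_ : _ = tp y v (tp y v b)) 1?[tp b v y](jt_sym J) // addrAC subrr add0r.
Qed.

Lemma sa_square y : selfadjoint y -> selfadjoint (tp y v y).
Proof.
move=> hy; rewrite /selfadjoint -(sa_mul hy hy) tp_mid.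
have hw : tp v v (tp y y v) = tp y y v.
  by rewrite sa_mul // -{2}(sa_mul hy hy); have := @peirce_tp v 1 1 1 y v y;
     rewrite subrr add0r !scale1r => -> //; rewrite ?sa_D ?rmorph1 // sa_mul.
by rewrite [tp (tp y y v) v v](jt_sym J) !hw tv addrK.
Qed.

(** [L(y,y)] is the Jordan multiplication by the square of [y]. Hence the odd powers of [y], and in
    the limit its spectral tripotent, are self-adjoint. *)
Lemma sa_L y b : selfadjoint y -> selfadjoint b -> selfadjoint (tp y y b).
Proof.
move=> hy hb; have hw := sa_square hy.
rewrite /selfadjoint tp_mid hb [tp v b _](jt_sym J) (sa_mul hy hy) (sa_mul hw hb).
by rewrite [tp (tp y v y) v b](jt_sym J) -sa_square_mul // addrK.
Qed.

(* A self-adjoint tripotent of the Peirce 2-space of [v] other than [v] and [- v]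
   splits [v]: its square is a projection, and if that is [v] then [e] is a symmetry. *)
Lemma sa_split e : tp e e e = e -> selfadjoint e -> e <> 0 -> e <> v -> e <> - v ->
  exists p, [/\ tp p p p = p, tp (v - p) (v - p) (v - p) = v - p,
    tp p p (v - p) = 0, p <> 0 & v - p <> 0].
Proof.
move=> te he e0 ev eNv; pose f := tp e v e.
have fE : tp e e v = f by rewrite sa_mul.
have [fv|fv] := pselect (f = v).
  have r1 : tp v v e = e := sa_D he.
  have r2 : tp e v v = e by rewrite (jt_sym J).
  have r3 : tp v e e = v by rewrite (jt_sym J) fE.
  have R := (r1, r2, r3, he, fE, fv, te, tv).
  have r4 : tp e v e = v by [].
  exists (2^-1 *: (v + e)); split.
  - by rewrite !tpE fmorphV rmorph_nat !(R, r4); lf.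
  - by rewrite !tpE fmorphV rmorph_nat !(R, r4); lf.
  - by rewrite !tpE fmorphV rmorph_nat !(R, r4); lf.
  - move=> /eqP; rewrite scaler_eq0 invr_eq0 pnatr_eq0 /= addrC addr_eq0 => /eqP; exact: eNv.
  - have -> : v - 2^-1 *: (v + e) = 2^-1 *: (v - e) by lf.
    move=> /eqP; rewrite scaler_eq0 invr_eq0 pnatr_eq0 /= subr_eq0 => /eqP ve.
    exact: ev (esym ve).
(* [f] and [w = v - f] are the Peirce 2- and 0-parts of [v] at [e]; cubing [v] and separating the
   parts makes both tripotents. *)
have Df : tp e e f = f := peirce_DQ te v.
pose w := v - f; have Dw : tp e e w = 0 by rewrite /w !tpE fE Df subrr.
have vE : v = f + w by rewrite /w; lv.
have c1 z : tp f w z = 0 := peirce20_l z te Df Dw.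
have c2 z : tp w f z = 0 := peirce20_r z te Df Dw.
have cube : f + w = tp f f f + tp w w w by rewrite -(cube_orth c1 c2) -vE tv.
have Dfff : tp e e (tp f f f) = tp f f f.
  by have := @peirce_tp e 1 1 1 f f f; rewrite subrr add0r !scale1r; apply; rewrite ?rmorph1.
have Dwww : tp e e (tp w w w) = 0.
  by have := @peirce_tp e 0 0 0 w w w; rewrite subrr add0r !scale0r; apply; rewrite ?rmorph0.
have fff : tp f f f = f.
  by have := congr1 (tp e e) cube; rewrite (tpDr e e f w) (tpDr e e (tp f f f)) Df Dw Dfff Dwww !addr0.
have www : tp w w w = w by move: cube; rewrite fff => /addrI.
exists f; split=> //.
- by rewrite (jt_sym J); exact: c2.
- move=> f0; apply: e0; rewrite -he; apply: (peirce0_m te).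
  by rewrite fE.
- by move=> /eqP; rewrite subr_eq0 => /eqP /esym.
Qed.

End SelfAdjoint.

Definition minimal e : Prop :=
  [/\ tp e e e = e, e <> 0 & forall x, exists c, tp e x e = c *: e].

(* The coordinate of the Peirce 2-part of [x], which is a multiple of [e] when [e] is
   minimal. *)
Definition mcoef (e x : V) : C := xget 0 [set c | tp e (tp e x e) e = c *: e].

Section Minimal.
Variable e : V.
Hypothesis me : minimal e.

Let te : tp e e e = e. Proof. by case: me. Qed.

Lemma scale_inj_min (a b : C) : a *: e = b *: e -> a = b.
Proof.
have [_ e0 _] := me; move=> /eqP; rewrite -subr_eq0 -scalerBl scaler_eq0 => /orP[|/eqP //].
by rewrite subr_eq0 => /eqP.
Qed.

Lemma mcoefP x : tp e (tp e x e) e = mcoef e x *: e.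
Proof.
have [_ _ /(_ (tp e x e)) cex] := me.
exact: (@xgetPex _ 0 [set c | tp e (tp e x e) e = c *: e] cex).
Qed.

Lemma mcoef_lin k x y : mcoef e (k *: x + y) = k * mcoef e x + mcoef e y.
Proof.
apply: scale_inj_min; rewrite -mcoefP !tpE conjCK !mcoefP; lv.
Qed.

Lemma mcoefD x y : mcoef e (x + y) = mcoef e x + mcoef e y.
Proof. by rewrite -[x in LHS]scale1r mcoef_lin mul1r. Qed.

Lemma mcoef0 : mcoef e 0 = 0.
Proof. by apply: scale_inj_min; rewrite -mcoefP !tpE scale0r. Qed.

Lemma mcoefZ k x : mcoef e (k *: x) = k * mcoef e x.
Proof. by rewrite -[_ *: _]addr0 mcoef_lin mcoef0 addr0. Qed.

Lemma mcoef_self : mcoef e e = 1.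
Proof. by apply: scale_inj_min; rewrite -mcoefP !te scale1r. Qed.

Lemma mcoef_peirce2 x : tp e e x = x -> x = mcoef e x *: e.
Proof. by move=> hx; rewrite -mcoefP (peirce2_Q te hx). Qed.

Lemma mcoef_peirce1 x : tp e e x = 2^-1 *: x -> mcoef e x = 0.
Proof. by move=> hx; apply: scale_inj_min; rewrite -mcoefP (peirce_Q1 te hx) tp0m scale0r. Qed.

Lemma mcoef_peirce0 x : tp e e x = 0 -> mcoef e x = 0.
Proof. by move=> hx; apply: scale_inj_min; rewrite -mcoefP (peirce_Q0 te hx) tp0m scale0r. Qed.

Lemma peirce_dec x : x = mcoef e x *: e + P1 e x + P0 e x.
Proof. by rewrite -mcoefP -(peirce_sum te). Qed.

Lemma minimal_phase k : k * k^* = 1 -> minimal (k *: e).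
Proof.
have [_ e0 ce] := me; move=> k1; split.
- by rewrite !tpE te scalerA k1 scale1r.
- move=> /eqP; rewrite scaler_eq0 => /orP[/eqP k0|/eqP //].
  by move: k1; rewrite k0 mul0r => /esym/eqP; rewrite oner_eq0.
- move=> x; have [c cE] := ce x; exists (k * c); rewrite !tpE cE; lv.
Qed.

End Minimal.

(** * Two orthogonal minimal tripotents and their spin factor *)

Section SpinFactor.
Variables e e' : V.
Hypotheses (me : minimal e) (me' : minimal e') (ee' : tp e e e' = 0).

Let te : tp e e e = e. Proof. by case: me. Qed.
Let te' : tp e' e' e' = e'. Proof. by case: me'. Qed.
Let e'e : tp e' e' e = 0. Proof. exact: orth_sym te ee'. Qed.
Let o1 z : tp e e' z = 0. Proof. exact: peirce0_l. Qed.
Let o2 z : tp e' e z = 0. Proof. exact: peirce0_m. Qed.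
Let o3 z : tp z e' e = 0. Proof. by rewrite (jt_sym J) o1. Qed.
Let o4 z : tp z e e' = 0. Proof. by rewrite (jt_sym J) o2. Qed.

Definition half b := tp e e b = 2^-1 *: b /\ tp e' e' b = 2^-1 *: b.
Definition plus b := 2 *: tp e b e'.
Definition spinS b c : C := mcoef e' (tp b e c).

Let conj2V : (2^-1 : C)^* = 2^-1. Proof. by rewrite fmorphV rmorph_nat. Qed.
Let conj2 : (2 : C)^* = 2. Proof. exact: rmorph_nat. Qed.

Lemma half_lin k b c : half b -> half c -> half (k *: b + c).
Proof. by move=> [b1 b2] [c1 c2]; split; rewrite !tpE ?b1 ?b2 ?c1 ?c2; lv. Qed.

Lemma half_plus b : half b -> half (plus b).
Proof.
move=> [b1 b2]; split; rewrite /plus tpZr.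
  rewrite (@peirce_tp e 1 2^-1 0 e b e') ?scale1r ?scale0r //; lf.
rewrite (@peirce_tp e' 0 2^-1 1 e b e') ?scale1r ?scale0r //; lf.
Qed.

Lemma tripotent_add : tp (e + e') (e + e') (e + e') = e + e'.
Proof. by rewrite !tpE !(te, te', o1, o2, ee', e'e) !(addr0, add0r). Qed.

Lemma plus_Q b : half b -> tp (e + e') b (e + e') = plus b.
Proof.
move=> [b1 b2]; rewrite !tpE (peirce_Q1 te b1) (peirce_Q1 te' b2) [tp e' b e](jt_sym J) /plus.
lv.
Qed.

Lemma plusK b : half b -> plus (plus b) = b.
Proof.
move=> hb; rewrite -(plus_Q (half_plus hb)) -(plus_Q hb); apply: (peirce2_Q tripotent_add).
case: hb => b1 b2; rewrite !tpE b1 b2 o1 o2 addr0 add0r; lf.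
Qed.

Lemma spinSP b c : half b -> half c -> tp b e c = spinS b c *: e'.
Proof.
move=> [b1 b2] [c1 c2]; apply: (mcoef_peirce2 me').
rewrite (@peirce_tp e' 2^-1 0 2^-1 b e c) ?rmorph0 ?scale0r //.
have -> : 2^-1 - 0 + 2^-1 = 1 :> C by field.
by rewrite scale1r.
Qed.

Lemma spinS_sym b c : spinS b c = spinS c b.
Proof. by rewrite /spinS (jt_sym J). Qed.

Lemma spinS_lin k b c d : spinS (k *: b + c) d = k * spinS b d + spinS c d.
Proof. by rewrite /spinS (jt_lin J) (mcoef_lin me'). Qed.

Lemma plus_right b c : half b -> half c -> tp c (plus b) e' = spinS b c *: e'.
Proof.
move=> hb hc; rewrite /plus tpZm conj2 tp_mid spinSP // [tp (spinS _ _ *: _) _ _]tpZl te' o4 tp0r.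
by case: hc => c1 c2; rewrite [tp c e' e'](jt_sym J) c2 tpZr spinSP //; lf.
Qed.

End SpinFactor.


Section SpinFormula.
Variables e e' : V.
Hypotheses (me : minimal e) (me' : minimal e') (ee' : tp e e e' = 0).

Let te : tp e e e = e. Proof. by case: me. Qed.
Let te' : tp e' e' e' = e'. Proof. by case: me'. Qed.
Let e'e : tp e' e' e = 0. Proof. exact: orth_sym te ee'. Qed.
Let o1 z : tp e e' z = 0. Proof. exact: peirce0_l. Qed.
Let o2 z : tp e' e z = 0. Proof. exact: peirce0_m. Qed.
Let o3 z : tp z e' e = 0. Proof. by rewrite (jt_sym J) o1. Qed.
Let o4 z : tp z e e' = 0. Proof. by rewrite (jt_sym J) o2. Qed.

Local Notation S := (spinS e e').

Lemma half_swap b : half e e' b -> half e' e b. Proof. by case. Qed.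

Lemma plus_swap b : plus e' e b = plus e e' b.
Proof. by rewrite /plus (jt_sym J). Qed.

Lemma plus_left b c : half e e' b -> half e e' c -> tp c (plus e e' b) e = spinS e' e b c *: e.
Proof.
by move=> hb hc; rewrite -plus_swap (plus_right me' me e'e (half_swap hb) (half_swap hc)).
Qed.

Lemma plus_mid b c d : half e e' b -> half e e' c -> half e e' d -> tp b (plus e e' d) c =
  spinS e' e d b *: c + spinS e' e d c *: b - S b c *: d.
Proof.
move=> hb hc hd; have := jt_id J d e' b e c.
rewrite (spinSP me me' ee' hb hc) (spinSP me' me e'e (half_swap hd) (half_swap hb)).
rewrite (spinSP me' me e'e (half_swap hd) (half_swap hc)) !tpE.
case: (hb) => b1 _; case: (hc) => c1 _; case: (hd) => _ d2.
rewrite [tp d e' e'](jt_sym J) d2 [tp b e e](jt_sym J) b1 c1 [tp e' d e](jt_sym J) => H.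
rewrite rmorph_nat.
transitivity (2 *: (spinS e' e d b *: (2^-1 *: c) + spinS e' e d c *: (2^-1 *: b)
  - (spinS e' e d b *: (2^-1 *: c) - tp b (tp e d e') c + spinS e' e d c *: (2^-1 *: b)))).
  by lv.
by rewrite -H; lf.
Qed.

Lemma spinS_add b c d : S (b + c) d = S b d + S c d.
Proof. by rewrite -[b in LHS]scale1r (spinS_lin e me') mul1r. Qed.

Lemma half_add b c : half e e' b -> half e e' c -> half e e' (b + c).
Proof. by move=> hb hc; rewrite -[b]scale1r; apply: half_lin. Qed.

End SpinFormula.

Section SpinSymmetry.
Variables e e' : V.
Hypotheses (me : minimal e) (me' : minimal e') (ee' : tp e e e' = 0).

Let te : tp e e e = e. Proof. by case: me. Qed.
Let te' : tp e' e' e' = e'. Proof. by case: me'. Qed.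
Let e'e : tp e' e' e = 0. Proof. exact: orth_sym te ee'. Qed.
Let o1 z : tp e e' z = 0. Proof. exact: peirce0_l. Qed.
Let o2 z : tp e' e z = 0. Proof. exact: peirce0_m. Qed.
Let o3 z : tp z e' e = 0. Proof. by rewrite (jt_sym J) o1. Qed.
Let o4 z : tp z e e' = 0. Proof. by rewrite (jt_sym J) o2. Qed.
Local Notation S := (spinS e e').

(** For [b = c = d], exchanging [e] and [e'] leaves [{d, plus d, d}] unchanged but exchanges the two
    forms in its expansion by [plus_mid], so they agree at [d]; the general case is polarisation. *)
Lemma spinS_swap b c : half e e' b -> half e e' c -> spinS e' e b c = S b c.
Proof.
have diag d : half e e' d -> spinS e' e d d = S d d.
  move=> hd; have [d0|/eqP d0] := eqVneq d 0.
    by rewrite d0 /spinS !tp0l !mcoef0.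
  have := plus_mid me' me e'e (half_swap hd) (half_swap hd) (half_swap hd).
  rewrite plus_swap (plus_mid me me' ee' hd hd hd) => H.
  have : (3 * (spinS e' e d d - S d d)) *: d = 0.
    transitivity ((spinS e' e d d *: d + spinS e' e d d *: d - S d d *: d) -
      (S d d *: d + S d d *: d - spinS e' e d d *: d)); first by lv.
    by rewrite H subrr.
  move=> /eqP; rewrite scaler_eq0 mulf_eq0 pnatr_eq0 /= subr_eq0 => /orP[/eqP //|/eqP //].
move=> hb hc; have := diag _ (half_add hb hc).
have S2 f f' (mf : minimal f) (mf' : minimal f') : spinS f f' (b + c) (b + c) =
    spinS f f' b b + spinS f f' c c + 2 * spinS f f' b c.
  rewrite spinS_add // ![spinS f f' _ (b + c)]spinS_sym !spinS_add //.
  by rewrite [spinS f f' c b]spinS_sym; ring.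
rewrite !S2 // !diag // => /addrI; exact: mulfI.
Qed.

Definition spin_el (a : C) b a' := a *: e + b + a' *: e'.
Definition spin_bar (a : C) b a' := spin_el a'^* (- plus e e' b) a^*.
Definition spin_q (a : C) b a' c d c' := 2^-1 * (a * c' + a' * c) - S b d.

(** The triple product of a complex spin factor with bilinear form [spin_q]. With the conjugation
    put into the middle variable, no conjugates are left on the right. *)
Lemma spin_tp a b a' k c k' m d m' : half e e' b -> half e e' c -> half e e' d ->
  tp (spin_el a b a') (spin_bar k c k') (spin_el m d m') =
  spin_q a b a' k c k' *: spin_el m d m' + spin_q m d m' k c k' *: spin_el a b a'
  - spin_q a b a' m d m' *: spin_el k c k'.
Proof.
move=> hb hc hd; rewrite /spin_bar.
have := plus_mid me me' ee' hb hd hc; rewrite !spinS_swap // => r1.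
have := plus_left me me' ee' hc hb; rewrite spinS_swap // => r2.
have := plus_left me me' ee' hc hd; rewrite spinS_swap // => r3.
have r4 := plus_right me me' ee' hc hb.
have r5 := plus_right me me' ee' hc hd.
have [p1 p2] := half_plus me me' ee' hc.
have r6 : tp e (plus e e' c) e' = 2^-1 *: c.
  by rewrite -[in RHS](plusK me me' ee' hc) [in RHS]/plus scalerA mulVf // scale1r.
have r7 := peirce_Q1 te p1; have r8 := peirce_Q1 te' p2.
move: (plus e e' c) r1 r2 r3 r4 r5 r6 r7 r8 {p1 p2} => p r1 r2 r3 r4 r5 r6 r7 r8.
have := spinSP me me' ee' hb hd => r9.
have := spinSP me' me e'e (half_swap hb) (half_swap hd); rewrite spinS_swap // => r10.
case: hb => b1 b2; case: hd => d1 d2.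
have r11 : tp e' p e = 2^-1 *: c by rewrite (jt_sym J).
have r12 : tp e p d = S c d *: e by rewrite (jt_sym J).
have r13 : tp e' p d = S c d *: e' by rewrite (jt_sym J).
have r14 : tp b e e = 2^-1 *: b by rewrite (jt_sym J).
have r15 : tp b e' e' = 2^-1 *: b by rewrite (jt_sym J).
rewrite /spin_el /spin_q.
rewrite !(tpDl, tpDm, tpDr, tpZl, tpZm, tpZr, tpNm) !conjCK.
rewrite !(te, te', ee', e'e, o1, o2, o3, o4, r1, r2, r3, r4, r5, r6, r7, r8, r9, r10, r11,
  r12, r13, r14, r15, b1, b2, d1, d2) [S c b]spinS_sym [S d c]spinS_sym.
lf.
Qed.

End SpinSymmetry.

End JordanTriples.

Local Open Scope complex_scope.

(** * Complex normed spaces *)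

Section Realify.
Variable R : realType.
(** An alias carrying the real structure, so that it does not compete with the complex one on [E];
    the two are convertible. *)
Definition realify (E : lmodType R[i]) : Type := E.
Variable E : lmodType R[i].
HB.instance Definition _ := GRing.Zmodule.on (realify E).
Definition real_scale (r : R) (x : realify E) : realify E := (r%:C *: (x : E) : E).
Lemma real_scaleA (a b : R) (x : realify E) : real_scale a (real_scale b x) = real_scale (a * b) x.
Proof. by rewrite /real_scale scalerA -rmorphM. Qed.
Lemma real_scale1 : left_id 1 real_scale.
Proof. by move=> x; rewrite /real_scale rmorph1 scale1r. Qed.
Lemma real_scaleDr : right_distributive real_scale +%R.
Proof. by move=> a x y; rewrite /real_scale scalerDr. Qed.
Lemma real_scaleDl (x : realify E) : {morph real_scale^~ x : a b / a + b}.
Proof. by move=> a b; rewrite /real_scale rmorphD scalerDl. Qed.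
HB.instance Definition _ := GRing.Zmodule_isLmodule.Build R (realify E)
  real_scaleA real_scale1 real_scaleDr real_scaleDl.
Lemma real_scaleE (r : R) (x : realify E) : r *: x = (r%:C *: (x : E) : E).
Proof. by []. Qed.
End Realify.

Section ComplexModulus.
Variable R : realType.
Implicit Types k l : R[i].

(** The modulus on [R[i]] has values in [R[i]]; this is its real version. [nrm] does the same for
    vectors, which brings estimates within reach of [lra] and [nra]. *)
Definition cabs k : R := complex.Re `|k|.

Lemma cabsE k : `|k| = (cabs k)%:C.
Proof. by rewrite RRe_real // normr_real. Qed.

Lemma cabs_ge0 k : 0 <= cabs k.
Proof. by have := normr_ge0 k; rewrite cabsE -[0]/(0%:C) lecR. Qed.

Lemma cabsM k l : cabs (k * l) = cabs k * cabs l.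
Proof. by apply: (@complexI R); rewrite rmorphM /= -!cabsE normrM. Qed.

Lemma cabsD k l : cabs (k + l) <= cabs k + cabs l.
Proof. by rewrite -lecR rmorphD /= -!cabsE ler_normD. Qed.

Lemma cabsN k : cabs (- k) = cabs k.
Proof. by rewrite /cabs normrN. Qed.

Lemma cabs_real (r : R) : cabs r%:C = `|r|.
Proof. by rewrite /cabs normc_def /= expr0n addr0 sqrtr_sqr. Qed.

Lemma cabs_conj k : cabs k^* = cabs k.
Proof. by rewrite /cabs !normc_def /=; case: k => a b /=; rewrite sqrrN. Qed.

Lemma cabs_sqr k : cabs k ^+ 2 = complex.Re k ^+ 2 + complex.Im k ^+ 2.
Proof. by apply: (@complexI R); rewrite rmorphXn /= -cabsE add_Re2_Im2. Qed.

Lemma cabs_eq0 k : cabs k = 0 -> k = 0.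
Proof. by move=> k0; apply/eqP; rewrite -normr_eq0 cabsE k0. Qed.

Lemma cabs_i : cabs 'i = 1.
Proof.
have : cabs 'i ^+ 2 = 1 by rewrite cabs_sqr /= expr0n add0r expr1n.
by move=> /eqP; rewrite sqrf_eq1 => /orP[/eqP //|/eqP h]; have := cabs_ge0 'i; rewrite h; lra.
Qed.

Lemma Re_le_cabs k : complex.Re k <= cabs k.
Proof.
rewrite -lecR -cabsE; apply: le_trans (normc_ge_Re k).
by rewrite lecR ler_norm.
Qed.

Lemma cabs_le k : cabs k <= `|complex.Re k| + `|complex.Im k|.
Proof.
rewrite {1}[k]complexE; apply: le_trans (cabsD _ _) _.
by rewrite cabsM cabs_i mul1r !cabs_real.
Qed.

Lemma ReD k l : complex.Re (k + l) = complex.Re k + complex.Re l.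
Proof. by case: k l => ? ? []. Qed.

Lemma ReZ (r : R) k : complex.Re (r%:C * k) = r * complex.Re k.
Proof. by case: k => a b /=; rewrite mul0r subr0. Qed.

Lemma conj_realC (r : R) : Num.conj (r%:C) = r%:C.
Proof. exact: conjc_real. Qed.

Lemma mul_conj_cabs k : k * k^* = (cabs k ^+ 2)%:C.
Proof. by rewrite cabs_sqr; case: k => a b; apply/eqP; rewrite eq_complex /=; apply/andP; split; apply/eqP; ring. Qed.

End ComplexModulus.

Section Norm.
Variables (R : realType) (E : normedModType R[i]).
Implicit Types x y : E.

Definition nrm x : R := complex.Re `|x|.

Lemma nrmE x : `|x| = (nrm x)%:C.
Proof. by rewrite RRe_real // normr_real. Qed.

Lemma nrmZ (k : R[i]) x : nrm (k *: x) = cabs k * nrm x.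
Proof. by apply: (@complexI R); rewrite rmorphM /= -nrmE normrZ nrmE cabsE. Qed.

Lemma realify_is_norm : is_norm (nrm : realify E -> R).
Proof.
split.
- by move=> x y; rewrite -lecR rmorphD /= -!nrmE ler_normD.
- by move=> a x; rewrite real_scaleE nrmZ cabs_real.
- by move=> x nx; apply/eqP; rewrite -normr_eq0 nrmE nx.
Qed.
Let H := realify_is_norm.

Lemma nrmD x y : nrm (x + y) <= nrm x + nrm y. Proof. exact: (is_normD H). Qed.
Lemma nrm0_eq0 x : nrm x = 0 -> x = 0. Proof. exact: (is_norm0_eq H). Qed.
Lemma nrmN x : nrm (- x) = nrm x. Proof. exact: (norm_opp H). Qed.
Lemma nrm0 : nrm 0 = 0. Proof. exact: (norm_zero H). Qed.
Lemma nrm_ge0 x : 0 <= nrm x. Proof. exact: (norm_pos H). Qed.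
Lemma nrm_gt0 x : x <> 0 -> 0 < nrm x. Proof. exact: (norm_gt0 H). Qed.
Lemma nrm_sub x y : nrm (x - y) = nrm (y - x). Proof. exact: (norm_sub H). Qed.
Lemma nrm_leD x y : nrm x <= nrm (x - y) + nrm y. Proof. exact: (norm_leD H). Qed.
Lemma nrm_tri x y z : nrm (x - z) <= nrm (x - y) + nrm (y - z).
Proof. by have := nrmD (x - y) (y - z); rewrite addrA subrK. Qed.
Lemma nrmZr (r : R) x : nrm (r%:C *: x) = `|r| * nrm x.
Proof. by rewrite nrmZ cabs_real. Qed.

Lemma nrm_eps_eq0 x (K : R) : 0 <= K -> (forall eps, 0 < eps -> nrm x <= K * eps) -> x = 0.
Proof.
move=> K0 Hx; apply/nrm0_eq0/eqP; rewrite eq_le nrm_ge0 andbT leNgt; apply/negP => n0.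
have := Hx (nrm x / (2 * (K + 1))).
rewrite divr_gt0 ?mulr_gt0 ?ltr_wpDl // => /(_ isT); rewrite mulrA ler_pdivlMr ?mulr_gt0 ?ltr_wpDl //; nra.
Qed.

Lemma nrm_eps_le x (c : R) : (forall eps, 0 < eps -> nrm x <= c + eps) -> nrm x <= c.
Proof. by move=> h; apply/ler_addgt0Pr. Qed.

End Norm.

(** * Bounded functionals and weak cluster points *)

Section Dual.
Variables (R : realType) (E : normedModType R[i]).
Implicit Types x y : E.

Lemma pos_real (eps : R[i]) : 0 < eps -> exists2 r : R, 0 < r & eps = r%:C.
Proof.
move=> e0; have er : (complex.Re eps)%:C = eps by rewrite RRe_real // gtr0_real.
by exists (complex.Re eps) => //; rewrite -ltcR er.
Qed.

Lemma nbhs_nrm x (A : set E) : nbhs x A -> exists2 r, 0 < r & forall y, nrm (x - y) < r -> A y.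
Proof.
move=> /nbhs_ballP[_/posnumP[e] H].
have [r r0 er] := pos_real [gt0 of e%:num].
by exists r => // y yr; apply: H; rewrite -ball_normE /= nrmE er ltcR.
Qed.

Lemma dual_bound (psi : continuous_dual E) :
  exists2 K, 0 <= K & forall x, cabs (dual_fun psi x) <= K * nrm x.
Proof.
case: psi => psi cpsi; rewrite /dual_fun /=.
have nb0 : nbhs (psi 0) [set k : R[i]^o | `|psi 0 - k| < 1].
  by have := @nbhsx_ballx _ R[i]^o (psi 0) 1 ltr01; rewrite -ball_normE.
have nb := cpsi 0 _ nb0.
have [r r0 H] := nbhs_nrm nb; exists (2 / r); first by rewrite divr_ge0 // ltW.
move=> x; have [->|/eqP x0] := eqVneq x 0; first by rewrite linear0 nrm0 mulr0 -[0]/(0%:C : R[i]) cabs_real normr0.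
have n0 := nrm_gt0 x0; pose s := r / (2 * nrm x).
have s0 : 0 < s by rewrite divr_gt0 // mulr_gt0.
have := H (s%:C *: x); rewrite sub0r nrmN nrmZr (gtr0_norm s0).
have -> : s * nrm x = r / 2 by rewrite /s; field; rewrite gt_eqF.
rewrite ltr_pdivrMr ?ltr_pMr ?ltr1n // => /(_ isT).
rewrite /= linear0 sub0r normrN linearZ /= cabsE -[1]/(1%:C) ltcR.
rewrite cabsM cabs_real gtr0_norm // => h.
rewrite -(ler_pM2l s0); apply: le_trans (ltW h) _.
by rewrite le_eqVlt; apply/orP; left; apply/eqP; rewrite /s; field; rewrite !gt_eqF.
Qed.

Lemma dual_exists (f : E -> R[i]) (K : R) : (forall k x y, f (k *: x + y) = k * f x + f y) ->
  (forall x, cabs (f x) <= K * nrm x) -> exists psi : continuous_dual E, dual_fun psi =1 f.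
Proof.
move=> lf bf; pose L : {linear E -> R[i]^o} :=
  HB.pack f (GRing.isLinear.Build R[i] E R[i]^o *:%R f lf).
have cL : continuous L.
  apply: bounded_linear_continuous; apply/linear_boundedP.
  near=> M; move=> x; have M0 : K%:C <= M by near: M; apply: nbhs_pinfty_ge; by apply/complex_realP; exists K.
  have -> : `|L x| = (cabs (f x))%:C by rewrite -cabsE.
  apply: (@le_trans _ _ ((K * nrm x)%:C)); first by rewrite lecR.
  by rewrite rmorphM /= nrmE; apply: ler_wpM2r => //; rewrite -[0]/(0%:C) lecR nrm_ge0.
by exists (exist _ L cL).
Unshelve. all: by end_near.
Qed.

Definition subspace (W : E -> Prop) : Prop :=
  W 0 /\ forall (k : R[i]) x y, W x -> W y -> W (k *: x + y).

(* The real functional [f] dominated by the distance to [W] vanishes on [W], and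
   [x |-> f x - i f (i x)] is complex linear. *)
Lemma separation (W : E -> Prop) x0 d : subspace W -> 0 < d ->
  (forall w, W w -> d <= nrm (x0 - w)) ->
  exists psi : continuous_dual E, (forall w, W w -> dual_fun psi w = 0) /\ dual_fun psi x0 <> 0.
Proof.
move=> [W0 WD] d0 dW.
have WZ k x : W x -> W (k *: x) by move=> Wx; rewrite -[_ *: _]addr0; apply: WD.
pose F (w : E) (x : realify E) := nrm ((x : E) - w).
pose p (x : realify E) := inf [set F w x | w in W].
have W1 : [set w | W w] !=set0 by exists 0.
have sp : sublinear p.
  apply: (@sublinear_inf _ _ _ W F (fun=> 0)) => //.
  - by move=> w x _; exact: nrm_ge0.
  - move=> v w x y Wv Ww; exists (v + w); first by rewrite -[v]scale1r; apply: WD.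
    by rewrite /F opprD addrACA; exact: nrmD.
  - move=> w t x Ww t0; exists (t%:C *: w); first exact: WZ.
    by rewrite /F real_scaleE -scalerBr nrmZr gtr0_norm.
have p_le x w : W w -> p x <= F w x.
  by move=> Ww; apply: ge_inf; [exists 0 => _ [v _ <-]; exact: nrm_ge0|exists w].
have [f [lf fp fx0]] := @hahn_banach R (realify E) p x0 sp.
have fD (x y : E) : f (x + y) = f x + f y by have := lf 1 x y; rewrite scale1r mul1r.
have f0 : f 0 = 0 by have := fD 0 0; rewrite addr0; lra.
have fZ (a : R) (x : E) : f (a%:C *: x) = a * f x.
  by have := lf a x 0; rewrite f0 !addr0.
have fN (x : E) : f (- x) = - f x.
  by have := fD x (- x); rewrite subrr f0; lra.
have fle (x : E) : f x <= nrm x.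
  by apply: le_trans (fp x) _; have := p_le x 0 W0; rewrite /F subr0.
have fW w : W w -> f w = 0.
  move=> Ww; have h v : W v -> f v <= 0.
    by move=> Wv; apply: le_trans (fp v) _; have := p_le v v Wv; rewrite /F subrr nrm0.
  apply/eqP; rewrite eq_le h //= -oppr_le0 -fN; apply: h.
  by rewrite -scaleN1r; exact: WZ.
pose g (x : E) : R[i] := (f x)%:C - 'i * (f ('i *: x))%:C.
have gD x y : g (x + y) = g x + g y.
  by rewrite /g scalerDr !fD !rmorphD /=; ring.
have gZ (k : R[i]) x : g (k *: x) = k * g x.
  have i2 : 'i * 'i = -1 :> R[i] by rewrite -expr2 sqr_i.
  rewrite [k]complexE complexiE; move: (complex.Re k) (complex.Im k) => a b.
  have -> : (a%:C + 'i * b%:C) *: x = a%:C *: x + b%:C *: ('i *: x).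
    by rewrite scalerDl scalerA [_ * 'i]mulrC.
  rewrite gD /g !fZ.
  have -> : 'i *: (a%:C *: x) = a%:C *: ('i *: x) by rewrite !scalerA mulrC.
  have -> : 'i *: (b%:C *: ('i *: x)) = b%:C *: (- x).
    by rewrite !scalerA -scaleN1r scalerA; congr (_ *: _); rewrite -i2; ring.
  rewrite !fZ fN !rmorphM /= rmorphN /=.
  apply/eqP; rewrite -subr_eq0; apply/eqP.
  transitivity (b%:C * (f ('i *: x))%:C * (1 + 'i * 'i)); first by ring.
  by rewrite i2 addrN mulr0.
have [||psi psiE] := @dual_exists g 2.
- by move=> k x y; rewrite gD gZ.
- move=> x; apply: le_trans (cabsD _ _) _.
  rewrite cabsN cabsM cabs_i mul1r !cabs_real.
  have nf (y : E) : `|f y| <= nrm y.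
    by rewrite ler_norml fle andbT lerNl -fN -(nrmN y) fle.
  have := nf x; have := nf ('i *: x); rewrite nrmZ cabs_i mul1r; lra.
exists psi; split=> [w Ww|].
  by rewrite psiE /g !fW ?mulr0 ?subr0 //; exact: WZ.
rewrite psiE => gx0.
have fpos : d <= f x0.
  by rewrite fx0; apply: lb_le_inf; [exists (F 0 x0), 0|move=> _ [w Ww <-]; exact: dW].
have : complex.Re (g x0) = f x0 by rewrite /g /=; ring.
by rewrite gx0 /=; lra.
Qed.

(** Tested by one functional at a time. This is weaker than clustering in the weak topology, but
    every use below involves a single functional. *)
Definition weak_cluster (u : nat -> E) (w : E) : Prop :=
  forall (psi : continuous_dual E) (eps : R) N, 0 < eps ->
  exists2 n, (N <= n)%N & cabs (dual_fun psi (u n - w)) < eps.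

Lemma weak_cluster_sequence (A : set E) (u : nat -> E) :
  precompact (A : set (weak_space E)) -> (forall n, A (u n)) -> exists w, weak_cluster u w.
Proof.
rewrite precompactE => cA uA.
pose FF : set_system (weak_space E) := (u : nat -> weak_space E) @ \oo.
have FA : FF (closure (A : set (weak_space E))).
  by exists 0%N => // n _ /=; apply: subset_closure; exact: uA.
have [w [_ cw]] := cA FF (fmap_proper_filter _ _) FA.
exists w => psi eps N e0.
pose B : set (weak_space E) := [set y : E | cabs (dual_fun psi (y - w)) < eps].
have nB : nbhs (w : weak_space E) B.
  have /cvg_sup /(_ psi) cw' : (nbhs (w : weak_space E) --> (w : weak_space E)) by [].
  apply: cw'.
  have cpsi := @initial_continuous _ _ (dual_fun psi) w.
  have nS : nbhs (dual_fun psi w) [set k : R[i]^o | cabs (k - dual_fun psi w) < eps].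
    apply/nbhs_ballP; exists eps%:C; first by rewrite /= -[0]/(0%:C) ltcR.
    by move=> k; rewrite -ball_normE /= distrC cabsE ltcR.
  have SB : dual_fun psi @^-1` [set k : R[i]^o | cabs (k - dual_fun psi w) < eps] = B.
    by apply/funext => y; rewrite /B /= /dual_fun linearB.
  have h : nbhs (w : initial_topology (dual_fun psi)) (dual_fun psi @^-1`
    [set k : R[i]^o | cabs (k - dual_fun psi w) < eps]) := cpsi _ nS.
  by rewrite SB in h.
have [|_ [[n Nn <-] Bn]] := cw [set u n | n in [set n | (N <= n)%N]] B _ nB.
  by exists N => // n Nn; exists n.
by exists n.
Qed.

(** Mazur's theorem for subspaces: a functional vanishing on [W] vanishes at its weak cluster
    points, so by [separation] these are at distance 0. *)
Lemma weak_cluster_subspace (W : E -> Prop) (u : nat -> E) w eps : subspace W ->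
  (forall n, W (u n)) -> weak_cluster u w -> 0 < eps -> exists2 y, W y & nrm (w - y) < eps.
Proof.
move=> sW Wu cw e0; apply: contrapT => H.
have [|psi [pW pw]] := @separation W w eps sW e0.
  by move=> y Wy; rewrite leNgt; apply/negP => h; apply: H; exists y.
have [k0|k0] := eqVneq (cabs (dual_fun psi w)) 0; first by move/cabs_eq0: k0.
have kp : 0 < cabs (dual_fun psi w) by rewrite lt_neqAle eq_sym k0 cabs_ge0.
have [n _] := cw psi _ 0 kp.
rewrite [dual_fun _ _]linearB -/(dual_fun psi w) -/(dual_fun psi (u n)) pW // sub0r cabsN; lra.
Qed.

End Dual.

(** * Norm estimates for the triple product *)

Section JBNorm.
Variables (R : realType) (E : completeNormedModType R[i]).
Variable tp : E -> E -> E -> E.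
Hypothesis JB : JBstar_triple tp.

Lemma jb_jordan : jordan_triple tp.
Proof.
split.
- by move=> b c k x y; exact: (JB_linear JB).
- exact: (JB_sym JB).
- by move=> a c k x y; exact: (JB_conj_linear JB).
- move=> a b x y z; have := JB_identity JB a b x y z; rewrite /tripleL => <-.
  by rewrite addrC addrA [_ + tp a b _]addrC addrK.
Qed.
Let J := jb_jordan.

(** Continuity at 0 and homogeneity, with no control on [K]; [expr3_le] is the means to get rid of
    it. *)
Lemma tp_bound : exists2 K, 0 <= K & forall x y z, nrm (tp x y z) <= K * nrm x * nrm y * nrm z.
Proof.
have c0 := @JB_continuous _ _ _ JB (0, 0, 0).
have nb0 : nbhs (tp 0 0 0) [set k : E | `|tp 0 0 0 - k| < 1].
  by have := @nbhsx_ballx _ E (tp 0 0 0) 1 ltr01; rewrite -ball_normE.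
have nb := c0 _ nb0.
have /nbhs_ballP[e e0 He] := nb.
have [r r0 er] := pos_real e0.
pose s := r / 2; have s0 : 0 < s by rewrite divr_gt0.
have K0 : 0 <= s^-1 ^+ 3 by rewrite exprn_ge0 // invr_ge0 ltW.
exists (s^-1 ^+ 3) => // x y z.
have N x' : ball (0 : E) e ((s / nrm x')%:C *: x') \/ x' = 0.
  have [->|/eqP x0] := eqVneq x' 0; [by right|left].
  have n0 := nrm_gt0 x0.
  rewrite -ball_normE /= sub0r normrN nrmE er ltcR nrmZr gtr0_norm ?divr_gt0 //.
  by rewrite divfK ?gt_eqF // /s ltr_pdivrMr // ltr_pMr // ltr1n.
clearbody s.
have Z0 : 0 <= s^-1 ^+ 3 * nrm x * nrm y * nrm z.
  by move: (s^-1 ^+ 3) K0 => k k0; rewrite !mulr_ge0 ?nrm_ge0 //.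
have [bx|x0] := N x; last by rewrite x0 (tp0l J) nrm0 mulr0 !mul0r.
have [bY|y0] := N y; last by rewrite y0 (tp0m J) nrm0 mulr0 mul0r.
have [bz|z0] := N z; last by rewrite z0 (tp0r J) nrm0 mulr0.
have [->|/eqP x0] := eqVneq x 0; first by rewrite (tp0l J) nrm0 mulr0 !mul0r.
have [->|/eqP y0] := eqVneq y 0; first by rewrite (tp0m J) nrm0 mulr0 mul0r.
have [->|/eqP z0] := eqVneq z 0; first by rewrite (tp0r J) nrm0 mulr0.
have nx := nrm_gt0 x0; have ny := nrm_gt0 y0; have nz := nrm_gt0 z0.
have := He ((s / nrm x)%:C *: x, (s / nrm y)%:C *: y, (s / nrm z)%:C *: z) (conj (conj bx bY) bz).
rewrite /= (tp0l J) sub0r normrN nrmE -[1]/(1%:C) ltcR !(tpZl J, tpZm J, tpZr J).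
rewrite !nrmZ cabs_conj !cabs_real !gtr0_norm ?divr_gt0 // => h.
rewrite -(ler_pM2l (x := (s / nrm x) * ((s / nrm y) * (s / nrm z)))); last first.
  by rewrite !mulr_gt0 ?invr_gt0.
rewrite -!mulrA in h *; apply: le_trans (ltW h) _.
by rewrite le_eqVlt; apply/orP; left; apply/eqP; field; rewrite !gt_eqF.
Qed.

Lemma nrm_cube x : nrm (tp x x x) = nrm x ^+ 3.
Proof. by apply: (@complexI R); rewrite rmorphXn /= -!nrmE (JB_norm JB). Qed.

Definition tends (u : nat -> E) (l : E) : Prop :=
  forall eps, 0 < eps -> exists N, forall n, (N <= n)%N -> nrm (u n - l) < eps.

Lemma tends_cst l : tends (fun=> l) l.
Proof. by move=> eps e0; exists 0%N => n _; rewrite subrr nrm0. Qed.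

Lemma tends_bounded u l : tends u l -> exists2 M, 0 < M & exists N, forall n, (N <= n)%N -> nrm (u n) <= M.
Proof.
move=> ul; have [N HN] := ul 1 ltr01; exists (1 + nrm l).
  by have := nrm_ge0 l; lra.
by exists N => n /HN; have := nrm_leD (u n) l; lra.
Qed.

Lemma tends_sub u l (f : nat -> nat) : tends u l -> (forall n, (n <= f n)%N) -> tends (u \o f) l.
Proof. by move=> ul fn eps e0; have [N HN] := ul _ e0; exists N => n Nn; apply: HN; exact: leq_trans (fn n). Qed.

Lemma tends_unique u l l' : tends u l -> tends u l' -> l = l'.
Proof.
move=> ul ul'; apply/eqP; rewrite -subr_eq0; apply/eqP; apply: (@nrm_eps_eq0 _ _ _ 2) => // eps e0.
have [N HN] := ul _ e0; have [N' HN'] := ul' _ e0.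
have := HN (maxn N N') (leq_maxl _ _); have := HN' (maxn N N') (leq_maxr _ _).
by have := nrm_tri l (u (maxn N N')) l'; rewrite (nrm_sub l (u _)); lra.
Qed.

Lemma tends_lin k u v l m : tends u l -> tends v m -> tends (fun n => k *: u n + v n) (k *: l + m).
Proof.
move=> ul vm eps e0; have c1 : 0 < cabs k + 1 by have := cabs_ge0 k; lra.
have [N HN] := ul _ (divr_gt0 e0 (mulr_gt0 (ltr0Sn R 1) c1)).
have [N' HN'] := vm _ (divr_gt0 e0 (ltr0Sn R 1)).
exists (maxn N N') => n; rewrite geq_max => /andP[/HN h /HN' h'].
rewrite opprD addrACA -scalerBr; apply: le_lt_trans (nrmD _ _) _; rewrite nrmZ.
rewrite ltr_pdivlMr ?mulr_gt0 // in h; have := nrm_ge0 (u n - l); have := cabs_ge0 k.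
rewrite ltr_pdivlMr // in h'; nra.
Qed.

Lemma tends_bound u l c : tends u l -> (forall n, nrm (u n) <= c) -> nrm l <= c.
Proof.
move=> ul uc; apply: nrm_eps_le => eps e0; have [N HN] := ul _ e0.
by have := HN _ (leqnn N); have := uc N; have := nrm_leD l (u N); rewrite (nrm_sub l); lra.
Qed.

Lemma tends_nrm u l : tends u l -> forall eps, 0 < eps -> exists N, forall n, (N <= n)%N -> `|nrm (u n) - nrm l| < eps.
Proof.
move=> ul eps e0; have [N HN] := ul _ e0; exists N => n /HN h.
have := nrm_leD (u n) l; have := nrm_leD l (u n); rewrite (nrm_sub l) ltr_norml => h1 h2.
by apply/andP; split; lra.
Qed.

Lemma tends_tp u v w a b c : tends u a -> tends v b -> tends w c ->
  tends (fun n => tp (u n) (v n) (w n)) (tp a b c).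
Proof.
have [K K0 HK] := tp_bound => ua vb wc eps e0.
have [M1 M10 [N1 H1]] := tends_bounded ua; have [M2 M20 [N2 H2]] := tends_bounded vb.
pose Q := 1 + K * M1 * M2 + K * M1 * nrm c + K * nrm b * nrm c.
have p1 : 0 <= K * M1 * M2 by rewrite !mulr_ge0 // ltW.
have p2 : 0 <= K * M1 * nrm c by rewrite !mulr_ge0 ?nrm_ge0 // ltW.
have p3 : 0 <= K * nrm b * nrm c by rewrite !mulr_ge0 ?nrm_ge0 //.
have Q0 : 0 < Q by rewrite /Q; lra.
have d0 := divr_gt0 e0 Q0.
have [N3 H3] := ua _ d0; have [N4 H4] := vb _ d0; have [N5 H5] := wc _ d0.
exists (maxn N1 (maxn N2 (maxn N3 (maxn N4 N5)))) => n.
rewrite !geq_max => /andP[/H1 h1 /andP[/H2 h2 /andP[/H3 h3 /andP[/H4 h4 /H5 h5]]]].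
have -> : tp (u n) (v n) (w n) - tp a b c = tp (u n) (v n) (w n - c) + tp (u n) (v n - b) c + tp (u n - a) b c.
  by rewrite !(tpDl J, tpDm J, tpDr J, tpNl J, tpNm J, tpNr J) !addrA !subrK.
apply: le_lt_trans (nrmD _ _) _.
have q1 : nrm (tp (u n) (v n) (w n - c)) <= K * M1 * M2 * (eps / Q).
  apply: le_trans (HK _ _ _) _; apply: ler_pM; rewrite ?mulr_ge0 ?nrm_ge0 //; last exact: ltW.
  by apply: ler_pM; rewrite ?mulr_ge0 ?nrm_ge0 //; apply: ler_wpM2l.
have q2 : nrm (tp (u n) (v n - b) c) <= K * M1 * nrm c * (eps / Q).
  apply: le_trans (HK _ _ _) _; rewrite mulrAC; apply: ler_pM; rewrite ?mulr_ge0 ?nrm_ge0 //; last exact: ltW.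
  by apply: ler_wpM2r; rewrite ?nrm_ge0 //; apply: ler_wpM2l.
have q3 : nrm (tp (u n - a) b c) <= K * nrm b * nrm c * (eps / Q).
  apply: le_trans (HK _ _ _) _; rewrite -!mulrA; apply: ler_wpM2l => //.
  rewrite mulrC -!mulrA; apply: ler_wpM2l; rewrite ?nrm_ge0 //; apply: ler_wpM2l; rewrite ?nrm_ge0 //; exact: ltW.
have q4 : nrm (tp (u n) (v n) (w n - c) + tp (u n) (v n - b) c) <= K * M1 * M2 * (eps / Q) + K * M1 * nrm c * (eps / Q).
  by apply: le_trans (nrmD _ _) _; exact: lerD.
have : Q * (eps / Q) = eps by rewrite mulrC divfK ?gt_eqF.
rewrite /Q; move: d0; rewrite /Q; move: (eps / _) q1 q2 q3 q4 => d; lra.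
Qed.

Lemma cube_iter_nrm x k : nrm (iter k (fun y => tp y y y) x) = nrm x ^+ (3 ^ k).
Proof.
elim: k => [|k IH] /=; first by rewrite expr1.
by rewrite nrm_cube IH -exprM expnS mulnC.
Qed.

(** If [y < x], the powers of [x / y] outgrow [K] by Bernoulli's inequality. Estimates stable under
    taking cubes lose their constant in this way. *)
Lemma expr3_le (x y K : R) : 0 <= x -> 0 <= y -> 0 <= K ->
  (forall k, x ^+ (3 ^ k) <= K * y ^+ (3 ^ k)) -> x <= y.
Proof.
move=> x0 y0 K0 H; rewrite leNgt; apply/negP => yx.
have xp : 0 < x by exact: le_lt_trans yx.
have [y00|y00] := eqVneq y 0.
  by have := H 0%N; rewrite !expr1 y00 mulr0; lra.
have yp : 0 < y by rewrite lt_neqAle eq_sym y00.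
pose q := x / y; have q1 : 1 < q by rewrite /q ltr_pdivlMr // mul1r.
have Hq k : q ^+ (3 ^ k) <= K by rewrite expr_div_n ler_pdivrMr ?exprn_gt0.
have B n : 1 + n%:R * (q - 1) <= q ^+ n.
  elim: n => [|n IH]; first by rewrite mul0r addr0 expr0.
  rewrite exprS -natr1; have n0 : 0 <= n%:R :> R by rewrite ler0n.
  have : q * (1 + n%:R * (q - 1)) <= q * q ^+ n by rewrite ler_pM2l // (lt_trans ltr01).
  by have := mulr_ge0 n0 (sqr_ge0 (q - 1)); rewrite expr2; nra.
pose n := Num.trunc (K / (q - 1)).
have nK : K / (q - 1) < n.+1%:R by rewrite truncnS_gt.
rewrite ltr_pdivrMr in nK; last lra.
have n3 : (n.+1 <= 3 ^ n.+1)%N by apply: ltnW; exact: ltn_expl.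
have := Hq n.+1; have := B (3 ^ n.+1)%N.
have : n.+1%:R * (q - 1) <= (3 ^ n.+1)%:R * (q - 1) by rewrite ler_pM2r ?ler_nat // subr_gt0.
lra.
Qed.

(** An eigenvalue is in the spectrum, as a left inverse would kill the eigenvector. The positivity
    axiom enters through this lemma. *)
Lemma JB_eigen_ge0 a x (c : R[i]) : tp a a x = c *: x -> x <> 0 -> 0 <= c.
Proof.
move=> ax x0; apply: (JB_positive JB (a := a)) => -[S [_ S1 _]].
by apply: x0; rewrite -(S1 x) /tripleL ax subrr linear0.
Qed.

End JBNorm.

(** * The limit of the odd powers *)

Lemma central_binomial_step m :
  ('C((m.+1).*2, m.+1) * m.+1 = 2 * (m.*2.+1) * 'C(m.*2, m))%N.
Proof.
have f1 := @bin_fact m.*2 m; have f2 := @bin_fact (m.+1).*2 m.+1.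
have e1 : (m.*2 - m = m)%N by lia.
have e2 : ((m.+1).*2 - m.+1 = m.+1)%N by lia.
rewrite e1 in f1; rewrite e2 in f2.
have {}f1 := f1 ltac:(lia); have {}f2 := f2 ltac:(lia).
have F : ((m.+1).*2`! = (m.*2.+2) * (m.*2.+1) * (m.*2)`!)%N by rewrite doubleS !factS mulnA.
rewrite F -f1 !factS in f2.
have m0 : (0 < m`!)%N by exact: fact_gt0.
have m1 : (0 < m.+1 * (m`! * m`!))%N by rewrite !muln_gt0 m0.
apply/eqP; rewrite -(eqn_pmul2r m1); apply/eqP; rewrite -muln2 in f2 *.
nia.
Qed.

(** The decay of [C(2m, m) / 4 ^ m] like the inverse square root of [2 m + 1], squared to stay among
    natural numbers. *)
Lemma central_binomial_bound m : ('C(m.*2, m) ^ 2 * m.*2.+1 <= 16 ^ m)%N.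
Proof.
elim: m => [|m IH]; first by rewrite bin0.
have st := central_binomial_step m.
rewrite -(leq_pmul2r (m := m.+1 ^ 2)) ?expn_gt0 //.
set c := 'C(_, m.+1) in st *; set d := 'C(m.*2, m) in IH st *.
have -> : (c ^ 2 * ((m.+1).*2).+1 * m.+1 ^ 2 = (c * m.+1) ^ 2 * ((m.+1).*2).+1)%N by rewrite expnMn; ring.
rewrite st [(16 ^ m.+1)%N]expnS; set k := (16 ^ m)%N in IH *.
have -> : ((2 * (m.*2).+1 * d) ^ 2 * ((m.+1).*2).+1 =
  (d ^ 2 * m.*2.+1) * (4 * ((m.*2).+1 * ((m.+1).*2).+1)))%N by rewrite !expnMn; ring.
have h : (4 * ((m.*2).+1 * ((m.+1).*2).+1) <= 16 * m.+1 ^ 2)%N by rewrite -!muln2 expnS expn1; nia.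
by rewrite [(16 * k)%N]mulnC -[(k * 16 * _)%N]mulnA; exact: leq_mul IH h.
Qed.

Lemma binomial_increasing m k : (k < m)%N -> ('C(m.*2, k) <= 'C(m.*2, k.+1))%N.
Proof.
move=> km; rewrite -(leq_pmul2l (m := k.+1)) // mul_bin_left leq_mul2r.
by apply/orP; right; lia.
Qed.

Section Abel.
Variables (R : realType) (E : normedModType R[i]) (F : nat -> E) (c : nat -> R).
Hypothesis F1 : forall k, nrm (F k) <= 1.

(** Summation by parts: because the coefficients increase, only the last one appears in the
    bound. *)
Lemma abel_sum j : 0 <= c 0%N -> (forall k, (k < j)%N -> c k <= c k.+1) ->
  nrm (\sum_(0 <= k < j) (c k)%:C *: (F k - F k.+1)) <= 2 * c j.
Proof.
move=> c0 cS; pose S j := \sum_(0 <= k < j) (c k)%:C *: (F k - F k.+1).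
suff [H cj] : nrm (S j + (c j)%:C *: F j) <= c j /\ 0 <= c j.
  have := nrmD (S j + (c j)%:C *: F j) (- ((c j)%:C *: F j)); rewrite addrK nrmN nrmZr ger0_norm //.
  have := F1 j; rewrite -/(S j); nra.
elim: j cS => [|j IH] cS.
  by rewrite /S big_geq // add0r nrmZr ger0_norm //; split=> //; have := F1 0; nra.
have [k kj|H cj] := IH; first by apply: cS; exact: ltnW.
have cjS := cS j (ltnSn j); split; last exact: le_trans cjS.
have -> : S j.+1 + (c j.+1)%:C *: F j.+1 = (S j + (c j)%:C *: F j) + (c j.+1 - c j)%:C *: F j.+1.
  by rewrite /S big_nat_recr //= rmorphB; lmod_with E R[i]; ring.
apply: le_trans (nrmD _ _) _; rewrite nrmZr ger0_norm ?subr_ge0 //.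
have := F1 j.+1; nra.
Qed.

End Abel.

Lemma binomial_telescope (R : comNzRingType) (x y : {poly R}) n :
  (x + y) ^+ n * (x - y) = \sum_(0 <= k < n.+1) ('C(n, k))%:R *:
    (x ^+ (n.+1 - k) * y ^+ k - x ^+ (n.+1 - k.+1) * y ^+ k.+1).
Proof.
rewrite exprDn mulr_suml big_mkord; apply: eq_bigr => i _.
have -> : (n.+1 - i = (n - i).+1)%N by rewrite subSn // -ltnS.
have -> : (n.+1 - i.+1 = n - i)%N by rewrite subSS.
rewrite scaler_nat (exprS _ (n - i)) (exprS _ i).
move: (x ^+ _) (y ^+ _) ('C(_, _)) => p q b.
by rewrite -[in LHS]mulr_natr -[in RHS]mulr_natr; ring.
Qed.

Section OddCalculus.
Variables (R : realType) (E : completeNormedModType R[i]).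
Variable tp : E -> E -> E -> E.
Hypothesis JB : JBstar_triple tp.
Variable a : E.
Hypothesis na : nrm a = 1.

Local Notation C := R[i].
Let J := jb_jordan JB.
Let T y := tp a a y.
Let A n := iter n T a.

Let ATP i j k : tp (A i) (A j) (A k) = A (i + j + k).+1.
Proof. exact: (odd_powers_tp J a i j k). Qed.

(** [p(T) a], the odd functional calculus of [a] with ['X] standing for [T]. By [pv_tp] the triple
    product becomes a product of polynomials; the extra ['X] accounts for the two surplus factors
    [a]. *)
Let pv (p : {poly C}) : E := \sum_(i < size p) p`_i *: A i.

Let pvE n (p : {poly C}) : (size p <= n)%N -> pv p = \sum_(i < n) p`_i *: A i.
Proof.
move=> sn; rewrite /pv (big_ord_widen n (fun i => p`_i *: A i) sn) big_mkcond /=.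
apply: eq_bigr => i _; case: ltnP => // h; by rewrite nth_default // scale0r.
Qed.

Let pv_lin (k : C) p q : pv (k *: p + q) = k *: pv p + pv q.
Proof.
pose n := maxn (size (k *: p + q)) (maxn (size p) (size q)).
rewrite !(@pvE n) ?leq_max ?leqnn ?orbT // scaler_sumr -big_split; apply: eq_bigr => i _.
by rewrite coefD coefZ scalerDl scalerA.
Qed.

Let pv0 : pv 0 = 0. Proof. by rewrite /pv size_poly0 big_ord0. Qed.
Let pvD p q : pv (p + q) = pv p + pv q.
Proof. by have := pv_lin 1 p q; rewrite !scale1r. Qed.
Let pvZ k p : pv (k *: p) = k *: pv p.
Proof. by have := pv_lin k p 0; rewrite pv0 !addr0. Qed.
Let pvN p : pv (- p) = - pv p.
Proof. by rewrite -scaleN1r pvZ scaleN1r. Qed.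
Let pvB p q : pv (p - q) = pv p - pv q. Proof. by rewrite pvD pvN. Qed.

Let pvX i : pv 'X^i = A i.
Proof.
rewrite (@pvE i.+1) ?size_polyXn // (bigD1 ord_max) //= coefXn eqxx scale1r big1 ?addr0 //.
by move=> j /eqP ji; rewrite coefXn; case: eqP => [e|_]; [case: ji; exact: val_inj|rewrite scale0r].
Qed.

Let poly_monomials (P : {poly C} -> Prop) : P 0 -> (forall k p q, P p -> P q -> P (k *: p + q)) ->
  (forall i, P 'X^i) -> forall p, P p.
Proof.
move=> P0 PD PX p; rewrite -[p]coefK poly_def; elim/big_ind: _ => //.
  by move=> x y Px Py; rewrite -[x]scale1r; exact: PD.
by move=> i _; rewrite -[_ *: _]addr0; exact: PD.
Qed.

Let cj (p : {poly C}) : {poly C} := map_poly Num.conj p.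

Let cjD p q : cj (p + q) = cj p + cj q. Proof. exact: rmorphD. Qed.
Let cjM p q : cj (p * q) = cj p * cj q. Proof. exact: rmorphM. Qed.
Let cjZ (k : C) p : cj (k *: p) = k^* *: cj p. Proof. exact: map_polyZ. Qed.
Let cjX : cj 'X = 'X. Proof. exact: map_polyX. Qed.
Let cj1 : cj 1 = 1. Proof. exact: rmorph1. Qed.
Let cjK p : cj (cj p) = p.
Proof. by apply/polyP => i; rewrite !coef_map /= conjCK. Qed.
Let cjXn i : cj 'X^i = 'X^i. Proof. exact: map_polyXn. Qed.
Let cjE p n : cj (p ^+ n) = cj p ^+ n. Proof. exact: rmorphXn. Qed.

Let pv_tp p q r : tp (pv p) (pv q) (pv r) = pv (p * cj q * r * 'X).
Proof.
elim/poly_monomials: p => [|k p p' IH IH'|i]; first by rewrite pv0 (tp0l J) !mul0r pv0.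
  by rewrite pv_lin (jt_lin J) IH IH' -pv_lin; congr pv; rewrite -!mul_polyC; ring.
elim/poly_monomials: q => [|k q q' IH IH'|j]; first by rewrite pv0 (tp0m J) /cj rmorph0 mulr0 !mul0r pv0.
  by rewrite pv_lin (jt_conj J) IH IH' -pv_lin cjD cjZ; congr pv; rewrite -!mul_polyC; ring.
elim/poly_monomials: r => [|k r r' IH IH'|m]; first by rewrite pv0 (tp0r J) mulr0 !mul0r pv0.
  by rewrite pv_lin (tpDr J) (tpZr J) IH IH' -pv_lin; congr pv; rewrite -!mul_polyC; ring.
by rewrite cjXn -!exprD -exprSr !pvX ATP.
Qed.

Let N p := nrm (pv p).
Let cub p := p * cj p * p * 'X.

Let N_cub p : N (cub p) = N p ^+ 3.
Proof. by rewrite /N /cub -pv_tp nrm_cube. Qed.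

Let ND p q : N (p + q) <= N p + N q.
Proof. by rewrite /N pvD; exact: nrmD. Qed.

Let N_cub_iter k p : N (iter k cub p) = N p ^+ (3 ^ k).
Proof.
elim: k => [|k IH] /=; first by rewrite expr1.
by rewrite N_cub IH -exprM expnS mulnC.
Qed.

Let N1 : N 1 = 1. Proof. by rewrite /N -(expr0 'X) pvX /A /= na. Qed.

Let bounded_mul q := exists2 K, 0 <= K & forall p, N (q * p) <= K * N p.
Let contr q := forall p, N (q * p) <= N p.

Let pv_XM p : pv ('X * p) = T (pv p).
Proof.
have e : a = pv 1 by rewrite -(expr0 'X) pvX.
by rewrite /T {1 2}e pv_tp cj1 !mul1r mulrC.
Qed.

Let bounded_mulP q : bounded_mul q.
Proof.
have [K K0 HK] := tp_bound JB.
have bX r : bounded_mul r -> bounded_mul (r * 'X).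
  move=> [L L0 HL]; exists (L * K) => [|p]; first exact: mulr_ge0.
  rewrite -mulrA; apply: le_trans (HL _) _; rewrite -mulrA; apply: ler_wpM2l => //.
  by rewrite /N pv_XM; have := HK a a (pv p); rewrite na !mulr1.
elim/poly_ind: q => [|q c [L L0 HL]]; first by exists 0 => // p; rewrite mul0r /N pv0 nrm0 mul0r.
have [M M0 HM] := bX q (ex_intro2 _ _ L L0 HL).
exists (M + cabs c) => [|p]; first by rewrite addr_ge0 // cabs_ge0.
rewrite mulrDl mul_polyC mulrDl; apply: le_trans (ND _ _) _.
by apply: lerD => //; rewrite /N pvZ nrmZ.
Qed.

(* With [K] a bound of the multiplication by [q], iterating the cube gives
   [N (q p) ^ (3^k) <= K * N p ^ (3^k)] for all [k]. *)
Let contr_of_square q : contr (q * cj q) -> contr q.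
Proof.
move=> cq p; have [K K0 HK] := bounded_mulP q.
have cqs s r : N ((q * cj q) ^+ s * r) <= N r.
  elim: s => [|s IH]; first by rewrite expr0 mul1r.
  by rewrite exprS -mulrA; apply: le_trans (cq _) IH.
have H k : exists s, iter k cub (q * p) = (q * cj q) ^+ s * (q * iter k cub p).
  elim: k => [|k [s IH]]; first by exists 0; rewrite expr0 mul1r.
  exists (s + s + s).+1; rewrite iterS IH iterS /cub.
  rewrite !cjM cjE cjM cjK exprS !exprD [cj q * q]mulrC.
  by move: (iter k cub p) (_ ^+ s) => r u; ring.
apply: (@expr3_le _ _ _ K); rewrite ?nrm_ge0 // => k.
rewrite -!N_cub_iter; have [s ->] := H k; exact: le_trans (cqs _ _) (HK _).
Qed.

Let contr_mul p q : contr p -> contr q -> contr (p * q).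
Proof. by move=> cp cq r; rewrite -mulrA; apply: le_trans (cp _) (cq _). Qed.

Let contr1 : contr 1. Proof. by move=> p; rewrite mul1r. Qed.

Let contr_exp p n : contr p -> contr (p ^+ n).
Proof. by move=> cp; elim: n => [|n IH]; rewrite ?expr0 // exprS; exact: contr_mul. Qed.

Let contr_half p q : contr p -> contr q -> contr (2^-1 *: (p + q)).
Proof.
move=> cp cq r; rewrite -scalerAl mulrDl /N pvZ nrmZ.
have -> : cabs (2^-1 : C) = 2^-1 :> R.
  have -> : (2^-1 : C) = (2^-1 : R)%:C by rewrite fmorphV rmorph_nat.
  by rewrite cabs_real ger0_norm // invr_ge0.
by have := ND (p * r) (q * r); have := cp r; have := cq r; rewrite /N; lra.
Qed.

(** The [k]-th iterated cube of ['X * p] is ['X^(3 ^ k)] times that of [p]. Writing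
    [3 ^ k = m + m + 1], it is a triple product with two factors ['X^m], which are iterated cubes of
    1 and so have norm 1; [expr3_le] removes the constant. *)
Let contr_X : contr 'X.
Proof.
have [K K0 HK] := tp_bound JB; move=> p.
have odd k : exists2 m, N 'X^m = 1 & (3 ^ k = m + m + 1)%N.
  elim: k => [|k [m Nm e]]; first by exists 0%N; rewrite ?N1.
  exists (m + m + m).+1; last by rewrite expnS e; lia.
  by have := N_cub 'X^m; rewrite Nm expr1n /cub cjXn -!exprD -exprSr.
have H k : iter k cub ('X * p) = 'X^(3 ^ k) * iter k cub p.
  elim: k => [|k IH] /=; first by rewrite expr1.
  rewrite IH /cub cjM cjXn expnS !mulSn mul0n addn0 !exprD; ring.
apply: (@expr3_le _ _ _ K); rewrite ?nrm_ge0 // => k.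
rewrite -!N_cub_iter H; have [m Nm ->] := odd k.
have -> : 'X^(m + m + 1) * iter k cub p = 'X^m * cj 'X^m * iter k cub p * 'X.
  by rewrite cjXn !exprD expr1; ring.
by rewrite /N -pv_tp; have := HK (pv 'X^m) (pv 'X^m) (pv (iter k cub p)); rewrite -!/(N _) Nm !mulr1.
Qed.

(* [w] and its conjugate are contractive, [w - cj w] is a multiple of ['X] and
   [w + cj w = 1 - 'X^2]: powers of ['X] times [1 - 'X^2] are alternating binomial sums
   of contractions. *)
Let w : {poly C} := 2^-1 *: (1 + 'i *: 'X) ^+ 2.

Let cjw : cj w = 2^-1 *: (1 - 'i *: 'X) ^+ 2.
Proof. by rewrite /w cjZ cjE cjD cj1 cjZ cjX conjCi fmorphV rmorph_nat scaleNr. Qed.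

Let ii : 'i * 'i = -1 :> C. Proof. by rewrite -expr2 sqr_i. Qed.

Let wwE : w * cj w = (2^-1 *: (1 + 'X ^+ 2)) ^+ 2.
Proof.
rewrite cjw /w -!mul_polyC.
have i2 : ('i%:P * 'i%:P : {poly C}) = - 1 by rewrite -polyCM ii rmorphN1.
transitivity ((2^-1)%:P ^+ 2 * (1 - 'i%:P * 'i%:P * 'X ^+ 2) ^+ 2 : {poly C}); first by ring.
by rewrite i2; ring.
Qed.

Let contr_ww : contr (w * cj w).
Proof. by rewrite wwE; apply/contr_exp/contr_half => //; exact: contr_exp. Qed.
Let contr_w : contr w. Proof. exact: contr_of_square. Qed.
Let contr_cjw : contr (cj w). Proof. by apply: contr_of_square; rewrite cjK mulrC. Qed.

Let w_sub : w - cj w = (2 * 'i) *: 'X.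
Proof.
rewrite cjw /w -!mul_polyC polyCM; have h : (2^-1)%:P * 2%:P = 1 :> {poly C}.
  by rewrite -polyCM mulVf ?pnatr_eq0.
have -> : 2%:P = 2 :> {poly C} by rewrite rmorph_nat.
rewrite [2%:P](_ : _ = 2) ?rmorph_nat // in h.
transitivity ((2^-1)%:P * 2 * (2 * 'i%:P * 'X) : {poly C}); first by ring.
by rewrite h mul1r.
Qed.

Let w_add : w + cj w = 1 - 'X ^+ 2.
Proof.
rewrite cjw /w -!mul_polyC; have h : (2^-1)%:P * 2%:P = 1 :> {poly C}.
  by rewrite -polyCM mulVf ?pnatr_eq0.
rewrite [2%:P](_ : _ = 2) ?rmorph_nat // in h.
have i2 : ('i%:P * 'i%:P : {poly C}) = - 1 by rewrite -polyCM ii rmorphN1.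
transitivity ((2^-1)%:P * 2 * (1 + 'i%:P * 'i%:P * 'X ^+ 2) : {poly C}); first by ring.
by rewrite h i2; ring.
Qed.


Let N_ww j k : N (w ^+ j * cj w ^+ k) <= 1.
Proof.
have := contr_mul (contr_exp j contr_w) (contr_exp k contr_cjw) 1.
by rewrite mulr1 N1.
Qed.

(** [binomial_telescope] with [y = - cj w] gives differences of contractions whose coefficients rise
    to the central one and fall symmetrically. Abel summation costs twice that coefficient on each
    half, and the middle term as much, whence 6; [4 ^+ m] is the modulus of [(2 * 'i) ^+ m.*2]. *)
Let powers_le m : N ('X ^+ (m.*2) * (1 - 'X ^+ 2)) <= 6 * ('C(m.*2, m))%:R / 4 ^+ m.
Proof.
pose F k := pv (w ^+ (m.*2.+1 - k) * (- cj w) ^+ k).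
have F1 k : nrm (F k) <= 1.
  rewrite /F -mulN1r exprMn_comm; last by rewrite /GRing.comm mulrC.
  rewrite mulrCA -[(-1) ^+ k]signr_odd; have := N_ww (m.*2.+1 - k) k.
  by case: odd; rewrite ?expr0 ?expr1 ?mulN1r ?mul1r /N ?pvN ?nrmN.
pose c k : R := ('C(m.*2, k))%:R.
have c0 : 0 <= c 0%N by rewrite ler0n.
have cS k : (k < m)%N -> c k <= c k.+1 by move=> km; rewrite ler_nat binomial_increasing.
have h1 := @abel_sum _ _ F c F1 m c0 cS.
have h2 := @abel_sum _ _ (fun k => F (m.*2.+1 - k)%N) c (fun k => F1 _) m c0 cS.
have cm k : cabs ((c k)%:C) = c k by rewrite cabs_real ger0_norm // ler0n.
have E0 : (w - cj w) ^+ (m.*2) * (w + cj w) =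
    \sum_(0 <= k < m.*2.+1) (c k)%:C *: (w ^+ (m.*2.+1 - k) * (- cj w) ^+ k -
      w ^+ (m.*2.+1 - k.+1) * (- cj w) ^+ k.+1).
  rewrite -[X in _ * (_ + X)]opprK binomial_telescope; apply: eq_bigr => i _.
  by rewrite /c rmorph_nat.
have E1 : pv ((w - cj w) ^+ (m.*2) * (w + cj w)) =
    \sum_(0 <= k < m.*2.+1) (c k)%:C *: (F k - F k.+1).
  rewrite E0 (big_morph pv pvD pv0); apply: eq_bigr => k _; by rewrite pvZ pvB.
have E2 : pv ((w - cj w) ^+ (m.*2) * (w + cj w)) =
    \sum_(0 <= k < m) (c k)%:C *: (F k - F k.+1) + (c m)%:C *: (F m - F m.+1)
    - \sum_(0 <= k < m) (c k)%:C *: (F (m.*2.+1 - k)%N - F (m.*2.+1 - k.+1)%N).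
  rewrite E1 (big_cat_nat (n := m.+1)) //=; last by lia.
  rewrite big_nat_recr //=; congr (_ + _).
  rewrite big_nat_rev /= (big_addn 0 _ m.+1) -sumrN.
  have -> : (m.*2.+1 - m.+1 = m)%N by lia.
  apply: eq_big_nat => i im.
  have -> : (m.+1 + m.*2.+1 - (i + m.+1).+1 = m.*2 - i)%N by lia.
  have -> : (m.*2.+1 - i = (m.*2 - i).+1)%N by lia.
  have -> : (m.*2.+1 - i.+1 = m.*2 - i)%N by lia.
  have -> : c (m.*2 - i)%N = c i by rewrite /c bin_sub //; lia.
  by rewrite -scalerN opprB.
have n1 : nrm (pv ((w - cj w) ^+ (m.*2) * (w + cj w))) <= 6 * c m.
  rewrite E2; apply: le_trans (nrmD _ _) _; rewrite nrmN.
  have := nrmD (\sum_(0 <= k < m) (c k)%:C *: (F k - F k.+1)) ((c m)%:C *: (F m - F m.+1)).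
  rewrite nrmZ cm; have := nrmD (F m) (- F m.+1); rewrite nrmN.
  have := F1 m; have := F1 m.+1; have : 0 <= c m by rewrite ler0n.
  by move: h1 h2; nra.
move: n1; rewrite w_sub w_add exprZn -scalerAl pvZ nrmZ.
have -> : cabs ((2 * 'i) ^+ m.*2 : C) = 4 ^+ m.
  have -> : (2 * 'i : C) ^+ m.*2 = ((- 4) ^+ m : R)%:C.
    rewrite -mul2n exprM [(2 * 'i) ^+ 2]exprMn sqrCi rmorphXn rmorphN rmorph_nat; congr (_ ^+ _); ring.
  by rewrite cabs_real normrX normrN ger0_norm.
by rewrite /N ler_pdivlMr ?exprn_gt0 // mulrC.
Qed.

Let powers_tends q : forall eps, 0 < eps -> exists M, forall m, (M <= m)%N ->
  N (q * ('X ^+ (m.*2) * (1 - 'X ^+ 2))) < eps.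
Proof.
have [K K0 HK] := bounded_mulP q; move=> eps e0.
have K1 : 0 < 6 * (K + 1) by lra.
pose d := eps / (6 * (K + 1)); have d0 : 0 < d by rewrite divr_gt0.
exists (Num.trunc (d ^- 2)) => m Mm; apply: le_lt_trans (HK _) _.
pose r : R := ('C(m.*2, m))%:R / 4 ^+ m.
have r0 : 0 <= r by rewrite divr_ge0 ?ler0n ?exprn_ge0.
have hr : r ^+ 2 * m.*2.+1%:R <= 1.
  rewrite /r expr_div_n -exprM mulnC exprM -natrX mulrAC ler_pdivrMr ?exprn_gt0 // mul1r -natrM.
  have -> : (4 ^+ 2 : R) = 16%:R by rewrite -natrX.
  by rewrite -natrX ler_nat central_binomial_bound.
have hd : 1 < d ^+ 2 * m.*2.+1%:R.
  rewrite mulrC -ltr_pdivrMr ?exprn_gt0 // mul1r.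
  apply: lt_le_trans (truncnS_gt _) _.
  by rewrite ler_nat ltnS (leq_trans Mm) // -addnn leq_addr.
have m0 : 0 < m.*2.+1%:R :> R by rewrite ltr0n.
have rd : r < d.
  have : r ^+ 2 < d ^+ 2 by rewrite -(ltr_pM2r m0); apply: le_lt_trans hr hd.
  by rewrite ltr_pXn2r ?nnegrE // ltW.
have := powers_le m; rewrite -mulrA -/r => h.
have : d * (6 * (K + 1)) = eps by rewrite divfK ?gt_eqF.
have := nrm_ge0 (pv ('X ^+ (m.*2) * (1 - 'X ^+ 2))); rewrite -/(N _).
nra.
Qed.

Let TD y z : T (y + z) = T y + T z. Proof. exact: (tpDr J). Qed.
Let TN y : T (- y) = - T y. Proof. exact: (tpNr J). Qed.
Let iterTD n y z : iter n T (y + z) = iter n T y + iter n T z.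
Proof. by elim: n => //= n ->; rewrite TD. Qed.
Let iterTN n y : iter n T (- y) = - iter n T y.
Proof. by elim: n => //= n ->; rewrite TN. Qed.

Let pv_iter n p : iter n T (pv p) = pv ('X^n * p).
Proof. by elim: n => [|n IH]; rewrite ?expr0 ?mul1r //= IH exprS -mulrA pv_XM. Qed.

(** On the whole space [T] is only known to be bounded; on this closure it is contractive by
    [contr_X]. *)
Let closure_pv z := forall eps, 0 < eps -> exists p, nrm (z - pv p) < eps.

Let closure_T z : closure_pv z -> closure_pv (T z) /\ nrm (T z) <= nrm z.
Proof.
have [K K0 HK] := tp_bound JB.
have bT y : nrm (T y) <= K * nrm y by have := HK a a y; rewrite na !mulr1.
move=> cz; split.
  move=> eps e0; have K1 : 0 < K + 1 by lra.
  have [p Hp] := cz _ (divr_gt0 e0 K1); exists ('X * p).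
  rewrite pv_XM -TN -TD; apply: le_lt_trans (bT _) _.
  rewrite ltr_pdivlMr // in Hp; have := nrm_ge0 (z - pv p); nra.
apply: nrm_eps_le => eps e0; have K1 : 0 < K + 1 by lra.
have [p Hp] := cz _ (divr_gt0 e0 K1).
have -> : T z = T (z - pv p) + T (pv p) by rewrite -TD subrK.
apply: le_trans (nrmD _ _) _.
have := bT (z - pv p); have := contr_X p; rewrite /N pv_XM.
rewrite ltr_pdivlMr // in Hp.
have := nrm_leD (pv p) z; rewrite (nrm_sub (pv p)).
lra.
Qed.

Let closure_iter n z : closure_pv z -> nrm (iter n T z) <= nrm z.
Proof.
move=> cz; suff [] : closure_pv (iter n T z) /\ nrm (iter n T z) <= nrm z by [].
elim: n => [|n [IH1 IH2]] //=; have [h1 h2] := closure_T IH1; split=> //.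
exact: le_trans IH2.
Qed.

Let iterAT n : iter n T a = A n. Proof. by []. Qed.

Let A_le n : nrm (A n) <= 1.
Proof. by rewrite -iterAT -na; apply: closure_iter => eps e0; exists 'X^0; rewrite pvX /A /= subrr nrm0. Qed.

Hypothesis WC : weakly_compact_triple tp.

(** These iterates are the values of [Q(a)] at points of the unit ball. Only even indices are taken,
    because the decay estimate concerns [1 - T ^ 2]. *)
Let even_cluster : exists e, weak_cluster (fun n => A (n.*2.+2)) e.
Proof.
apply: (weak_cluster_sequence (WC a)) => n; exists (A n.*2.+1); last by rewrite /tripleQ -[a]/(A 0) ATP addn0.
by rewrite /closed_unit_ball /mkset nrmE -[1]/(1%:C) lecR; exact: (A_le n.*2.+1).
Qed.

Let W0 (y : E) := exists p, y = pv ((1 - 'X ^+ 2) * p).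

Let W0_subspace : subspace W0.
Proof.
split; first by exists 0; rewrite mulr0 pv0.
move=> k x y [p ->] [q ->]; exists (k *: p + q); rewrite -pv_lin.
by congr pv; rewrite mulrDr scalerAr.
Qed.

Let W0_A n : W0 (A n.*2.+2 - a).
Proof.
rewrite -[X in _ - X]/(A 0) -!pvX -pvB; elim: n => [|n [p Hp]].
  by exists (- 1); congr pv; rewrite expr0; ring.
exists (- 'X^(n.*2.+2) + p); rewrite mulrDr [RHS]pvD -Hp -pvD; congr pv.
by rewrite doubleS !exprS !expr0; ring.
Qed.

(** A mean ergodic argument for [T ^ 2]. By Mazur's theorem the cluster point [e] differs from [a]
    by a limit of vectors [(1 - T ^ 2) y], on which [T ^ (2 m)] tends to 0, and [e] is fixed by
    [T ^ 2]. *)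
Theorem spectral_unit : exists e, tends A e.
Proof.
have [e ce] := even_cluster; exists e.
have clW eps : 0 < eps -> exists p, nrm (e - a - pv ((1 - 'X ^+ 2) * p)) < eps.
  move=> e0; have ce' : weak_cluster (fun n => A n.*2.+2 - a) (e - a).
    by move=> psi d n d0; have [k nk h] := ce psi d n d0; exists k => //; rewrite opprB addrA subrK.
  have [_ [p ->] h] := weak_cluster_subspace W0_subspace W0_A ce' e0; by exists p.
have clz y q : closure_pv y -> closure_pv (y + pv q).
  by move=> cy eps e0; have [p Hp] := cy eps e0; exists (p + q); rewrite pvD opprD addrACA subrr addr0.
have cea : closure_pv (e - a) by move=> eps /clW[p Hp]; exists ((1 - 'X ^+ 2) * p).
have kill : forall eps, 0 < eps -> exists M, forall m, (M <= m)%N -> nrm (iter m.*2 T (e - a)) < eps.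
  move=> eps e0; have e2 : 0 < eps / 2 by lra.
  have [p Hp] := clW _ e2; have [M HM] := powers_tends p e2; exists M => m /HM hm.
  rewrite -[e - a](subrK (pv ((1 - 'X ^+ 2) * p))) iterTD pv_iter.
  apply: le_lt_trans (nrmD _ _) _.
  have : nrm (iter m.*2 T (e - a - pv ((1 - 'X ^+ 2) * p))) <= nrm (e - a - pv ((1 - 'X ^+ 2) * p)).
    by apply: closure_iter; rewrite -pvN; exact: clz.
  have -> : 'X^(m.*2) * ((1 - 'X ^+ 2) * p) = p * ('X^(m.*2) * (1 - 'X ^+ 2)) by ring.
  by move: hm; rewrite /N; lra.
have fix2 : T (T e) = e.
  apply/eqP; rewrite -subr_eq0; apply/eqP; have [//|n0] := pselect (T (T e) - e = 0).
  have n1 := nrm_gt0 n0.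
  have s0 : subspace (fun y : E => y = 0) by split=> // k x y -> ->; rewrite scaler0 addr0.
  have [|psi [_ pw]] := separation (x0 := T (T e) - e) s0 n1.
    by move=> y ->; rewrite subr0.
  have [L L0 HL] := dual_bound psi.
  have [K K0 HK] := tp_bound JB.
  have bT y : nrm (T y) <= K * nrm y by have := HK a a y; rewrite na !mulr1.
  have pl k x y : dual_fun psi (k *: x + y) = k * dual_fun psi x + dual_fun psi y by rewrite /dual_fun linearP.
  have pB x y : dual_fun psi (x - y) = dual_fun psi x - dual_fun psi y.
    by rewrite addrC -scaleN1r pl mulN1r addrC.
  (* Cluster points are tested by functionals, so [T ^ 2 - 1] is moved onto [psi]. *)
  have [||chi chiE] := @dual_exists _ _ (fun y => dual_fun psi (T (T y) - y)) (L * (K * K + 1)).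
  - move=> k x y; rewrite /T !(tpDr J, tpZr J) -pl; congr dual_fun.
    by lmod_with E R[i]; ring.
  - move=> y; apply: le_trans (HL _) _; rewrite -mulrA; apply: ler_wpM2l => //.
    apply: le_trans (nrmD _ _) _; rewrite nrmN mulrDl mul1r lerD2r -mulrA.
    by apply: le_trans (bT _) _; apply: ler_wpM2l.
  case: pw; apply: cabs_eq0; apply/eqP; rewrite eq_le cabs_ge0 andbT leNgt; apply/negP => c0.
  set d := cabs _ in c0; have d2 : 0 < d / 2 by lra.
  have L1 : 0 < L + 1 by lra.
  have [M HM] := powers_tends 1 (divr_gt0 d2 L1).
  have [n Mn] := ce chi _ M d2; rewrite chiE !TD !TN opprD addrACA -opprD pB -/d.
  have hn : cabs (dual_fun psi (T (T (A n.*2.+2)) - A n.*2.+2)) < d / 2.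
    apply: le_lt_trans (HL _) _.
    have := HM n.+1 (leqW Mn); rewrite mul1r ltr_pdivlMr //.
    have -> : N ('X ^+ (n.+1).*2 * (1 - 'X ^+ 2)) = nrm (T (T (A n.*2.+2)) - A n.*2.+2).
      rewrite /N nrm_sub; have -> : T (T (A n.*2.+2)) = A (n.*2.+4) by [].
      by rewrite -!pvX -pvB; congr (nrm (pv _)); rewrite doubleS !exprS; ring.
    by have := nrm_ge0 (T (T (A n.*2.+2)) - A n.*2.+2); nra.
  set x := dual_fun psi _ in hn *; set y := dual_fun psi _ => xy.
  have := cabsD (x : R[i]) (y - x); rewrite addrC subrK -(opprB x y) cabsN.
  by move: xy hn; rewrite /d -/y; lra.
have tends_even eps : 0 < eps -> exists M, forall m, (M <= m)%N -> nrm (A m.*2 - e) < eps.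
  move=> /kill[M HM]; exists M => m /HM.
  rewrite nrm_sub iterTD iterTN.
  have -> : iter m.*2 T e = e by elim: m => //= m ->.
  by [].
(* Otherwise [T e - e] would be an eigenvector of [L(a,a)] for the eigenvalue [-1]. *)
have fix1 : T e = e.
  apply/eqP; rewrite -subr_eq0; apply/eqP; have [//|n0] := pselect (T e - e = 0).
  have h : T (T e - e) = (-1) *: (T e - e) by rewrite TD TN fix2 scaleN1r opprB.
  by have := JB_eigen_ge0 JB h n0; rewrite oppr_ge0 ler10.
have [K K0 HK] := tp_bound JB.
have bT y : nrm (T y) <= K * nrm y by have := HK a a y; rewrite na !mulr1.
move=> eps e0; have K1 : 0 < K + 1 by lra.
have [M HM] := tends_even _ (divr_gt0 e0 K1); exists M.*2 => n Mn.
have hM : nrm (A n./2.*2 - e) < eps / (K + 1) by apply: HM; lia.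
rewrite -[n]odd_double_half; case: odd => /=; last first.
  rewrite add0n; apply: lt_le_trans hM _; rewrite ler_pdivrMr //; nra.
rewrite add0n; set y := A _ in hM *.
have -> : T y - e = T (y - e) by rewrite TD TN fix1.
apply: le_lt_trans (bT _) _.
rewrite ltr_pdivlMr // in hM; have := nrm_ge0 (y - e); nra.
Qed.

End OddCalculus.

(** * The spectral tripotent of an element *)

Section Spectral.
Variables (R : realType) (E : completeNormedModType R[i]).
Variable tp : E -> E -> E -> E.
Hypothesis JB : JBstar_triple tp.
Hypothesis WC : weakly_compact_triple tp.
Let J := jb_jordan JB.

(** Stands in for the closed subtriple generated by [a]: properties of this kind pass from [a] to
    its spectral tripotent. They are applied to Peirce spaces and to self-adjointness. *)
Definition closed_odd (a : E) (P : E -> Prop) : Prop :=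
  [/\ P a, forall y, P y -> P (tp a a y), forall (r : R) y, P y -> P (r%:C *: y)
    & forall u l, (forall n, P (u n)) -> tends u l -> P l].

Definition spectral_tripotent (a e : E) : Prop :=
  [/\ tp e e e = e, nrm e = 1, tp e e (a - (nrm a)%:C *: e) = 0,
    nrm (a - (nrm a)%:C *: e) < nrm a & forall P, closed_odd a P -> P e].

Let cube (y : E) := tp y y y.

Lemma orthogonal_cubes e x k : tp e e e = e -> tp e e x = 0 ->
  iter k cube (e + x) = e + iter k cube x /\ tp e e (iter k cube x) = 0.
Proof.
move=> te ex; elim: k => [//|k [IH1 IH2]]; rewrite !iterS IH1 /cube.
have c1 := peirce0_l J te _ IH2; have c2 := peirce0_m J te _ IH2.
rewrite (cube_orth J) // te; split=> //.
by rewrite (jt_id J) IH2 !(tp0l J, tp0m J, tp0r J) subr0 addr0.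
Qed.

(** [e] is the limit of the odd powers of the normalised [a]. Triple products of odd powers are odd
    powers again, so the identities for [e] are limits along subsequences. *)
Lemma spectral a : a <> 0 -> exists e, spectral_tripotent a e.
Proof.
move=> a0; have la := nrm_gt0 a0; set l := nrm a in la.
have l0 : l%:C != 0 by rewrite -[0]/(0%:C) (inj_eq (@complexI R)) gt_eqF.
pose b := (l^-1)%:C *: a.
have nb : nrm b = 1 by rewrite nrmZr gtr0_norm ?invr_gt0 // mulVf ?gt_eqF.
have aE : a = l%:C *: b by rewrite scalerA -rmorphM /= mulfV ?gt_eqF // scale1r.
have [e te] := spectral_unit JB nb WC; set A := fun n => iter n (tp b b) b in te.
have ATP i j k : tp (A i) (A j) (A k) = A (i + j + k).+1 by exact: (odd_powers_tp J).
have te3 : tp e e e = e.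
  apply: (tends_unique (u := fun n => tp (A n) (A n) (A n))); first exact: tends_tp.
  have -> : (fun n => tp (A n) (A n) (A n)) = A \o (fun n => (n + n + n).+1).
    by apply/funext => n /=; rewrite ATP.
  by apply: tends_sub => // n; lia.
have teb : tp e e b = e.
  apply: (tends_unique (u := fun n => tp (A n) (A n) b)).
    by apply: tends_tp => //; exact: tends_cst.
  have -> : (fun n => tp (A n) (A n) b) = A \o (fun n => (n + n).+1).
    by apply/funext => n /=; rewrite -[b in LHS]/(A 0%N) ATP addn0.
  by apply: tends_sub => // n; lia.
have [idx [hidx cidx]] : exists idx : nat -> nat, (forall k, (k <= idx k)%N) /\ forall k, iter k cube b = A (idx k).
  exists (fun k => iter k (fun m => (m + m + m).+1) 0%N); split.
    by elim=> //= k IH; lia.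
  by elim=> //= k ->; rewrite /cube ATP.
have tc : tends (fun k => iter k cube b) e.
  have -> : (fun k => iter k cube b) = A \o idx by apply/funext => k /=; rewrite cidx.
  exact: tends_sub.
have nc k : nrm (iter k cube b) = 1 by rewrite (cube_iter_nrm JB) nb expr1n.
have ne : nrm e = 1.
  apply/eqP; rewrite eq_le (tends_bound tc) => [|k]; last by rewrite nc.
  rewrite leNgt; apply/negP => h; have h0 : 0 < 1 - nrm e by lra.
  have [M /(_ M (leqnn M))] := tends_nrm tc h0; rewrite nc ger0_norm; lra.
have ed : tp e e (b - e) = 0 by rewrite (tpDr J) (tpNr J) teb te3 subrr.
(* The iterated cubes of [b] are [e] plus those of [b - e], and they tend to [e]; so the cubes of
   [b - e] tend to 0. *)
have nd : nrm (b - e) < 1.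
  rewrite ltNge; apply/negP => h.
  have [M /(_ M (leqnn M))] := tc _ ltr01.
  rewrite -[b](subrK e) [_ - e + e]addrC; have [-> _] := orthogonal_cubes M te3 ed.
  rewrite [e + _]addrC addrK (cube_iter_nrm JB) => h2.
  by have := exprn_ege1 (3 ^ M) h; lra.
have dE : a - l%:C *: e = l%:C *: (b - e) by rewrite aE scalerBr.
exists e; split=> //.
- by rewrite dE (tpZr J) ed scaler0.
- by rewrite dE nrmZr gtr0_norm //; nra.
- move=> P [Pa PT PZ Pl]; apply: Pl te => n.
  elim: n => [|n IH]; first exact: PZ.
  have -> : A n.+1 = (l^-1 * l^-1)%:C *: tp a a (A n).
    rewrite /A /= {1 2}/b (tpZl J) (tpZm J) scalerA; congr (_ *: _).
    by rewrite rmorphM /= conj_realC.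
  exact/PZ/PT.
Qed.

End Spectral.

(** * Contractivity of the Peirce projections *)

Section PeirceNorm.
Variables (R : realType) (E : completeNormedModType R[i]).
Variable tp : E -> E -> E -> E.
Hypothesis JB : JBstar_triple tp.
Let J := jb_jordan JB.

Definition exp_partial (t : R) n : R[i] := \sum_(0 <= k < n) (t *i) ^+ k / k`!%:R.

Lemma exp_partial_lim (t : R) eps : 0 < eps -> exists N, forall n, (N <= n)%N ->
  cabs (exp_partial t n - (cos t +i* sin t)) < eps.
Proof.
move=> e0.
have partE n : exp_partial t n = series (cos_coeff t) n +i* series (sin_coeff t) n.
  rewrite /exp_partial /series /=; elim: n => [|n IH]; first by rewrite !big_geq.
  rewrite !big_nat_recr //= IH.
  have -> : (t *i) ^+ n / n`!%:R = cos_coeff t n +i* sin_coeff t n.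
    have -> : t *i = t%:C * 'i%C by apply/eqP; rewrite eq_complex /=; apply/andP; split; apply/eqP; ring.
    rewrite exprMn -rmorphXn /=.
    have -> : (n`!%:R : R[i])^-1 = ((n`!%:R)^-1)%:C by rewrite fmorphV rmorph_nat.
    have -> : ('i%C : R[i]) ^+ n = ((~~ odd n)%:R * (-1) ^+ n./2) +i* ((odd n)%:R * (-1) ^+ n.-1./2).
      rewrite -{1}[n]odd_double_half exprD -mul2n exprM sqr_i; case: (boolP (odd n)) => on /=.
        rewrite (_ : n.-1./2 = n./2); last by lia.
        have -> : ((-1) ^+ n./2 : R[i]) = ((-1) ^+ n./2)%:C by rewrite rmorphXn rmorphN1.
        by rewrite expr1; apply/eqP; rewrite eq_complex /=; apply/andP; split; apply/eqP; ring.
      have -> : ((-1) ^+ n./2 : R[i]) = ((-1) ^+ n./2)%:C by rewrite rmorphXn rmorphN1.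
      by rewrite expr0; apply/eqP; rewrite eq_complex /=; apply/andP; split; apply/eqP; ring.
    have -> : cos_coeff t n = (~~ odd n)%:R * (-1) ^+ n./2 * t ^+ n / n`!%:R by [].
    rewrite /sin_coeff /=.
    by apply/eqP; rewrite eq_complex /=; apply/andP; split; apply/eqP; ring.
  by [].
have hc : series (cos_coeff t) @ \oo --> cos t.
  by rewrite cos.unlock; exact: is_cvg_series_cos_coeff.
have hs : series (sin_coeff t) @ \oo --> sin t.
  by rewrite sin.unlock; exact: is_cvg_series_sin_coeff.
have e2 : 0 < eps / 2 by lra.
have /cvgrPdist_lt/(_ _ e2)[N1 _ H1] := hc.
have /cvgrPdist_lt/(_ _ e2)[N2 _ H2] := hs.
exists (maxn N1 N2) => n; rewrite geq_max => /andP[/H1 h1 /H2 h2].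
apply: le_lt_trans (cabs_le _) _; rewrite partE /=.
by move: h1 h2; rewrite /= ![`|_ - series _ _|]distrC; lra.
Qed.

Lemma tends_lim (u : nat -> E) l : tends u l -> lim (u @ \oo) = l.
Proof.
move=> ul; apply: cvg_lim; first exact: norm_hausdorff.
apply/cvgrPdist_lt => eps e0; have [r r0 ->] := pos_real e0.
by have [N HN] := ul _ r0; exists N => // n Nn /=; rewrite distrC nrmE ltcR; exact: HN.
Qed.

Variable e : E.
Hypothesis te : tp e e e = e.

(** The hermitian axiom turns these phases into isometries; averaging over [t = 0], [pi] and [2 pi]
    then yields the projections. *)
Lemma exp_peirce (t : R) x2 x1 x0 : tp e e x2 = x2 -> tp e e x1 = 2^-1 *: x1 -> tp e e x0 = 0 ->
  exp_operator (t *i) (tripleL tp e e) (x2 + x1 + x0) =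
  (cos t +i* sin t) *: x2 + (cos (t / 2) +i* sin (t / 2)) *: x1 + x0.
Proof.
move=> h2 h1 h0; apply: tends_lim.
have itE k : iter k (tripleL tp e e) (x2 + x1 + x0) = x2 + (2^-1) ^+ k *: x1 + (k == 0%N)%:R *: x0.
  elim: k => [|k IH]; first by rewrite expr0 !scale1r.
  rewrite iterS IH /tripleL !(tpDr J) !(tpZr J) h2 h1 h0 scaler0 scale0r !addr0 scalerA.
  by rewrite exprSr.
have sE n : series (fun k => ((t *i) ^+ k / k`!%:R) *: iter k (tripleL tp e e) (x2 + x1 + x0)) n =
    exp_partial t n *: x2 + exp_partial (t / 2) n *: x1 + (n != 0%N)%:R *: x0.
  rewrite /series /exp_partial /=; elim: n => [|n IH]; first by rewrite !big_geq // !scale0r !addr0.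
  rewrite !big_nat_recr //= IH itE.
  have -> : ((t / 2) *i) ^+ n = (t *i) ^+ n * 2^-1 ^+ n :> R[i].
    rewrite -exprMn; congr (_ ^+ _); have -> : (2^-1 : R[i]) = (2^-1)%:C by rewrite fmorphV rmorph_nat.
    by apply/eqP; rewrite eq_complex /=; apply/andP; split; apply/eqP; ring.
  have -> : (t *i) ^+ n / n`!%:R *: (x2 + 2^-1 ^+ n *: x1 + (n == 0)%:R *: x0) =
     ((t *i) ^+ n / n`!%:R) *: x2 + ((t *i) ^+ n * 2^-1 ^+ n / n`!%:R) *: x1 + (n == 0)%:R *: x0.
    case: n {IH} => [|n] /=; first by rewrite !expr0 fact0 mulr1 divr1 !scale1r.
    by lmod_with E R[i]; ring.
  by case: n {IH} => [|n] /=; lmod_with E R[i]; ring.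
have T s x : tends (fun n => exp_partial s n *: x) ((cos s +i* sin s) *: x).
  move=> eps e0; have n1 : 0 < nrm x + 1 by have := nrm_ge0 x; lra.
  have [N HN] := exp_partial_lim s (divr_gt0 e0 n1); exists N => n /HN h.
  rewrite -scalerBl nrmZ; rewrite ltr_pdivlMr // in h.
  by have := cabs_ge0 (exp_partial s n - (cos s +i* sin s)); nra.
have -> : series (fun k => ((t *i) ^+ k / k`!%:R) *: iter k (tripleL tp e e) (x2 + x1 + x0)) =
   (fun n => 1 *: (1 *: (exp_partial t n *: x2) + exp_partial (t / 2) n *: x1) + (n != 0%N)%:R *: x0).
  by apply/funext => n; rewrite sE !scale1r.
have -> : (cos t +i* sin t) *: x2 + (cos (t / 2) +i* sin (t / 2)) *: x1 + x0 =
   1 *: (1 *: ((cos t +i* sin t) *: x2) + (cos (t / 2) +i* sin (t / 2)) *: x1) + x0.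
  by rewrite !scale1r.
apply: tends_lin; first by apply: tends_lin; exact: T.
by move=> eps e0; exists 1%N => -[//|n] _; rewrite /= scale1r subrr nrm0.
Qed.

Lemma peirce_rotation_pi x2 x1 x0 : tp e e x2 = x2 -> tp e e x1 = 2^-1 *: x1 -> tp e e x0 = 0 ->
  nrm (- x2 + 'i *: x1 + x0) = nrm (x2 + x1 + x0).
Proof.
move=> h2 h1 h0; have := JB_hermitian JB e pi (x2 + x1 + x0).
rewrite exp_peirce // cospi sinpi cos_pihalf sin_pihalf /nrm => <-.
congr (complex.Re `|_|); rewrite -complexiE; congr (_ + _ + _).
have -> : (-1 +i* 0 : R[i]) = - 1 by apply/eqP; rewrite eq_complex /= oppr0 !eqxx.
by rewrite scaleN1r.
Qed.

Lemma peirce_rotation_2pi x2 x1 x0 : tp e e x2 = x2 -> tp e e x1 = 2^-1 *: x1 -> tp e e x0 = 0 ->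
  nrm (x2 - x1 + x0) = nrm (x2 + x1 + x0).
Proof.
move=> h2 h1 h0; have h1' : tp e e ('i *: x1) = 2^-1 *: ('i *: x1).
  by rewrite (tpZr J) h1; lmod_with E R[i]; ring.
have h2' : tp e e (- x2) = - x2 by rewrite (tpNr J) h2.
rewrite -(peirce_rotation_pi h2 h1 h0) -(peirce_rotation_pi h2' h1' h0).
by rewrite opprK scalerA -expr2 sqrCi scaleN1r.
Qed.

Lemma peirce_pieces x : [/\ tp e e (P2 tp e x) = P2 tp e x, tp e e (P1 tp e x) = 2^-1 *: P1 tp e x
  & tp e e (P0 tp e x) = 0].
Proof. by split; [exact: (D_P2 J te)|exact: (D_P1 J te)|exact: (D_P0 J te)]. Qed.

Let two_inv : (2^-1 : R[i]) = (2^-1)%:C. Proof. by rewrite fmorphV rmorph_nat. Qed.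

Let half_le (x y : E) (c : R) : nrm x <= c -> nrm y <= c -> nrm (2^-1 *: (x + y)) <= c.
Proof.
move=> nx ny; rewrite two_inv nrmZr ger0_norm ?invr_ge0 //.
by have := nrmD x y; lra.
Qed.

Lemma P20_le x : nrm (P2 tp e x + P0 tp e x) <= nrm x.
Proof.
have [h2 h1 h0] := peirce_pieces x.
have -> : P2 tp e x + P0 tp e x = 2^-1 *: ((P2 tp e x + P1 tp e x + P0 tp e x) +
   (P2 tp e x - P1 tp e x + P0 tp e x)) by lmod_with E R[i]; field.
by apply: half_le; rewrite ?(peirce_rotation_2pi h2 h1 h0) -(peirce_sum J te).
Qed.

Let rotation20 x2 x0 : tp e e x2 = x2 -> tp e e x0 = 0 -> nrm (- x2 + x0) = nrm (x2 + x0).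
Proof.
move=> h2 h0; have h1 : tp e e 0 = 2^-1 *: 0 by rewrite (tp0r J) scaler0.
by have := peirce_rotation_pi h2 h1 h0; rewrite scaler0 !addr0.
Qed.

Lemma P2_le x : nrm (P2 tp e x) <= nrm x.
Proof.
have [h2 h1 h0] := peirce_pieces x.
have -> : P2 tp e x = 2^-1 *: ((P2 tp e x + P0 tp e x) + - (- P2 tp e x + P0 tp e x)).
  by lmod_with E R[i]; field.
by apply: half_le; rewrite ?nrmN ?(rotation20 h2 h0) P20_le.
Qed.

Lemma P0_le x : nrm (P0 tp e x) <= nrm x.
Proof.
have [h2 h1 h0] := peirce_pieces x.
have -> : P0 tp e x = 2^-1 *: ((P2 tp e x + P0 tp e x) + (- P2 tp e x + P0 tp e x)).
  by lmod_with E R[i]; field.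
by apply: half_le; rewrite ?nrmN ?(rotation20 h2 h0) P20_le.
Qed.

(** Half the difference of a vector and its rotation by [pi] loses the Peirce 0-part but keeps the
    2-part and a nonzero multiple of the 1-part, as [unit_ball_peirce1] requires. *)
Lemma rotated_average x2 x1 x0 : tp e e x2 = x2 -> tp e e x1 = 2^-1 *: x1 -> tp e e x0 = 0 ->
  nrm (x2 + ((1 - 'i) / 2) *: x1) <= nrm (x2 + x1 + x0).
Proof.
move=> h2 h1 h0.
have -> : x2 + ((1 - 'i) / 2) *: x1 = 2^-1 *: ((x2 + x1 + x0) + - (- x2 + 'i *: x1 + x0)).
  by lmod_with E R[i]; field.
by apply: half_le; rewrite ?nrmN ?(peirce_rotation_pi h2 h1 h0).
Qed.

Lemma tripotent_nrm : e <> 0 -> nrm e = 1.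
Proof.
move=> /nrm_gt0 n0; have h := nrm_cube JB e; rewrite te in h.
have : (nrm e - 1) * (nrm e * (nrm e + 1)) = 0.
  transitivity (nrm e ^+ 3 - nrm e); first by ring.
  by rewrite -h subrr.
by move=> /eqP; rewrite mulf_eq0 [X in _ || X]gt_eqF ?mulr_gt0 ?addr_gt0 // orbF subr_eq0 => /eqP.
Qed.

(** Iterated cubes of the sum split. The triangle inequality gives the bound up to a factor 2, which
    [expr3_le] removes. *)
Lemma orthogonal_nrm (a : R[i]) z : tp e e z = 0 ->
  nrm (a *: e + z) <= Num.max (nrm (a *: e)) (nrm z).
Proof.
move=> hz; pose cube (y : E) := tp y y y.
have H k : exists c, [/\ iter k cube (a *: e) = c *: e, tp e e (iter k cube z) = 0
   & iter k cube (a *: e + z) = iter k cube (a *: e) + iter k cube z].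
  elim: k => [|k [c [h1 h2 h3]]]; first by exists a.
  exists (c * c^* * c); rewrite !iterS h3 h1; split.
  - by rewrite /cube !(tpZl J, tpZm J, tpZr J) te; lmod_with E R[i]; ring.
  - by rewrite /cube (jt_id J) h2 !(tp0l J, tp0m J, tp0r J) subr0 addr0.
  - apply: (cube_orth J) => y; rewrite ?(tpZl J) ?(tpZm J).
      by rewrite (peirce0_l J te) // scaler0.
    by rewrite (peirce0_m J te) // scaler0.
apply: (@expr3_le _ _ _ 2); rewrite ?nrm_ge0 ?le_max ?nrm_ge0 // => k.
rewrite -(cube_iter_nrm JB); have [c [_ _ ->]] := H k.
apply: le_trans (nrmD _ _) _; rewrite !(cube_iter_nrm JB) mulr_natl mulr2n.
by apply: lerD; apply: lerXn2r; rewrite ?nnegrE ?le_max ?nrm_ge0 ?lexx ?orbT.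
Qed.

End PeirceNorm.

(** * Minimal tripotents *)

Section Atoms.
Variables (R : realType) (E : completeNormedModType R[i]).
Variable tp : E -> E -> E -> E.
Hypothesis JB : JBstar_triple tp.
Hypothesis WC : weakly_compact_triple tp.
Let J := jb_jordan JB.
Local Notation coef := (mcoef tp).
Local Notation minimal := (minimal tp).
Ltac lv := lmod_with E R[i]; try ring.

Lemma conj_half : Num.conj (2^-1 : R[i]) = 2^-1.
Proof. by rewrite fmorphV rmorph_nat. Qed.

Lemma ge0_realC (c : R[i]) : 0 <= c -> exists2 r : R, 0 <= r & c = r%:C.
Proof.
move=> c0; exists (complex.Re c); last by rewrite RRe_real // ger0_real.
by rewrite -lecR RRe_real // ger0_real.
Qed.

Lemma minimal_trip e : minimal e -> tp e e e = e. Proof. by case. Qed.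
Lemma minimal_neq0 e : minimal e -> e <> 0. Proof. by case. Qed.
Lemma minimal_nrm e : minimal e -> nrm e = 1.
Proof. by case=> te e0 _; exact: (tripotent_nrm JB). Qed.

Lemma coef_le e x : minimal e -> cabs (coef e x) <= nrm x.
Proof.
move=> me; have := P2_le JB (minimal_trip me) x.
by rewrite /P2 (mcoefP me) nrmZ (minimal_nrm me) mulr1.
Qed.

Lemma hermitian_eigen e u : minimal e -> tp e e u = 2^-1 *: u ->
  exists2 r : R, 0 <= r & tp u u e = r%:C *: e.
Proof.
move=> me hu; have te := minimal_trip me.
have : tp e e (tp u u e) = tp u u e.
  rewrite (@peirce_tp _ _ _ J e 2^-1 2^-1 1 u u e) ?conj_half ?scale1r //.
  by rewrite subrr add0r scale1r.
move=> /(mcoef_peirce2 J me) h.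
have [r r0 cr] := ge0_realC (JB_eigen_ge0 JB h (minimal_neq0 me)).
by exists r => //; rewrite {1}h cr.
Qed.

Lemma peirce1_closed e a : tp e e a = 2^-1 *: a ->
  closed_odd tp a (fun y => tp e e y = 2^-1 *: y).
Proof.
move=> ha; split=> //.
- move=> y hy; rewrite (@peirce_tp _ _ _ J e 2^-1 2^-1 2^-1) ?conj_half //.
  by rewrite subrr add0r.
- by move=> r y hy; rewrite (tpZr J) hy; lv.
- move=> u l hu ul; apply: (tends_unique (u := fun n => tp e e (u n))).
    by apply: (tends_tp JB) => //; exact: tends_cst.
  have -> : (fun n => tp e e (u n)) = (fun n => 2^-1 *: u n + 0).
    by apply/funext => n; rewrite hu addr0.
  by rewrite -[X in tends _ X]addr0; apply: tends_lin => //; exact: tends_cst.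
Qed.

Lemma peirce0_closed e a : tp e e a = 0 -> closed_odd tp a (fun y => tp e e y = 0).
Proof.
move=> ha; split=> //.
- by move=> y hy; rewrite (jt_id J) ha hy !(tp0l J, tp0m J, tp0r J) subr0 addr0.
- by move=> r y hy; rewrite (tpZr J) hy scaler0.
- move=> u l hu ul; apply: (tends_unique (u := fun n => tp e e (u n))).
    by apply: (tends_tp JB) => //; exact: tends_cst.
  by rewrite (_ : (fun n => _) = (fun=> 0)); [exact: tends_cst|apply/funext].
Qed.

(** Split [u] into a multiple of its spectral tripotent [v] and an orthogonal rest. Both contribute
    nonnegative multiples of [e] to [{u,u,e}], so [{v,v,e} = 0]; by symmetry of orthogonality
    [{e,e,v} = 0], although [v] is in the Peirce 1/2-space of [e]. *)
Lemma square_peirce1_eq0 e u : minimal e -> tp e e u = 2^-1 *: u -> tp u u e = 0 -> u = 0.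
Proof.
move=> me hu uue; have [//|u0] := pselect (u = 0); have te := minimal_trip me.
have [v [tv nv hw _ /(_ _ (peirce1_closed hu)) hv]] := spectral JB WC u0.
set l := nrm u in hw; have l0 : 0 < l by exact: nrm_gt0.
set w := u - l%:C *: v in hw.
have hw1 : tp e e w = 2^-1 *: w by rewrite /w (tpDr J) (tpNr J) (tpZr J) hu hv; lv.
have [d1 d10 vve] := hermitian_eigen me hv.
have [d2 d20 wwe] := hermitian_eigen me hw1.
have uE : u = l%:C *: v + w by rewrite /w addrC subrK.
clearbody w.
have : tp u u e = (l * l * d1 + d2)%:C *: e.
  rewrite uE !(tpDl J, tpDm J, tpDr J, tpZl J, tpZm J) (peirce0_l J tv _ hw) (peirce0_m J tv _ hw).
  rewrite vve wwe conj_realC !rmorphD !rmorphM /=; lv.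
rewrite uue => /esym/eqP; rewrite scaler_eq0 => /orP[|/eqP e0]; last by case: (minimal_neq0 me).
rewrite -[0]/(0%:C) (inj_eq (@complexI R)) => /eqP s0.
have d10' : d1 = 0.
  have ll : 0 < l * l by rewrite mulr_gt0.
  have : l * l * d1 <= 0 by lra.
  by rewrite pmulr_rle0 // => h; apply/eqP; rewrite eq_le h d10.
have vve0 : tp v v e = 0 by rewrite vve d10' scale0r.
have := orth_sym J tv vve0; rewrite hv => /eqP; rewrite scaler_eq0 invr_eq0 pnatr_eq0 /=.
by move=> /eqP v0; move: nv; rewrite v0 nrm0 => /esym/eqP; rewrite oner_eq0.
Qed.

(* The Peirce 2-part of the cube of [e + u] is [1 + 2 d] times [e], where
   [{u,u,e} = d e] and [d >= 0]. *)
Lemma unit_ball_peirce1 e u : minimal e -> tp e e u = 2^-1 *: u -> nrm (e + u) <= 1 -> u = 0.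
Proof.
move=> me hu n1; have te := minimal_trip me.
have [d d0 uue] := hermitian_eigen me hu.
apply: (square_peirce1_eq0 me hu).
have half_nz : (2 : R[i]) != 0 by rewrite pnatr_eq0.
have hueu : tp e e (tp u e u) = 0.
  rewrite (@peirce_tp _ _ _ J e 2^-1 1 2^-1) ?rmorph1 ?scale1r //.
  by rewrite (_ : _ + _ = 0) ?scale0r //; field.
have huuu : tp e e (tp u u u) = 2^-1 *: tp u u u.
  by rewrite (@peirce_tp _ _ _ J e 2^-1 2^-1 2^-1) ?conj_half // subrr add0r.
have c3 : coef e (tp (e + u) (e + u) (e + u)) = 1 + 2 * d%:C.
  rewrite !(tpDl J, tpDm J, tpDr J) te hu (peirce_Q1 J te hu) [tp u e e](jt_sym J) hu.
  rewrite [tp e u u](jt_sym J) uue !(mcoefD J me) (mcoef_self me) (mcoef0 J me).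
  rewrite (mcoef_peirce0 J me hueu) (mcoef_peirce1 J me huuu) !(mcoefZ J me) (mcoef_self me).
  by rewrite (mcoef_peirce1 J me hu); ring.
have n3 : nrm (tp (e + u) (e + u) (e + u)) <= 1.
  by rewrite (nrm_cube JB) exprn_ile1 ?nrm_ge0.
have := le_trans (coef_le _ me) n3; rewrite c3.
have -> : 1 + 2 * d%:C = (1 + 2 * d)%:C :> R[i] by rewrite rmorphD rmorphM rmorph1 rmorph_nat.
rewrite cabs_real ger0_norm; last lra.
move=> h; have d00 : d = 0 by lra.
by rewrite uue d00 scale0r.
Qed.

Lemma unit_ball_P1 e x : minimal e -> nrm x <= 1 -> coef e x = 1 -> P1 tp e x = 0.
Proof.
move=> me nx cx; have te := minimal_trip me.
have [h2 h1 h0] := peirce_pieces JB te x.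
have := rotated_average JB h2 h1 h0; rewrite -(peirce_sum J te).
have -> : P2 tp e x = e by rewrite /P2 (mcoefP me) cx scale1r.
move=> n1; have : ((1 - 'i) / 2) *: P1 tp e x = 0.
  apply: (unit_ball_peirce1 me); last exact: le_trans nx.
  by rewrite (tpZr J) h1; lv.
move=> /eqP; rewrite scaler_eq0 mulf_eq0 invr_eq0 pnatr_eq0 orbF => /orP[|/eqP //].
rewrite subr_eq0 => /eqP h; have := congr1 (fun z : R[i] => z ^+ 2) h.
by rewrite sqrCi expr1n => /eqP; rewrite -subr_eq0 opprK (_ : 1 + 1 = 2) // pnatr_eq0.
Qed.

Lemma unit_ball_face e x : minimal e -> nrm x <= 1 -> complex.Re (coef e x) = 1 ->
  coef e x = 1 /\ tp e e (x - e) = 0.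
Proof.
move=> me nx rx; have te := minimal_trip me.
have c1 : coef e x = 1.
  have := le_trans (coef_le x me) nx; have := cabs_sqr (coef e x); rewrite rx.
  have := cabs_ge0 (coef e x); move=> h1 h2 h3; have i0 : complex.Im (coef e x) = 0 by nra.
  by apply/eqP; rewrite eq_complex rx i0 /= !eqxx.
split=> //; rewrite {1}(peirce_dec J me x) c1 scale1r (unit_ball_P1 me) // addr0.
by rewrite addrC addKr (D_P0 J te).
Qed.

(* The images under [Q(x)] of [p_0 + ... + p_(n-1)] have a weak cluster point [w]. It
   lies in the closed span of the [p_k], but its Peirce 2-part at [p_k] is [c_k p_k], which
   stays away from 0. *)
Lemma no_infinite_orthogonal x (p : nat -> E) (c : nat -> R[i]) d : 0 < d ->
  (forall n, tp (p n) (p n) (p n) = p n) -> (forall n, p n <> 0) ->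
  (forall m n, m <> n -> tp (p m) (p m) (p n) = 0) ->
  (forall n, tp x (p n) x = c n *: p n) -> (forall n, d <= cabs (c n)) -> False.
Proof.
move=> d0 tpp p0 op xp dc.
pose s n := \sum_(0 <= k < n) p k.
have os n k : (n <= k)%N -> tp (p k) (p k) (s n) = 0.
  elim: n => [|n IH] nk; first by rewrite /s big_geq // (tp0r J).
  rewrite /s big_nat_recr //= (tpDr J) -/(s n) IH ?(ltnW nk) // op ?addr0 //.
  by move=> kn; move: nk; rewrite kn ltnn.
have ns n : nrm (s n) <= 1.
  elim: n => [|n IH]; first by rewrite /s big_geq // nrm0.
  rewrite /s big_nat_recr //= -/(s n) addrC -[p n]scale1r.
  apply: le_trans (orthogonal_nrm JB (tpp n) 1 (os n n (leqnn n))) _.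
  by rewrite scale1r (tripotent_nrm JB) // ge_max lexx.
pose u n := \sum_(0 <= k < n) c k *: p k.
have uE n : tp x (s n) x = u n.
  rewrite /s /u; elim: n => [|n IH]; first by rewrite !big_geq // (tp0m J).
  by rewrite !big_nat_recr //= (tpDm J) IH xp.
have [w cw] : exists w, weak_cluster u w.
  apply: (weak_cluster_sequence (WC x)) => n; exists (s n); last by rewrite /tripleQ uE.
  by rewrite /closed_unit_ball /mkset nrmE -[1]/(1%:C) lecR.
have P2lin k a y z : P2 tp (p k) (a *: y + z) = a *: P2 tp (p k) y + P2 tp (p k) z.
  by rewrite /P2 !(tpDm J) !(tpZm J) conjCK.
have P20 k : P2 tp (p k) 0 = 0 by rewrite /P2 !(tp0m J).
have P2p k : P2 tp (p k) (p k) = p k by rewrite /P2 !tpp.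
have P2o k n : k <> n -> P2 tp (p k) (p n) = 0.
  by move=> kn; rewrite /P2 (peirce_Q0 J (tpp k) (op _ _ kn)) (tp0m J).
have P2u k n : P2 tp (p k) (u n) = if (k < n)%N then c k *: p k else 0.
  rewrite /u; elim: n => [|n IH]; first by rewrite big_geq.
  rewrite big_nat_recr //= addrC P2lin IH; have [kn|nk] := boolP (k < n)%N.
    have kn' : k <> n by move=> e; move: kn; rewrite e ltnn.
    by rewrite (P2o _ _ kn') scaler0 add0r ltnS (ltnW kn).
  have [->|/eqP kn'] := eqVneq k n; first by rewrite ltnSn P2p addr0.
  have -> : (k < n.+1)%N = false by lia.
  by rewrite (P2o _ _ kn') scaler0 add0r.
(* [W] contains all partial sums, so some [y] near [w] has no Peirce 2-part at [p k] for a suitable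
   [k]: that part of [w] is shorter than [d / 3]. *)
pose W (y : E) := exists N, forall k, (N <= k)%N -> P2 tp (p k) y = 0.
have sW : subspace W.
  split; first by exists 0%N => k _.
  move=> a y z [N1 H1] [N2 H2]; exists (maxn N1 N2) => k; rewrite geq_max => /andP[k1 k2].
  by rewrite P2lin H1 // H2 // scaler0 add0r.
have Wu n : W (u n) by exists n => k nk; rewrite P2u ltnNge nk.
have d3 : 0 < d / 3 by lra.
have [y [k /(_ k (leqnn k)) P2y] wy] := weak_cluster_subspace sW Wu cw d3.
(* For [n > k] the differences [u n - c k *: p k] are in [V], so the same part of [w] is within
   [d / 3] of [c k *: p k], a vector of norm at least [d]. *)
pose V (y : E) := P2 tp (p k) y = 0.
have sV : subspace V by split=> // a y' z h1 h2; rewrite /V P2lin h1 h2 scaler0 addr0.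
pose v n := u (k.+1 + n)%N - c k *: p k.
have Vv n : V (v n).
  by rewrite /V /v addrC -scaleNr P2lin P2u ltnS leq_addr P2p scaleNr addNr.
have cv : weak_cluster v (w - c k *: p k).
  move=> psi eps N e0; have [n Nn h] := cw psi eps (k.+1 + N)%N e0.
  exists (n - k.+1)%N; first by rewrite leq_subRL // (leq_trans _ Nn) // leq_addr.
  rewrite /v opprB addrA subrK subnKC //; exact: leq_trans (leq_addr _ _) Nn.
have [z Vz wz] := weak_cluster_subspace sV Vv cv d3.
have h1 := P2_le JB (tpp k) (w - y).
have h2 := P2_le JB (tpp k) (w - c k *: p k - z).
have e1 : P2 tp (p k) (w - y) = P2 tp (p k) w.
  by rewrite addrC -scaleN1r P2lin P2y scaler0 add0r.
have e2 : P2 tp (p k) (w - c k *: p k - z) = P2 tp (p k) w - c k *: p k.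
  rewrite addrC -scaleN1r P2lin Vz scaler0 add0r addrC -scaleNr P2lin P2p; lv.
have := nrm_leD (c k *: p k) (P2 tp (p k) w); rewrite nrm_sub -e2 -e1.
rewrite nrmZ (tripotent_nrm JB) // mulr1; have := dc k; lra.
Qed.

End Atoms.

(** * Tripotents as finite sums of minimal tripotents *)

Section Decomposition.
Variables (R : realType) (E : completeNormedModType R[i]).
Variable tp : E -> E -> E -> E.
Hypothesis JB : JBstar_triple tp.
Hypothesis WC : weakly_compact_triple tp.
Let J := jb_jordan JB.
Local Notation minimal := (minimal tp).
Ltac lv := lmod_with E R[i]; try ring.
Ltac lf := lmod_with E R[i]; try by field.

Definition orthogonal (e x : E) : Prop := tp e e x = 0.

Lemma orthogonal_part v g h : tp v v v = v -> tp v v g = g -> orthogonal v h -> orthogonal h g.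
Proof.
by move=> tv hg hh; rewrite /orthogonal (jt_sym J); exact: (peirce20_l J _ tv hg hh).
Qed.

Lemma orthogonal_part_sym v g h : tp v v v = v -> tp v v g = g -> orthogonal v h -> orthogonal g h.
Proof.
by move=> tv hg hh; rewrite /orthogonal (jt_sym J); exact: (peirce20_r J _ tv hg hh).
Qed.

Lemma sa_closed v a : tp v v v = v -> selfadjoint tp v a -> closed_odd tp a (selfadjoint tp v).
Proof.
move=> tv ha; split=> //.
- by move=> y; exact: (sa_L J).
- by move=> r y hy; rewrite /selfadjoint (tpZm J) conj_realC hy.
- move=> u l hu ul; apply: (tends_unique (u := fun n => tp v (u n) v)).
    by apply: (tends_tp JB) => //; exact: tends_cst.
  by rewrite (_ : (fun n => _) = u) //; apply/funext.
Qed.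

(** If [v] is not minimal, some self-adjoint [y] is not a real multiple of [v]. Its spectral
    tripotent is self-adjoint and differs from [v] and [- v], since the rest of [y] would be
    orthogonal to [v] and hence 0; [sa_split] applies. *)
Lemma split_tripotent v : tp v v v = v -> v <> 0 -> ~ minimal v ->
  exists p, [/\ tp p p p = p, tp (v - p) (v - p) (v - p) = v - p,
    tp p p (v - p) = 0, p <> 0 & v - p <> 0].
Proof.
move=> tv v0 nm.
have [x hx] : exists x, forall c, tp v x v <> c *: v.
  apply: contrapT => H; apply: nm; split=> // x; apply: contrapT => H2.
  by apply: H; exists x => c hc; apply: H2; exists c.
pose z := tp v x v; pose z' := tp v z v.
have zz : tp v z' v = z.
  by rewrite /z' /z (peirce2_Q J tv) // (peirce_DQ J tv).
have [y sy hy] : exists2 y, selfadjoint tp v y & forall r : R, y <> r%:C *: v.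
  apply: contrapT => H.
  have H' y : selfadjoint tp v y -> exists r : R, y = r%:C *: v.
    move=> sy; apply: contrapT => H2; apply: H; exists y => // r yr; apply: H2; by exists r.
  have [r1 h1] : exists r : R, z + z' = r%:C *: v.
    by apply: H'; rewrite /selfadjoint (tpDm J) zz -/z' addrC.
  have [r2 h2] : exists r : R, 'i *: (z - z') = r%:C *: v.
    apply: H'; rewrite /selfadjoint (tpZm J) conjCi (tpDm J) (tpNm J) zz -/z'; lv.
  apply: (hx (2^-1 * (r1%:C - 'i * r2%:C))); rewrite -/z.
  have -> : (2^-1 * (r1%:C - 'i * r2%:C)) *: v = 2^-1 *: (r1%:C *: v - 'i *: (r2%:C *: v)) by lv.
  rewrite -h1 -h2 [X in _ - X]scalerA -expr2 sqrCi; lf.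
have y0 : y <> 0 by move=> y0; apply: (hy 0); rewrite scale0r.
have [e [te ne he _ /(_ _ (sa_closed tv sy)) se]] := spectral JB WC y0.
have vy := sa_D J tv sy.
apply: (sa_split J tv te se).
- by move=> e0; move: ne; rewrite e0 nrm0 => /esym/eqP; rewrite oner_eq0.
- move=> ev; apply: (hy (nrm y)); apply/eqP; rewrite -subr_eq0; apply/eqP.
  by rewrite -he ev (tpDr J) (tpNr J) (tpZr J) vy tv.
- move=> ev; apply: (hy (- nrm y)); apply/eqP; rewrite -subr_eq0 rmorphN scaleNr opprK; apply/eqP.
  rewrite -he ev (tpNl J) (tpNm J) opprK (tpDr J) (tpNr J) (tpZr J) (tpNr J) vy tv; lv.
Qed.

Definition atoms (l : seq E) : Prop := orthos (V := realify E) minimal orthogonal l.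
Definition sum_of (l : seq E) (v : E) : Prop := [/\ atoms l, l <> [::] & v = \sum_(g <- l) g].

Lemma sum_orthogonal g l : (forall h, h \in l -> orthogonal g h) -> orthogonal g (\sum_(h <- l) h).
Proof.
move=> H; rewrite big_seq; elim/big_ind: _ => //; first exact: (tp0r J).
by move=> x y hx hy; rewrite /orthogonal (tpDr J) hx hy addr0.
Qed.

Lemma atoms_mem l g : atoms l -> g \in l ->
  tp (\sum_(h <- l) h) (\sum_(h <- l) h) g = g /\ orthogonal g (\sum_(h <- l) h - g).
Proof.
move=> [ul Ml Zl] gl; have mg := Ml _ gl; have tg := minimal_trip mg.
have og : orthogonal g (\sum_(h <- l) h - g).
  rewrite (big_rem g) //= addrAC subrr add0r; apply: sum_orthogonal => h.
  rewrite mem_rem_uniq // inE => /andP[/eqP hg hl]; apply: Zl => //.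
  by move=> gh; apply: hg.
split=> //; rewrite -[\sum_(h <- l) h](subrK g); move: (_ - g) og => r og.
rewrite !(tpDl J, tpDm J) tg (peirce0_l J tg _ og) (peirce0_m J tg _ og).
by rewrite [tp r r g](jt_sym J) (peirce0_l J tg _ og) !(addr0, add0r).
Qed.

Lemma atoms_cat l1 l2 : atoms l1 -> atoms l2 ->
  (forall g h, g \in l1 -> h \in l2 -> orthogonal g h) -> atoms (l1 ++ l2).
Proof.
move=> [u1 M1 Z1] [u2 M2 Z2] Z12.
have Z21 g h : g \in l1 -> h \in l2 -> orthogonal h g.
  by move=> gl hl; apply: (orth_sym J (minimal_trip (M1 _ gl))); exact: Z12.
split.
- rewrite cat_uniq u1 u2 /= andbT; apply/hasPn => g gl2; apply/negP => gl1.
  have := Z12 _ _ gl1 gl2; rewrite /orthogonal (minimal_trip (M1 _ gl1)).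
  exact: (minimal_neq0 (M1 _ gl1)).
- by move=> x; rewrite mem_cat => /orP[|]; [exact: M1|exact: M2].
- move=> x y; rewrite !mem_cat => /orP[x1|x2] /orP[y1|y2] xy.
  + exact: Z1.
  + exact: Z12.
  + exact: Z21.
  + exact: Z2.
Qed.

Lemma sum_of_orthogonal p q lp lq : tp p p p = p -> tp q q q = q -> orthogonal p q ->
  sum_of lp p -> sum_of lq q -> forall g h, g \in lp -> h \in lq -> orthogonal g h.
Proof.
move=> tpp tq pq [ap _ ep] [aq _ eq] g h gl hl.
have [hg _] := atoms_mem ap gl; have [hh _] := atoms_mem aq hl.
rewrite -ep in hg; rewrite -eq in hh.
apply: (orthogonal_part_sym tpp hg).
by apply: (orthogonal_part tq hh); exact: (orth_sym J).
Qed.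

(** A tripotent without such a decomposition splits so that one half has none either. Iterating, the
    other halves form an infinite orthogonal sequence fixed by [Q(v)], against
    [no_infinite_orthogonal]. *)
Lemma tripotent_sum_of v : tp v v v = v -> v <> 0 -> exists l, sum_of l v.
Proof.
move=> tv v0; apply: contrapT => bad0.
pose Bad v := [/\ tp v v v = v, v <> 0 & ~ exists l, sum_of l v].
have step v1 : Bad v1 -> exists q, [/\ Bad q, tp (v1 - q) (v1 - q) (v1 - q) = v1 - q,
    orthogonal (v1 - q) q & v1 - q <> 0].
  move=> [tv1 v10 nl]; have nm : ~ minimal v1.
    move=> mv; apply: nl; exists [:: v1]; split=> //; last by rewrite big_seq1.
    split=> // [x|x y]; rewrite inE => /eqP -> //; by rewrite inE => /eqP ->.
  have [p [tpp tq pq p0 q0]] := split_tripotent tv1 v10 nm.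
  have [[lq sq]|nq] := pselect (exists l, sum_of l (v1 - p)); last first.
    by exists (v1 - p); rewrite subKr; split.
  exists p; split=> //; last exact: (orth_sym J tpp).
  split=> // -[lp sp]; apply: nl; exists (lp ++ lq).
  have [[ap np ep] [aq nq eq]] := (sp, sq); split.
  - by apply: atoms_cat => //; exact: (sum_of_orthogonal tpp tq pq).
  - by case: lp np {sp ap ep}.
  - by rewrite big_cat /= -ep -eq addrC subrK.
have stepP v1 : exists q, Bad v1 -> [/\ Bad q, tp (v1 - q) (v1 - q) (v1 - q) = v1 - q,
    orthogonal (v1 - q) q & v1 - q <> 0].
  by have [/step[q hq]|nb] := pselect (Bad v1); [exists q|exists v1].
have [F HF] := choice stepP.
pose q n := iter n F v; pose p n := q n - q n.+1.
have Bq n : Bad (q n) by elim: n => [|n IH] //=; case: (HF _ IH).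
have tq n : tp (q n) (q n) (q n) = q n by case: (Bq n).
have Hp n : [/\ tp (p n) (p n) (p n) = p n, orthogonal (p n) (q n.+1) & p n <> 0].
  by have [_] := HF _ (Bq n).
have sub n : tp (q n) (q n) (q n.+1) = q n.+1.
  have [tpn opq _] := Hp n; have oqp := orth_sym J tpn opq.
  have -> : q n = p n + q n.+1 by rewrite /p subrK.
  have tq1 := tq n.+1; move: (p n) (q n.+1) tpn opq oqp tq1 => P Q tP oPQ oQP tQ.
  rewrite !(tpDl J, tpDm J) tQ oPQ (peirce0_l J tP _ oPQ) (peirce0_m J tP _ oPQ); lv.
have oq m k : orthogonal (p m) (q (m.+1 + k)%N).
  elim: k => [|k IH]; first by rewrite addn0; case: (Hp m).
  rewrite addnS; apply: (orthogonal_part (tq (m.+1 + k)%N) (sub _)).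
  by case: (Hp m) => tpm _ _; exact: (orth_sym J tpm).
have opp m n : (m < n)%N -> orthogonal (p m) (p n).
  move=> mn; rewrite /orthogonal {3}/p (tpDr J) (tpNr J).
  have := oq m (n - m.+1)%N; have := oq m (n - m)%N.
  rewrite subnKC // addSn subnKC ?(ltnW mn) // /orthogonal => -> ->.
  by rewrite oppr0 addr0.
have opp' m n : m <> n -> tp (p m) (p m) (p n) = 0.
  move=> /eqP; rewrite neq_ltn => /orP[/opp //|/opp h].
  by case: (Hp n) => tpn _ _; exact: (orth_sym J tpn).
have vq n : orthogonal (p n) (v - q n).
  have : forall j, (j <= n)%N -> orthogonal (p n) (v - q j).
    elim=> [|j IH] jn; first by rewrite /orthogonal subrr (tp0r J).
    have -> : v - q j.+1 = (v - q j) + p j by rewrite /p addrA subrK.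
    rewrite /orthogonal (tpDr J) IH ?(ltnW jn) // opp' ?addr0 // => nj.
    by move: jn; rewrite nj ltnn.
  exact.
apply: (@no_infinite_orthogonal _ _ tp JB WC v p (fun=> 1) 1 ltr01).
- by move=> n; case: (Hp n).
- by move=> n; case: (Hp n).
- exact: opp'.
- move=> n; case: (Hp n) => tpn oqn _; rewrite scale1r.
  have -> : v = p n + ((v - q n) + q n.+1) by rewrite /p; lv.
  have o : orthogonal (p n) ((v - q n) + q n.+1) by rewrite /orthogonal (tpDr J) vq oqn addr0.
  move: (p n) (_ + _) tpn o => P Q tP o.
  by rewrite !(tpDl J) !(tpDr J) tP !(peirce0_m J tP _ o) (o : tp P P Q = 0) !addr0.
- by move=> n; rewrite /cabs normr1 /=.
Qed.

End Decomposition.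

(** * Verification of the atomic structure *)

Section AtomicStructure.
Variables (R : realType) (E : completeNormedModType R[i]).
Variable tp : E -> E -> E -> E.
Hypothesis JB : JBstar_triple tp.
Hypothesis WC : weakly_compact_triple tp.
Let J := jb_jordan JB.
Local Notation minimal := (minimal tp).
Local Notation coef := (mcoef tp).
Local Notation orthogonal := (orthogonal tp).
Ltac lv := lmod_with E R[i]; try ring.
Ltac lf := lmod_with E R[i]; try by field.

Lemma orthogonalD g x y : orthogonal g x -> orthogonal g y -> orthogonal g (x + y).
Proof. by rewrite /orthogonal (tpDr J) => -> ->; rewrite addr0. Qed.

Lemma orthogonalZ g k x : orthogonal g x -> orthogonal g (k *: x).
Proof. by rewrite /orthogonal (tpZr J) => ->; rewrite scaler0. Qed.

Lemma orthogonalB g x y : orthogonal g x -> orthogonal g y -> orthogonal g (x - y).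
Proof. by move=> gx gy; apply: orthogonalD => //; rewrite -scaleN1r; exact: orthogonalZ. Qed.

(** Any minimal summand of the spectral tripotent of [x] will do. The last clause holds as
    orthogonality to [g] passes from [x] to this tripotent by [peirce0_closed]. *)
Lemma top_atom x : x <> 0 -> exists e, [/\ minimal e, orthogonal e (x - (nrm x)%:C *: e)
  & forall g, tp g g g = g -> orthogonal g x -> orthogonal g e].
Proof.
move=> x0; have [b [tb nb ob _ clb]] := spectral JB WC x0.
have b0 : b <> 0 by move=> b0; move: nb; rewrite b0 nrm0 => /esym/eqP; rewrite oner_eq0.
have [l [al nl bE]] := tripotent_sum_of JB WC tb b0.
have [e el] : exists e, e \in l by case: l nl {al bE} => // e l; exists e; rewrite mem_head.
have [be oe] := atoms_mem JB al el; rewrite -bE in be oe.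
have me : minimal e by have [_ Ml _] := al; exact: Ml.
have te := minimal_trip me.
exists e; split=> //.
- have -> : x - (nrm x)%:C *: e = (nrm x)%:C *: (b - e) + (x - (nrm x)%:C *: b) by lv.
  apply: orthogonalD; first exact: orthogonalZ.
  exact: (orthogonal_part_sym JB tb be).
- move=> g tg gx; have gb := clb _ (peirce0_closed JB gx).
  exact: (orthogonal_part JB tb be (orth_sym J tg gb)).
Qed.

Local Notation V := (realify E).

(** The spectral part [nrm r *: F r] of the remainder [r] is subtracted repeatedly. If the
    remainders stayed above [d], the [F (r n)] would be an infinite orthogonal family with
    coefficients at least [d ^+ 2] under [Q(x)]. *)
Lemma approximation x eps : nrm x = 1 -> 0 < eps -> exists l : seq (R * V),
  [/\ atoms tp (unzip2 l), forall p, p \in l -> `|p.1| <= 1,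
      exists2 p, p \in l & `|p.1| = 1 & nrm ((x - comb l : V) : E) <= eps].
Proof.
move=> nx e0.
have stepP r : exists e, r <> 0 -> spectral_tripotent tp r e.
  by have [->|/(spectral JB WC)[e he]] := pselect (r = 0); [exists 0|exists e].
have [F HF] := choice stepP.
pose next r := r - (nrm r)%:C *: F r; pose r n := iter n next x.
have rS n : r n = (nrm (r n))%:C *: F (r n) + r n.+1 by rewrite /r /= /next addrC subrK.
have o_next n g : tp g g g = g -> r n <> 0 -> orthogonal g (r n) ->
    orthogonal g (F (r n)) /\ orthogonal g (r n.+1).
  move=> tg rn gr; have [_ _ _ _ cl] := HF _ rn.
  have gF := cl _ (peirce0_closed JB gr); split=> //.
  by rewrite /r /= /next; apply: orthogonalB => //; exact: orthogonalZ.
(* The bound [2^-1] forces at least one step, and the first step contributes the coefficient 1. *)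
pose d := Num.min eps 2^-1; have d0 : 0 < d by rewrite lt_min e0 invr_gt0 ltr0n.
have [n hn] : exists n, nrm (r n) <= d.
  apply: contrapT => H.
  have rd n : d < nrm (r n) by rewrite ltNge; apply/negP => h; apply: H; exists n.
  have rn n : r n <> 0 by move=> h; have := rd n; rewrite h nrm0; lra.
  have tF n : tp (F (r n)) (F (r n)) (F (r n)) = F (r n) by case: (HF _ (rn n)).
  have oFr m k : orthogonal (F (r m)) (r (m.+1 + k)%N).
    elim: k => [|k IH]; first by rewrite addn0; case: (HF _ (rn m)).
    by rewrite addnS; case: (o_next _ _ (tF m) (rn _) IH).
  have oFF m k : (m < k)%N -> orthogonal (F (r m)) (F (r k)).
    move=> mk; have := oFr m (k - m.+1)%N; rewrite subnKC //.
    by move=> /(o_next _ _ (tF m) (rn k))[].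
  have oFF' m k : m <> k -> tp (F (r m)) (F (r m)) (F (r k)) = 0.
    move=> /eqP; rewrite neq_ltn => /orP[/oFF //|/oFF h].
    exact: (orth_sym J (tF k)).
  have xr k : orthogonal (F (r k)) (x - r k).
    have : forall j, (j <= k)%N -> orthogonal (F (r k)) (x - r j).
      elim=> [|j IH] jk; first by rewrite /r /= subrr /orthogonal (tp0r J).
      have -> : x - r j.+1 = (x - r j) + (nrm (r j))%:C *: F (r j).
        have -> : r j.+1 = r j - (nrm (r j))%:C *: F (r j) by [].
        by lv.
      apply: orthogonalD; first by apply: IH; exact: ltnW.
      by apply: orthogonalZ; apply: oFF' => kj; move: jk; rewrite kj ltnn.
    exact.
  apply: (@no_infinite_orthogonal _ _ tp JB WC x (fun n => F (r n))
     (fun n => (nrm (r n) ^+ 2)%:C) (d ^+ 2)) => //.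
  - by rewrite exprn_gt0.
  - move=> n h; have [_ nF _ _ _] := HF _ (rn n); move: nF; rewrite h nrm0 => /esym/eqP.
    by rewrite oner_eq0.
  - move=> n; have o : orthogonal (F (r n)) ((x - r n) + r n.+1).
      by apply: orthogonalD => //; have := oFr n 0%N; rewrite addn0.
    have -> : x = (nrm (r n))%:C *: F (r n) + ((x - r n) + r n.+1).
      have -> : r n.+1 = r n - (nrm (r n))%:C *: F (r n) by [].
      by lv.
    have := tF n; move: (F (r n)) (nrm (r n)) (_ + _) o => P c Q o tP.
    rewrite !(tpDl J) !(tpDr J) !(tpZl J) !(tpZr J) tP !(peirce0_m J tP _ o) (o : tp P P Q = 0).
    by rewrite rmorphXn /=; lv.
  - move=> n; rewrite cabs_real ger0_norm ?sqr_ge0 //; have := rd n; nra.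
have [m hm min_m] : exists2 m, nrm (r m) <= d & forall k, (k < m)%N -> d < nrm (r k).
  have exn : exists n, nrm (r n) <= d by exists n.
  case: (ex_minnP exn) => m hm mm; exists m => // k km; rewrite ltNge; apply/negP => /mm.
  by rewrite leqNgt km.
have H : forall k, (k <= m)%N -> nrm (r k) <= 1 /\ exists l : seq (R * V),
    [/\ atoms tp (unzip2 l), forall p, p \in l -> `|p.1| <= 1,
      (0 < k)%N -> exists2 p, p \in l & `|p.1| = 1, x = comb l + r k :> V &
      forall g, g \in unzip2 l -> orthogonal g (r k)].
  elim=> [|k IH] km.
    split; first by rewrite nx.
    exists [::]; split=> //.
    by rewrite /comb big_nil add0r.
  have [n1 [l [al bl ul xl ol]]] := IH (ltnW km).
  have rk : r k <> 0 by move=> h; have := min_m k km; rewrite h nrm0; lra.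
  have [tF nF oF ltF _] := HF _ rk.
  have F0 : F (r k) <> 0 by move=> h; move: nF; rewrite h nrm0 => /esym/eqP; rewrite oner_eq0.
  split; first by apply: le_trans (ltW ltF) n1.
  have [l' [al' nl' Fl]] := tripotent_sum_of JB WC tF F0.
  have tl g : g \in unzip2 l -> tp g g g = g.
    by have [_ Ml _] := al; move=> /Ml; exact: minimal_trip.
  have mF g : g \in l' -> tp (F (r k)) (F (r k)) g = g.
    by move=> /(atoms_mem JB al')[]; rewrite -Fl.
  pose c := nrm (r k).
  have un : unzip2 (l ++ [seq (c, g : V) | g <- l']) = unzip2 l ++ l'.
    by rewrite /unzip2 map_cat -map_comp map_id.
  exists (l ++ [seq (c, g : V) | g <- l']); split.
  - rewrite un; apply: (atoms_cat JB al al') => g h gl hl.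
    have [oF' _] := o_next k g (tl _ gl) rk (ol _ gl).
    exact: (orthogonal_part JB tF (mF _ hl) (orth_sym J (tl _ gl) oF')).
  - move=> p; rewrite mem_cat => /orP[/bl //|/mapP[g _ ->]] /=.
    by rewrite ger0_norm ?nrm_ge0.
  - move=> _; have [k0|/ul[p pl p1]] := posnP k; last by exists p => //; rewrite mem_cat pl.
    have [g gl] : exists g, g \in l' by case: (l') nl' => // g l'' _; exists g; rewrite mem_head.
    exists (c, g : V); last by rewrite /c k0 /r /= nx normr1.
    by rewrite mem_cat; apply/orP; right; apply/mapP; exists g.
  - rewrite /comb big_cat big_map /= -/(comb l) xl -addrA; congr (_ + _).
    rewrite [LHS](rS k); congr (_ + _); rewrite -/c.
    by rewrite [in LHS]Fl scaler_sumr; apply: eq_bigr.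
  - move=> g; rewrite un mem_cat => /orP[gl|gl].
      by case: (o_next k g (tl _ gl) rk (ol _ gl)).
    by apply: (orthogonal_part_sym JB tF (mF _ gl)).
have [n1 [l [al bl ul xl _]]] := H m (leqnn m).
exists l; split=> //.
  apply: ul; case: m hm {min_m H n1 xl} => // ; rewrite /r /= nx /d le_min => /andP[_ h].
  by exfalso; lra.
have -> : (x - comb l : V) = r m :> E by rewrite {1}xl addrC addKr.
by apply: le_trans hm _; rewrite ge_min lexx.
Qed.

Definition ephi (e x : V) : R := complex.Re (coef e x).

Lemma ephi_lin e a (x y : V) : minimal e -> ephi e (a *: x + y) = a * ephi e x + ephi e y.
Proof. by move=> me; rewrite /ephi real_scaleE (mcoef_lin J me) ReD ReZ. Qed.

Lemma opp_minimal e : minimal e -> minimal (- e).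
Proof. by move=> me; rewrite -scaleN1r; apply: (minimal_phase J me); rewrite rmorphN1 mulrNN mulr1. Qed.

Lemma coef_opp e x : minimal e -> coef (- e) x = - coef e x.
Proof.
move=> me; apply: (scale_inj_min (opp_minimal me)); rewrite -(mcoefP (opp_minimal me)).
by rewrite !(tpNl J, tpNm J, tpNr J) !opprK (mcoefP me) scalerN scaleNr opprK.
Qed.

Let quad_base (N B : R) : 1 <= N -> N ^+ 3 <= N + B -> N <= 1 + B / 2.
Proof.
move=> N1 h; have : 2 * (N - 1) <= N ^+ 3 - N; last by lra.
have -> : N ^+ 3 - N = (N - 1) * (N * (N + 1)) by ring.
rewrite mulrC; apply: ler_wpM2l; [lra|nra].
Qed.

(* The first order terms of [{e+tu, e+tu, e+tu}] and [e + t u] agree, so the norm [N] of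
   [e + t u] satisfies [N^3 <= N + O(t^2)]. *)
Lemma quad_peirce1 e u : minimal e -> tp e e u = 2^-1 *: u -> exists2 C : R, 0 <= C &
  forall t : R, `|t| <= 3 -> nrm (e + t%:C *: u) <= 1 + C * t ^+ 2.
Proof.
move=> me hu; have te := minimal_trip me.
pose B := nrm (2 *: tp u u e + tp u e u) + 3 * nrm (tp u u u).
have B0 : 0 <= B by rewrite addr_ge0 ?mulr_ge0 ?nrm_ge0.
exists (B / 2) => [|t t3]; first by rewrite divr_ge0.
have cu : tp e e (e + t%:C *: u) = e + (2^-1 * t%:C) *: u by rewrite (tpDr J) (tpZr J) te hu; lv.
have N1 : 1 <= nrm (e + t%:C *: u).
  apply: le_trans (coef_le JB _ me); rewrite (mcoefD J me) (mcoefZ J me) (mcoef_self me).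
  by rewrite (mcoef_peirce1 J me hu) mulr0 addr0 (_ : 1 = (1 : R)%:C) // cabs_real normr1.
have -> : B / 2 * t ^+ 2 = (B * t ^+ 2) / 2 by ring.
apply: quad_base => //; rewrite -(nrm_cube JB).
have -> : tp (e + t%:C *: u) (e + t%:C *: u) (e + t%:C *: u) =
   (e + t%:C *: u) + ((t ^+ 2)%:C *: (2 *: tp u u e + tp u e u) + (t ^+ 3)%:C *: tp u u u).
  rewrite !(tpDl J, tpDm J, tpDr J, tpZl J, tpZm J, tpZr J) conj_realC te hu (peirce_Q1 J te hu).
  rewrite [tp u e e](jt_sym J) hu [tp e u u](jt_sym J) !rmorphXn /=; lf.
apply: le_trans (nrmD _ _) _; rewrite lerD2l; apply: le_trans (nrmD _ _) _.
rewrite !nrmZr (ger0_norm (sqr_ge0 t)) normrX /B mulrDl.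
have t2 : `|t| ^+ 3 <= 3 * t ^+ 2.
  by rewrite exprS real_normK ?num_real //; apply: ler_wpM2r; rewrite ?sqr_ge0.
have := nrm_ge0 (tp u u u); rewrite [t ^+ 2 * _]mulrC; nra.
Qed.

(** [e + t y] is the mean of three vectors, each perturbing [e] in a single Peirce space by [3 t];
    hence the range [|t| <= 3] in [quad_peirce1]. *)
Lemma quad e y : minimal e -> exists C : R, forall t : R, `|t| <= 1 ->
  nrm (e + t%:C *: y) <= 1 + t * ephi e y + C * t ^+ 2.
Proof.
move=> me; have te := minimal_trip me; have ne := minimal_nrm JB me.
have [h2 h1 h0] := peirce_pieces JB te y; have yE := peirce_dec J me y.
have [C C0 HC] := quad_peirce1 me h1.
set c := coef e y in yE; set y1 := P1 tp e y in yE h1 HC; set y0 := P0 tp e y in yE h0.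
exists (3 / 2 * cabs c ^+ 2 + 3 * C + 3 * nrm y0 ^+ 2) => t t1.
have t3 : `|3 * t| <= 3 by rewrite normrM ger0_norm //; lra.
have n1 := HC _ t3.
have n2 : nrm ((1 + (3 * t)%:C * c) *: e) <= 1 + 3 * t * complex.Re c + 9 / 2 * t ^+ 2 * cabs c ^+ 2.
  rewrite nrmZ ne mulr1.
  have h : forall z : R[i], cabs z <= (1 + cabs z ^+ 2) / 2 by move=> z; have := sqr_ge0 (cabs z - 1); nra.
  apply: le_trans (h _) _; rewrite !cabs_sqr; case: (c) => a b /=; nra.
have n0 : nrm (e + (3 * t)%:C *: y0) <= 1 + 9 * t ^+ 2 * nrm y0 ^+ 2.
  rewrite -[e]scale1r; apply: le_trans (orthogonal_nrm JB te _ _) _.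
    by rewrite (tpZr J) h0 scaler0.
  rewrite scale1r ne nrmZr ge_max; apply/andP; split.
    by rewrite lerDl; apply: mulr_ge0; [apply: mulr_ge0|]; rewrite ?sqr_ge0 ?ler0n.
  have -> : 9 * t ^+ 2 * nrm y0 ^+ 2 = (`|3 * t| * nrm y0) ^+ 2.
    by rewrite exprMn real_normK ?num_real //; ring.
  by move: (_ * nrm y0) => s; have := sqr_ge0 (s - 1); nra.
have -> : e + t%:C *: y = (3^-1)%:C *: (((1 + (3 * t)%:C * c) *: e + (e + (3 * t)%:C *: y1)) + (e + (3 * t)%:C *: y0)).
  rewrite yE fmorphV rmorphM !rmorph_nat; lf.
rewrite nrmZr ger0_norm ?invr_ge0 // /ephi -/c.
have := nrmD ((1 + (3 * t)%:C * c) *: e + (e + (3 * t)%:C *: y1)) (e + (3 * t)%:C *: y0).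
have := nrmD ((1 + (3 * t)%:C * c) *: e) (e + (3 * t)%:C *: y1).
move: (nrm _) (nrm _) (nrm _) (nrm _) (nrm _) n0 n1 n2 => q1 q2 q3 q4 q5; lra.
Qed.

(** The leading atom [f] of [e + y] has coefficient 2 there, so both [e] and [y] have coefficient of
    real part 1. Then [e - f] is orthogonal to [f], whence [f] is a multiple of [e], and in fact
    [e]. *)
Lemma smooth e y : minimal e -> nrm y <= 1 -> nrm (e + y) = 2 -> ephi e y = 1.
Proof.
move=> me ny n2; have te := minimal_trip me; have ne := minimal_nrm JB me.
have x0 : e + y <> 0 by move=> h; move: n2; rewrite h nrm0; lra.
have [f [mf of_ _]] := top_atom x0; have tf := minimal_trip mf.
rewrite n2 in of_.
have ce : coef f (e + y) = 2%:C.
  rewrite -[e + y](subrK (2%:C *: f)) (mcoefD J mf) (mcoef_peirce0 J mf of_) (mcoefZ J mf).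
  by rewrite (mcoef_self mf) add0r mulr1.
have r1 : complex.Re (coef f e) <= 1 by apply: le_trans (Re_le_cabs _) _; rewrite -ne; exact: coef_le.
have r2 : complex.Re (coef f y) <= 1 by apply: le_trans (Re_le_cabs _) _; apply: le_trans ny; exact: coef_le.
have rs : complex.Re (coef f e) + complex.Re (coef f y) = 2 by rewrite -ReD -(mcoefD J mf) ce.
have fe1 : complex.Re (coef f e) = 1 by lra.
have [_ ofe] := unit_ball_face JB WC mf (eq_ind_r (fun z => z <= 1) (lexx 1) ne) fe1.
have fez : tp f f e = f by move: ofe; rewrite (tpDr J) (tpNr J) tf => /eqP; rewrite subr_eq0 => /eqP.
have [k fk] : exists k, f = k *: e.
  have [_ _ /(_ f)[k hk]] := me; exists k; rewrite -hk -[e](subrK f).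
  move: (e - f) ofe => z oz.
  by rewrite !(tpDl J) !(tpDr J) tf !(peirce0_m J tf _ oz) (oz : tp f f z = 0) !add0r.
have ef : e = f.
  have k1 : cabs k = 1 by have := minimal_nrm JB mf; rewrite fk nrmZ ne mulr1.
  rewrite -{1}fez {1 2}fk (tpZl J) (tpZm J) te scalerA mul_conj_cabs k1 expr1n scale1r //.
by rewrite ef /ephi; lra.
Qed.

Lemma jb_atomic : atomic (V := V) (@nrm R E) minimal ephi orthogonal.
Proof.
split.
- by move=> e a x y; exact: ephi_lin.
- by move=> e; exact: minimal_nrm.
- by move=> e me; rewrite /ephi (mcoef_self me).
- by move=> e x me; apply: le_trans (Re_le_cabs _) _; exact: coef_le.
- by move=> e _; exact: (tp0r J).
- by move=> e a x y _ hx hy; apply: orthogonalD => //; exact: orthogonalZ.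
- by move=> e x me hx; rewrite /ephi (mcoef_peirce0 J me hx).
- by move=> e x me nx px; case: (unit_ball_face JB WC me nx px).
- move=> e a z me hz a1 nz; rewrite real_scaleE.
  apply: le_trans (orthogonal_nrm JB (minimal_trip me) _ hz) _.
  by rewrite nrmZr (minimal_nrm JB me) mulr1 ge_max a1 nz.
- move=> e a z me hz; have te := minimal_trip me; apply: le_trans (P0_le JB te _).
  rewrite /P0 !(tpDr J) real_scaleE !(tpZr J) !te (hz : tp e e z = 0) (tp0r J) !addr0.
  rewrite (_ : _ + _ = z) //; lv.
- by move=> e; exact: opp_minimal.
- by move=> e x me; rewrite /ephi coef_opp //; case: (coef e x).
- by move=> e x _ hx; rewrite /orthogonal (tpNl J) (tpNm J) opprK.
- by move=> e g me mg; exact: (orth_sym J (minimal_trip me)).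
- move=> x /top_atom[e [me oe He]]; exists e; split=> // g /minimal_trip tg; exact: He.
- by move=> e y; exact: smooth.
- by move=> e y me; have [C HC] := quad y me; exists C.
Qed.

End AtomicStructure.

Local Open Scope ring_scope.

(** * Spin factors *)

Section SpinReal.
Variables (R : realType) (E : completeNormedModType R[i]).
Variable tp : E -> E -> E -> E.
Hypothesis JB : JBstar_triple tp.
Hypothesis WC : weakly_compact_triple tp.
Let J := jb_jordan JB.
Local Notation minimal := (minimal tp).
Local Notation coef := (mcoef tp).
Local Notation orthogonal := (orthogonal tp).
Ltac lv := lmod_with E R[i]; try ring.
Ltac lf := lmod_with E R[i]; try by field.

Lemma commute_orthogonal e e' x : tp e e e = e -> orthogonal e e' ->
  tp e e (tp e' e' x) = tp e' e' (tp e e x).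
Proof.
move=> te o; rewrite (jt_id J) (o : tp e e e' = 0) (tp0l J) (tp0m J); lv.
Qed.

Section Pair.
Variables e e' : E.
Hypotheses (me : minimal e) (me' : minimal e') (ee' : orthogonal e e').

Let te : tp e e e = e. Proof. by case: me. Qed.
Let te' : tp e' e' e' = e'. Proof. by case: me'. Qed.
Let e'e : tp e' e' e = 0. Proof. exact: (orth_sym J te ee'). Qed.
Local Notation half := (half tp e e').
Local Notation plus := (plus tp e e').
Local Notation S := (spinS tp e e').

Let A x := coef e x.
Let B x := coef e' x.
Definition spin_half x := x - A x *: e - B x *: e'.
Local Notation H := spin_half.
Definition in_spin x := half (H x).
Definition sq x y := spin_q tp e e' (A x) (H x) (B x) (A y) (H y) (B y).
Definition sbar x := spin_bar tp e e' (A x) (H x) (B x).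

Lemma spin_elE x : x = spin_el e e' (A x) (H x) (B x).
Proof. rewrite /spin_el /H; lv. Qed.

Lemma sbarE x : sbar x = (B x)^* *: e - plus (H x) + (A x)^* *: e'.
Proof. by []. Qed.

Lemma half_coef b : half b -> coef e b = 0 /\ coef e' b = 0.
Proof. by move=> [b1 b2]; rewrite (mcoef_peirce1 J me b1) (mcoef_peirce1 J me' b2). Qed.

Lemma coef_ee' : coef e e' = 0. Proof. exact: mcoef_peirce0. Qed.
Lemma coef_e'e : coef e' e = 0. Proof. exact: mcoef_peirce0. Qed.

Lemma spin_coords a b a' : half b ->
  [/\ A (a *: e + b + a' *: e') = a, B (a *: e + b + a' *: e') = a' & H (a *: e + b + a' *: e') = b].
Proof.
move=> hb; have [b1 b2] := half_coef hb.
have hA : A (a *: e + b + a' *: e') = a.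
  by rewrite /A !(mcoefD J me) !(mcoefZ J me) (mcoef_self me) b1 coef_ee' mulr0 !addr0 mulr1.
have hB : B (a *: e + b + a' *: e') = a'.
  by rewrite /B !(mcoefD J me') !(mcoefZ J me') (mcoef_self me') b2 coef_e'e mulr0 !add0r mulr1.
by split=> //; rewrite /H hA hB; lv.
Qed.

Lemma half0 : half 0.
Proof. by split; rewrite (tp0r J) scaler0. Qed.

Lemma in_spin_coords a b a' : half b -> in_spin (a *: e + b + a' *: e').
Proof. by move=> hb; have [_ _ hH] := spin_coords a a' hb; rewrite /in_spin hH. Qed.

Lemma A_lin k x y : A (k *: x + y) = k * A x + A y. Proof. exact: mcoef_lin. Qed.
Lemma B_lin k x y : B (k *: x + y) = k * B x + B y. Proof. exact: mcoef_lin. Qed.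
Lemma H_lin k x y : H (k *: x + y) = k *: H x + H y.
Proof. by rewrite /H A_lin B_lin; lv. Qed.

Lemma in_spin_lin k x y : in_spin x -> in_spin y -> in_spin (k *: x + y).
Proof. by rewrite /in_spin H_lin; exact: half_lin. Qed.

Lemma in_spin0 : in_spin 0.
Proof. by have := in_spin_coords 0 0 half0; rewrite !scale0r !addr0. Qed.

Lemma in_spinZ k x : in_spin x -> in_spin (k *: x).
Proof. by move=> hx; rewrite -[_ *: _]addr0; apply: in_spin_lin => //; exact: in_spin0. Qed.

Lemma in_spinD x y : in_spin x -> in_spin y -> in_spin (x + y).
Proof. by move=> hx hy; rewrite -[x]scale1r; exact: in_spin_lin. Qed.

Lemma in_spin_e : in_spin e.
Proof. by have := in_spin_coords 1 0 half0; rewrite scale1r scale0r !addr0. Qed.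

Lemma in_spin_e' : in_spin e'.
Proof. by have := in_spin_coords 0 1 half0; rewrite scale1r scale0r !add0r. Qed.

Lemma half_in_spin b : half b -> in_spin b.
Proof. by move=> hb; have := in_spin_coords 0 0 hb; rewrite !scale0r addr0 add0r. Qed.

(** On this space [L(e,e)] and [L(e',e')] add up to the identity, so eigenvalue 1 of one is paired
    with 0 of the other, and 1/2 with 1/2. *)
Lemma in_spin_peirce2 x : tp (e + e') (e + e') x = x -> in_spin x.
Proof.
have o1 z : tp e e' z = 0 by exact: (peirce0_l J te).
have o2 z : tp e' e z = 0 by exact: (peirce0_m J te).
rewrite !(tpDl J, tpDm J) o1 o2 addr0 add0r => hx.
have D'x : tp e' e' x = x - tp e e x by rewrite -{2}hx addrC addKr.
have cm y : tp e e (tp e' e' y) = tp e' e' (tp e e y) by exact: commute_orthogonal.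
have cube := peirce_cubic J te x.
have D'1 : tp e' e' (P1 tp e x) = 2^-1 *: P1 tp e x.
  rewrite /P1 !(tpZr J, tpDr J, tpNr J) -!cm D'x !(tpDr J) !(tpNr J).
  move: (cube); move: (tp e e x) (tp e e (tp e e x)) (tp e e (tp e e (tp e e x))) => a b c cube'.
  have -> : c = (3 / 2) *: b - (1 / 2) *: a.
    rewrite -[RHS]add0r -[0](scaler0 _ (1 / 2)) -cube'; lf.
  lf.
have D'0 : tp e' e' (P0 tp e x) = P0 tp e x.
  rewrite /P0 !(tpDr J) !(tpNr J) !(tpZr J) -!cm D'x !(tpDr J) !(tpNr J).
  move: (cube); move: (tp e e x) (tp e e (tp e e x)) (tp e e (tp e e (tp e e x))) => a b c cube'.
  have -> : c = (3 / 2) *: b - (1 / 2) *: a.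
    rewrite -[RHS]add0r -[0](scaler0 _ (1 / 2)) -cube'; lf.
  lf.
rewrite (peirce_dec J me x) (mcoef_peirce2 J me' D'0); apply: in_spin_coords.
by split=> //; exact: (D_P1 J te).
Qed.

Lemma sbar_in_spin x : in_spin x -> in_spin (sbar x).
Proof.
move=> hx; rewrite sbarE; apply: in_spin_coords; rewrite -scaleN1r -[_ *: _]addr0.
by apply: half_lin => //; [exact: half_plus|exact: half0].
Qed.

Lemma half_opp b : half b -> half (- b).
Proof. by move=> hb; rewrite -scaleN1r -[_ *: _]addr0; apply: half_lin => //; exact: half0. Qed.

Lemma sbar_coords x : in_spin x -> [/\ A (sbar x) = (B x)^*, B (sbar x) = (A x)^*
  & H (sbar x) = - plus (H x)].
Proof. by move=> hx; rewrite sbarE; apply: spin_coords; apply/half_opp/half_plus. Qed.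

Lemma plus_conj k b c : plus (k *: b + c) = k^* *: plus b + plus c.
Proof. rewrite /plus (tpDm J) (tpZm J); lv. Qed.

Lemma plus0 : plus 0 = 0. Proof. by rewrite /plus (tp0m J) scaler0. Qed.

Lemma plus_opp b : plus (- b) = - plus b.
Proof. by rewrite -scaleN1r -[_ *: _]addr0 plus_conj plus0 addr0 rmorphN1 scaleN1r. Qed.

Lemma sbarK x : in_spin x -> sbar (sbar x) = x.
Proof.
move=> hx; have [a1 a2 a3] := sbar_coords hx; rewrite sbarE a1 a2 a3 !conjCK plus_opp opprK.
by rewrite (plusK J me me' ee') // [RHS]spin_elE.
Qed.

Lemma sbar_lin k x y : sbar (k *: x + y) = k^* *: sbar x + sbar y.
Proof.
rewrite !sbarE A_lin B_lin H_lin plus_conj !rmorphD !rmorphM; lv.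
Qed.

Lemma spin_triple x y z : in_spin x -> in_spin y -> in_spin z ->
  tp x (sbar y) z = sq x y *: z + sq z y *: x - sq x z *: y.
Proof.
move=> hx hy hz; rewrite {1}[x]spin_elE {1}[z]spin_elE /sbar (spin_tp J me me' ee') //.
by rewrite -!spin_elE.
Qed.

Lemma sq_lin k x y z : sq (k *: x + y) z = k * sq x z + sq y z.
Proof. rewrite /sq /spin_q A_lin B_lin H_lin (spinS_lin J e me'); ring. Qed.

Lemma sq_sym x y : sq x y = sq y x.
Proof. rewrite /sq /spin_q (spinS_sym J e e' (H x)); ring. Qed.

(* The real form of the spin factor, on which [sq] is an inner product. *)
Definition spin_real x := in_spin x /\ sbar x = x.

Lemma spin_real_lin (r : R) x y : spin_real x -> spin_real y -> spin_real (r%:C *: x + y).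
Proof.
move=> [hx bx] [hy b_y]; split; first exact: in_spin_lin.
by rewrite sbar_lin bx b_y conj_realC.
Qed.

Lemma spin_real0 : spin_real 0.
Proof.
split; first exact: in_spin0.
by have := sbar_lin (-1) 0 0; rewrite scaler0 addr0 rmorphN1 scaleN1r addNr.
Qed.

Lemma spin_realZ (r : R) x : spin_real x -> spin_real (r%:C *: x).
Proof. by move=> hx; rewrite -[_ *: _]addr0; apply: spin_real_lin => //; exact: spin_real0. Qed.

Lemma spin_realD x y : spin_real x -> spin_real y -> spin_real (x + y).
Proof. by move=> hx hy; rewrite -[x]scale1r -[1]/(1%:C); exact: spin_real_lin. Qed.

(** For real [x], [sq x x] is the squared modulus of the coefficient at [e] plus the eigenvalue of
    [L(H x, H x)] at [e]. Definiteness is [square_peirce1_eq0]. *)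
Lemma sq_pos x : spin_real x -> exists2 r : R, 0 <= r & sq x x = r%:C /\ (r = 0 -> x = 0).
Proof.
move=> [hx bx]; have [a1 a2 a3] := sbar_coords hx; rewrite bx in a1 a2 a3.
have [s s0 hs] := hermitian_eigen JB me (proj1 hx).
have bbe : tp (H x) (H x) e = (- S (H x) (H x)) *: e.
  have := plus_left J me me' ee' hx hx; rewrite (spinS_swap J me me' ee') // => h.
  by rewrite {2}a3 (tpNm J) h scaleNr.
have sE : - S (H x) (H x) = s%:C by apply: (scale_inj_min me); rewrite -bbe hs.
exists (cabs (A x) ^+ 2 + s); first by rewrite addr_ge0 ?sqr_ge0.
split.
  rewrite /sq /spin_q a2 -/(A x); have := mul_conj_cabs (A x); rewrite rmorphD /= -sE => <-.
  by rewrite mulrC; field.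
move=> h; have c0 : cabs (A x) = 0 by have := sqr_ge0 (cabs (A x)); move: h; nra.
have s00 : s = 0 by move: h; rewrite c0; lra.
have Hx0 : H x = 0.
  by apply: (square_peirce1_eq0 JB WC me (proj1 hx)); rewrite hs s00 scale0r.
have Ax0 := cabs_eq0 c0.
rewrite [x]spin_elE /spin_el Hx0 a2 -/(A x) Ax0 rmorph0; lv.
Qed.

Lemma sq_real x y : spin_real x -> spin_real y -> exists r : R, sq x y = r%:C.
Proof.
move=> hx hy; have [r1 _ [h1 _]] := sq_pos hx; have [r2 _ [h2 _]] := sq_pos hy.
have [r3 _ [h3 _]] := sq_pos (spin_realD hx hy).
exists ((r3 - r1 - r2) / 2).
have : sq (x + y) (x + y) = sq x x + sq y y + 2 * sq x y.
  rewrite -{1}[x]scale1r sq_lin mul1r ![sq _ (x + y)]sq_sym -[x in sq (x + y) _]scale1r !sq_lin mul1r.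
  by rewrite -[x in sq (x + y) _]scale1r sq_lin mul1r [sq y x]sq_sym; ring.
rewrite h1 h2 h3 => h; rewrite rmorphM !rmorphB fmorphV rmorph_nat /= h; by field.
Qed.

Lemma spin_parts x : in_spin x -> exists x1 x2, [/\ spin_real x1, spin_real x2,
  x = x1 + 'i *: x2 & sbar x = x1 - 'i *: x2].
Proof.
move=> hx; have hb := sbar_in_spin hx; have bK := sbarK hx.
exists (2^-1 *: (x + sbar x)), ((- 'i / 2) *: (x - sbar x)); split.
- split; first by apply/in_spinZ/in_spinD.
  rewrite -[_ *: _]addr0 sbar_lin -{1}[x]scale1r sbar_lin bK rmorph1 scale1r (proj2 spin_real0).
  by rewrite conj_half [sbar x + x]addrC !addr0.
- split; first by apply: in_spinZ; rewrite -scaleN1r addrC; exact: in_spin_lin.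
  rewrite -[_ *: _]addr0 sbar_lin -scaleN1r [x + _]addrC sbar_lin bK rmorphN1 (proj2 spin_real0).
  by rewrite rmorphM rmorphN /= conjCi conj_half; lv.
- rewrite scalerA; have -> : 'i * (- 'i / 2) = 2^-1 :> R[i] by rewrite mulrA mulrN -expr2 sqrCi opprK mul1r.
  by lf.
- rewrite scalerA; have -> : 'i * (- 'i / 2) = 2^-1 :> R[i] by rewrite mulrA mulrN -expr2 sqrCi opprK mul1r.
  by lf.
Qed.

Let ii : 'i * 'i = -1 :> R[i]. Proof. by rewrite -expr2 sqrCi. Qed.

Lemma sq0l z : sq 0 z = 0.
Proof. by have := sq_lin (-1) 0 0 z; rewrite scaler0 addr0 mulN1r addNr. Qed.

Lemma sqZl k x z : sq (k *: x) z = k * sq x z.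
Proof. by rewrite -[_ *: _]addr0 sq_lin sq0l addr0. Qed.

Lemma sqDl x y z : sq (x + y) z = sq x z + sq y z.
Proof. by rewrite -[x in LHS]scale1r sq_lin mul1r. Qed.

Lemma sqZr k x z : sq z (k *: x) = k * sq z x.
Proof. by rewrite !(sq_sym z) sqZl. Qed.

Lemma sqDr x y z : sq z (x + y) = sq z x + sq z y.
Proof. by rewrite !(sq_sym z) sqDl. Qed.

Lemma in_spin_D g : in_spin g -> tp (e + e') (e + e') g = g.
Proof.
have o1 z : tp e e' z = 0 by exact: (peirce0_l J te).
have o2 z : tp e' e z = 0 by exact: (peirce0_m J te).
move=> [h1 h2]; rewrite !(tpDl J, tpDm J) o1 o2 addr0 add0r.
have := spin_elE g; rewrite /spin_el; move: (A g) (H g) (B g) h1 h2 => a b a' h1 h2 ->.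
rewrite !(tpDr J) !(tpZr J) te te' (ee' : tp e e e' = 0) e'e h1 h2; lf.
Qed.

Lemma sbar_isotropic g : in_spin g -> sq g g = 0 -> sq (sbar g) (sbar g) = 0.
Proof.
move=> hg g0.
have [x [y [hx hy gE bE]]] := spin_parts hg.
have [r1 q1] := sq_real hx hx; have [r2 q2] := sq_real hy hy; have [r3 q3] := sq_real hx hy.
have q4 : sq y x = r3%:C by rewrite sq_sym.
move: g0; rewrite bE gE -scaleN1r !(sqDl, sqDr, sqZl, sqZr) q1 q2 q3 q4.
have -> : r1%:C + 'i * r3%:C + ('i * r3%:C + 'i * ('i * r2%:C)) = (r1 - r2) +i* (2 * r3) :> R[i].
  rewrite -complexiE; apply/eqP; rewrite eq_complex /=; apply/andP; split; apply/eqP; ring.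
move=> /eqP; rewrite eq_complex /= => /andP[/eqP h1 /eqP h2].
have -> : r1 = r2 by lra.
have -> : r3 = 0 by lra.
transitivity (r2%:C * (1 + 'i * 'i) : R[i]); last by rewrite ii addrN mulr0.
by rewrite rmorph0; ring.
Qed.

(** For isotropic [g] the spin formula reduces to [{g, sbar w, g} = 2 sq g w g], and the value
    [2^-1] makes [g] a tripotent. For minimality in [E], only the Peirce 2-part of the middle
    variable at [e + e'] contributes. *)
Lemma isotropic_minimal g : in_spin g -> sq g g = 0 -> sq g (sbar g) = 2^-1 ->
  minimal g /\ orthogonal g (sbar g).
Proof.
move=> hg g0 g1; have hb := sbar_in_spin hg; have bK := sbarK hg.
have tu := tripotent_add J me me' ee'.
set u := e + e' in tu; have gu : tp u u g = g by exact: in_spin_D.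
have gw w : in_spin w -> tp g (sbar w) g = (2 * sq g w) *: g.
  by move=> hw; rewrite spin_triple // g0 scale0r subr0; lv.
split; last first.
  rewrite /orthogonal -{2}bK spin_triple //.
  have bb := sbar_isotropic hg g0.
  by rewrite bb scale0r addr0 subrr.
split.
- have := gw _ hb; rewrite bK g1 => ->; rewrite mulfV ?pnatr_eq0 // scale1r //.
- by move=> g00; move: g1; rewrite g00 sq0l => /esym/eqP; rewrite invr_eq0 pnatr_eq0.
- move=> z; rewrite [z](peirce_sum J tu).
  have [h2 h1 h0] := peirce_pieces JB tu z.
  move: (P2 tp u z) (P1 tp u z) (P0 tp u z) h2 h1 h0 => z2 z1 z0 h2 h1 h0.
  have hz : in_spin z2 by exact: in_spin_peirce2.
  exists (2 * sq g (sbar z2)).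
  rewrite !(tpDm J) -{1}(sbarK hz) gw; last exact: sbar_in_spin.
  have -> : tp g z0 g = 0 by exact: (peirce20_l J _ tu gu h0).
  rewrite addr0; have -> : tp g z1 g = 0; last by rewrite addr0.
  (* The product has weight [1 - 1/2 + 1] at [u]. *)
  apply: (peirce_eigen0 J tu (a := 3 / 2)).
    rewrite (@peirce_tp _ _ _ J u 1 2^-1 1) ?conj_half ?scale1r //.
    by congr (_ *: _); field.
  have -> : 2 * (3 / 2) ^+ 3 - 3 * (3 / 2) ^+ 2 + 3 / 2 = 3 / 2 :> R[i] by field.
  by rewrite mulf_neq0 ?invr_neq0 ?pnatr_eq0.
Qed.

Lemma real_pair_minimal x y : spin_real x -> spin_real y -> sq x x = 1 -> sq y y = 1 ->
  sq x y = 0 -> let g := 2^-1 *: (x + 'i *: y) in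
  [/\ in_spin g, sbar g = 2^-1 *: (x - 'i *: y), sq g g = 0 & sq g (sbar g) = 2^-1].
Proof.
move=> [hx bx] [hy b_y] xx yy xy g.
have yx : sq y x = 0 by rewrite sq_sym.
have bE : sbar g = 2^-1 *: (x - 'i *: y).
  rewrite /g -[_ *: _ in LHS]addr0 sbar_lin conj_half (proj2 spin_real0) addr0 [x + _]addrC.
  rewrite sbar_lin bx b_y conjCi; lv.
split=> //; first by apply: in_spinZ; rewrite addrC; exact: in_spin_lin.
  rewrite /g !(sqDl, sqDr, sqZl, sqZr) xx yy xy yx.
  transitivity (2^-1 * 2^-1 * (1 + 'i * 'i) : R[i]); first by ring.
  by rewrite ii addrN mulr0.
rewrite bE /g -scaleNr !(sqDl, sqDr, sqZl, sqZr) xx yy xy yx.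
transitivity (2^-1 * 2^-1 * (1 - 'i * 'i) : R[i]); first by ring.
by rewrite ii opprK; field.
Qed.

(** In [{f, sbar w, f}] the term [- sq f f w] would have to be a multiple of [f] for every [w],
    although [e] and [e'] are independent. *)
Lemma minimal_isotropic f : minimal f -> in_spin f -> sq f f = 0 /\ sq f (sbar f) = 2^-1.
Proof.
move=> mf hf; have [tf f0 cf] := mf.
have f00 : sq f f = 0.
  apply/eqP; apply: contraT => n0.
  have K w : in_spin w -> exists c, w = c *: f.
    move=> hw; have [c] := cf (sbar w); rewrite spin_triple // => h.
    exists ((2 * sq f w - c) / sq f f).
    apply: (scalerI n0); rewrite scalerA [sq f f * _]mulrC divfK //.
    transitivity ((sq f w *: f + sq f w *: f) - (sq f w *: f + sq f w *: f - sq f f *: w)); first by lv.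
    by rewrite h; lv.
  have [k ke] := K _ in_spin_e; have [k' ke'] := K _ in_spin_e'.
  have k0 : k <> 0 by move=> k0; move: (minimal_neq0 me); rewrite ke k0 scale0r.
  have e'E : e' = (k' / k) *: e by rewrite ke scalerA divfK; [|exact/eqP].
  have : tp e e e' = e' by rewrite {1}e'E (tpZr J) te -e'E.
  by rewrite (ee' : tp e e e' = 0) => /esym h; case: (minimal_neq0 me').
split=> //; have := spin_triple hf (sbar_in_spin hf) hf.
rewrite (sbarK hf) tf f00 scale0r subr0 => h.
have : (2 * sq f (sbar f) - 1) *: f = 0 by rewrite scalerBl scale1r [in X in _ - X]h; lv.
move=> /eqP; rewrite scaler_eq0 => /orP[|/eqP //]; rewrite subr_eq0 => /eqP h2.
have two0 : 2 != 0 :> R[i] by rewrite pnatr_eq0.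
by apply: (mulfI two0); rewrite h2 mulfV.
Qed.

Lemma spin_partner f : minimal f -> in_spin f -> exists2 g, minimal g & orthogonal f g.
Proof.
move=> mf hf; have [f0 f1] := minimal_isotropic mf hf.
have [_ ofb] := isotropic_minimal hf f0 f1.
exists (sbar f) => //.
have hb := sbar_in_spin hf; have bK := sbarK hf.
have tb := sbar_isotropic hf f0.
by have [] := isotropic_minimal hb tb; rewrite bK // sq_sym.
Qed.

Lemma spin_real_perp x : spin_real x -> exists y, [/\ spin_real y, y <> 0 & sq x y = 0].
Proof.
move=> [hx bx]; have [a1 a2 a3] := sbar_coords hx; rewrite bx in a1 a2 a3.
have E0 : forall a : R[i], a <> 0 -> spin_real (a *: e + a^* *: e') /\ a *: e + a^* *: e' <> 0.
  move=> a a0; have := in_spin_coords a a^* half0; have [c1 c2 c3] := spin_coords a a^* half0.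
  rewrite !addr0 in c1 c2 c3 *; move=> hy; split.
    by split=> //; rewrite sbarE c1 c2 c3 plus0 subr0 conjCK.
  by move=> y0; apply: a0; rewrite -c1 y0 /A (mcoef0 J me).
have [ax|/eqP ax] := eqVneq (A x) 0.
  have [h1 h2] := E0 1 (fun h => ltac:(by move/eqP: h; rewrite oner_eq0)).
  exists (1 *: e + 1^* *: e'); split=> //.
  have [c1 c2 c3] := spin_coords 1 1^* half0; rewrite !addr0 in c1 c2 c3.
  by rewrite /sq /spin_q c1 c2 c3 a2 ax rmorph0 !mul0r addr0 mulr0 (spinS_sym J) /spinS (tp0l J) (mcoef0 J me') subr0.
(* A real vector has conjugate coefficients at [e] and [e']; multiplying the first by ['i] makes the
   pairing with [x] purely imaginary, so its real part vanishes. *)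
have n0 : 'i * A x <> 0 by move=> /eqP; rewrite mulf_eq0 => /orP[|/eqP //]; rewrite (negbTE (neq0Ci _)).
have [h1 h2] := E0 _ n0; exists (('i * A x) *: e + ('i * A x)^* *: e'); split=> //.
have [c1 c2 c3] := spin_coords ('i * A x) ('i * A x)^* half0; rewrite !addr0 in c1 c2 c3.
rewrite /sq /spin_q c1 c2 c3 a2 (spinS_sym J) /spinS (tp0l J) (mcoef0 J me') rmorphM /= conjCi; ring.
Qed.

(** Gram-Schmidt for [sq]. Both basis vectors must be nonzero even for dependent [z1] and [z2], and
    [spin_real_perp] supplies the missing ones. *)
Lemma spin_real_plane z1 z2 : spin_real z1 -> spin_real z2 ->
  exists x y, [/\ spin_real x /\ spin_real y, x <> 0, y <> 0, sq x y = 0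
    & exists a b c d : R, z1 = a%:C *: x + b%:C *: y /\ z2 = c%:C *: x + d%:C *: y].
Proof.
have main w1 w2 : w1 <> 0 -> spin_real w1 -> spin_real w2 ->
  exists x y, [/\ spin_real x /\ spin_real y, x <> 0, y <> 0, sq x y = 0
    & exists a b c d : R, w1 = a%:C *: x + b%:C *: y /\ w2 = c%:C *: x + d%:C *: y].
  move=> w10 h1 h2; have [r r0 [q1 rz]] := sq_pos h1; have [s q2] := sq_real h1 h2.
  have r0' : r != 0 by apply/eqP => /rz.
  pose y0 := w2 - (s / r)%:C *: w1.
  have hy0 : spin_real y0 by rewrite /y0 addrC -scaleNr -rmorphN; exact: spin_real_lin.
  have [z|n0] := pselect (y0 = 0).
    have [y [hy yn0 xy]] := spin_real_perp h1; exists w1, y; split=> //.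
    exists 1, 0, (s / r), 0; rewrite !scale0r !addr0 scale1r; split=> //.
    by apply/eqP; rewrite -subr_eq0 -/y0 z.
  exists w1, y0; split=> //.
    rewrite /y0 -scaleNr sqDr sqZr q1 q2 -rmorphN -rmorphM -rmorphD /= (_ : s + - (s / r) * r = 0) //.
    by rewrite mulNr divfK // subrr.
  exists 1, 0, (s / r), 1; rewrite scale0r addr0 !scale1r; split=> //.
  by rewrite /y0 addrC subrK.
move=> h1 h2; have [z10|n1] := pselect (z1 = 0); last exact: main.
have [z20|n2] := pselect (z2 = 0); last first.
  have [x [y [hxy x0 y0 xy [a [b [c [d [e1 e2]]]]]]]] := main _ _ n2 h2 h1.
  by exists x, y; split=> //; exists c, d, a, b.
have [x [hx x0 _]] := spin_real_perp spin_real0.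
have [y [hy y0 xy]] := spin_real_perp hx.
by exists x, y; split=> //; exists 0, 0, 0, 0; rewrite z10 z20 scale0r scale0r addr0.
Qed.

End Pair.
End SpinReal.

(** * Linearity of the extension *)

Section Compatibility.
Variables (R : realType) (E : completeNormedModType R[i]).
Variable tp : E -> E -> E -> E.
Hypothesis JB : JBstar_triple tp.
Hypothesis WC : weakly_compact_triple tp.
Let J := jb_jordan JB.
Local Notation minimal := (minimal tp).
Local Notation coef := (mcoef tp).
Local Notation orthogonal := (orthogonal tp).
Ltac lv := lmod_with E R[i]; try ring.
Ltac lf := lmod_with E R[i]; try by field.

Local Notation V := (realify E).
Variables (Y : lmodType R) (ny : Y -> R).
Ltac ly := lmod_with Y R; try ring.
Let nv : V -> R := @nrm R E.
Let HV : is_norm nv := realify_is_norm E.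
Hypothesis HY : is_norm ny.
Let HA := jb_atomic JB WC.
Variable D : V -> Y.
Hypothesis D_sphere : forall x, nv x = 1 -> ny (D x) = 1.
Hypothesis D_onto : forall y, ny y = 1 -> exists2 x, nv x = 1 & D x = y.
Hypothesis D_iso : forall x y, nv x = 1 -> nv y = 1 -> ny (D x - D y) = nv (x - y).
Local Notation T := (ext nv D : E -> Y).

Lemma circle_i g : minimal g -> circle (V := V) minimal orthogonal g ('i *: g).
Proof.
move=> mg a b ab; pose k : R[i] := a%:C + 'i * b%:C.
have -> : (a *: (g : V) + b *: ('i *: g : V) : V) = (k *: g : E) by rewrite !real_scaleE /k; lv.
have k1 : k * k^* = 1.
  rewrite mul_conj_cabs cabs_sqr /k -complexiE /=.
  have -> : (a + (0 * b - 1 * 0)) ^+ 2 + (0 + (0 * 0 + 1 * b)) ^+ 2 = a ^+ 2 + b ^+ 2 by ring.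
  by rewrite ab.
have k2 : k^* * k = 1 by rewrite mulrC.
split; first exact: (minimal_phase J mg k1).
- by move=> x hx; rewrite /orthogonal (tpZl J) (tpZm J) hx !scaler0.
- move=> x; rewrite /orthogonal (tpZl J) (tpZm J) scalerA k1 scale1r; exact.
Qed.

Lemma T_flat g h (a a' b b' : R) : minimal g -> minimal h -> orthogonal g h ->
  T (a%:C *: g + a'%:C *: ('i *: g) + (b%:C *: h + b'%:C *: ('i *: h))) =
  a *: D g + a' *: D ('i *: g) + (b *: D h + b' *: D ('i *: h)).
Proof.
move=> mg mh gh.
have := @ext_flat _ V Y nv ny HV HY _ _ _ HA D D_sphere D_onto D_iso g ('i *: g) h ('i *: h)
  a a' b b' mg mh gh (circle_i mg) (circle_i mh).
by rewrite !real_scaleE.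
Qed.

Section SpinExtension.
Variables e e' : E.
Hypotheses (me : minimal e) (me' : minimal e') (ee' : orthogonal e e').
Local Notation X := (spin_real tp e e').
Local Notation q := (sq tp e e').

(* [g = (x + i y)/2] and [h = (x - i y)/2] are orthogonal minimal tripotents, and the plane
   is contained in the complex span of [g] and [h]. *)
Lemma T_unit_plane x y (a b c d : R) : X x -> X y -> q x x = 1 -> q y y = 1 -> q x y = 0 ->
  T ((a%:C + 'i * b%:C) *: x + (c%:C + 'i * d%:C) *: y) =
  a *: T x + b *: T ('i *: x) + (c *: T y + d *: T ('i *: y)).
Proof.
move=> hx hy xx yy xy; have [hg gb g0 g1] := real_pair_minimal JB me me' ee' hx hy xx yy xy.
have [mg gh] := isotropic_minimal JB WC me me' ee' hg g0 g1.
have hb := sbar_in_spin JB me me' ee' hg.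
have tb := sbar_isotropic JB WC me me' ee' hg g0.
have [|mh _] := isotropic_minimal JB WC me me' ee' hb tb.
  by rewrite (sbarK JB me me' ee') // (sq_sym JB).
move: gh mh; rewrite gb; set g := 2^-1 *: (x + _) in mg *; set h := 2^-1 *: (x - _) => gh mh.
have F (a1 a2 b1 b2 : R) := T_flat a1 a2 b1 b2 mg mh gh.
have xE : x = (1 : R)%:C *: g + (0 : R)%:C *: ('i *: g) + ((1 : R)%:C *: h + (0 : R)%:C *: ('i *: h)).
  rewrite /g /h; lf.
have ixE : 'i *: x = (0 : R)%:C *: g + (1 : R)%:C *: ('i *: g) + ((0 : R)%:C *: h + (1 : R)%:C *: ('i *: h)).
  rewrite /g /h; lf.
have z1 : y = - 'i *: ('i *: y) by rewrite scalerA mulNr -expr2 sqrCi opprK scale1r.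
have yE : y = (0 : R)%:C *: g + (- 1 : R)%:C *: ('i *: g) + ((0 : R)%:C *: h + (1 : R)%:C *: ('i *: h)).
  rewrite [LHS]z1 /g /h; move: ('i *: y) => z; lf.
have iyE : 'i *: y = (1 : R)%:C *: g + (0 : R)%:C *: ('i *: g) + ((- 1 : R)%:C *: h + (0 : R)%:C *: ('i *: h)).
  rewrite /g /h; move: ('i *: y) => z; lf.
have Tx : T x = T ((1 : R)%:C *: g + (0 : R)%:C *: ('i *: g) + ((1 : R)%:C *: h + (0 : R)%:C *: ('i *: h))).
  by rewrite -xE.
have Tix : T ('i *: x) = T ((0 : R)%:C *: g + (1 : R)%:C *: ('i *: g) + ((0 : R)%:C *: h + (1 : R)%:C *: ('i *: h))).
  by rewrite -ixE.
have Ty : T y = T ((0 : R)%:C *: g + (- 1 : R)%:C *: ('i *: g) + ((0 : R)%:C *: h + (1 : R)%:C *: ('i *: h))).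
  by rewrite -yE.
have Tiy : T ('i *: y) = T ((1 : R)%:C *: g + (0 : R)%:C *: ('i *: g) + ((- 1 : R)%:C *: h + (0 : R)%:C *: ('i *: h))).
  by rewrite -iyE.
have -> : (a%:C + 'i * b%:C) *: x + (c%:C + 'i * d%:C) *: y =
    (a + d)%:C *: g + (b - c)%:C *: ('i *: g) + ((a - d)%:C *: h + (b + c)%:C *: ('i *: h)).
  rewrite [in LHS]z1 /g /h !rmorphD !rmorphN /=.
  have -> : (a%:C + 'i * b%:C) *: x = a%:C *: x + b%:C *: ('i *: x) by lv.
  have -> : (c%:C + 'i * d%:C) *: (- 'i *: ('i *: y)) = (- 'i * c%:C - 'i * 'i * d%:C) *: ('i *: y) by lv.
  rewrite -[in LHS]expr2 sqrCi; move: ('i *: y) => z; lf.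
by rewrite Tx Tix Ty Tiy !F; ly.
Qed.

Lemma T_plane x y (a b c d : R) : X x -> X y -> x <> 0 -> y <> 0 -> q x y = 0 ->
  T ((a%:C + 'i * b%:C) *: x + (c%:C + 'i * d%:C) *: y) =
  a *: T x + b *: T ('i *: x) + (c *: T y + d *: T ('i *: y)).
Proof.
have unit z : X z -> z <> 0 -> exists r z', [/\ z = (r : R)%:C *: z', X z' & q z' z' = 1
   /\ forall w, q z w = 0 -> q z' w = 0].
  move=> hz z0; have [s s0 [qs sz]] := sq_pos JB WC me me' ee' hz.
  have sp : 0 < s by rewrite lt_neqAle s0 andbT eq_sym; apply/eqP => /sz.
  pose r := Num.sqrt s; have r0 : 0 < r by rewrite sqrtr_gt0.
  have rr : r * r = s by rewrite -expr2 sqr_sqrtr.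
  exists r, ((r^-1)%:C *: z); split.
  - by rewrite scalerA -rmorphM /= mulfV ?gt_eqF // scale1r.
  - exact: (spin_realZ JB me me').
  - split; last by move=> w h; rewrite (sqZl JB) // h mulr0.
    rewrite (sqZl JB) // (sq_sym JB) (sqZl JB) // qs -!rmorphM /= (_ : r^-1 * (r^-1 * s) = 1) //.
    by rewrite -rr; field; rewrite gt_eqF.
move=> hx hy x0 y0 xy.
have [r [x' [xE hx' [xx hx'0]]]] := unit x hx x0; have [s [y' [yE hy' [yy hy'0]]]] := unit y hy y0.
have xy' : q x' y' = 0.
  by have := hx'0 _ xy; rewrite (sq_sym JB) => /hy'0; rewrite (sq_sym JB).
have F (a1 b1 c1 d1 : R) := T_unit_plane a1 b1 c1 d1 hx' hy' xx yy xy'.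
have -> : T x = T ((r%:C + 'i * (0 : R)%:C) *: x' + ((0 : R)%:C + 'i * (0 : R)%:C) *: y').
  by congr T; rewrite xE; lv.
have -> : T ('i *: x) = T (((0 : R)%:C + 'i * r%:C) *: x' + ((0 : R)%:C + 'i * (0 : R)%:C) *: y').
  by congr T; rewrite xE; lv.
have -> : T y = T (((0 : R)%:C + 'i * (0 : R)%:C) *: x' + (s%:C + 'i * (0 : R)%:C) *: y').
  by congr T; rewrite yE; lv.
have -> : T ('i *: y) = T (((0 : R)%:C + 'i * (0 : R)%:C) *: x' + ((0 : R)%:C + 'i * s%:C) *: y').
  by congr T; rewrite yE; lv.
have -> : (a%:C + 'i * b%:C) *: x + (c%:C + 'i * d%:C) *: y =
   ((a * r)%:C + 'i * (b * r)%:C) *: x' + ((c * s)%:C + 'i * (d * s)%:C) *: y'.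
  by rewrite xE yE !rmorphM /=; lv.
by rewrite !F; ly.
Qed.

(** Two real vectors share a plane, and [T] is real linear on its complex span. Four real vectors
    occur in [z + w], so it is regrouped into real and imaginary parts and treated two at a time. *)
Lemma T_spinD z w : in_spin tp e e' z -> in_spin tp e e' w -> T (z + w) = T z + T w.
Proof.
have real2 x y (k : R[i]) : X x -> X y -> [/\ T (x + y) = T x + T y,
    T ('i *: x + 'i *: y) = T ('i *: x) + T ('i *: y) & T (x + 'i *: y) = T x + T ('i *: y)].
  move=> hx hy.
  have [u [v [[hu hv] u0 v0 uv [a [b [c [d [xE yE]]]]]]]] := spin_real_plane JB WC me me' ee' hx hy.
  have F (a1 b1 c1 d1 : R) := T_plane a1 b1 c1 d1 hu hv u0 v0 uv.
  have Tx : T x = T ((a%:C + 'i * (0 : R)%:C) *: u + (b%:C + 'i * (0 : R)%:C) *: v).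
    by congr T; rewrite xE; lv.
  have Ty : T y = T ((c%:C + 'i * (0 : R)%:C) *: u + (d%:C + 'i * (0 : R)%:C) *: v).
    by congr T; rewrite yE; lv.
  have Tix : T ('i *: x) = T (((0 : R)%:C + 'i * a%:C) *: u + ((0 : R)%:C + 'i * b%:C) *: v).
    by congr T; rewrite xE; lv.
  have Tiy : T ('i *: y) = T (((0 : R)%:C + 'i * c%:C) *: u + ((0 : R)%:C + 'i * d%:C) *: v).
    by congr T; rewrite yE; lv.
  split.
  - have -> : x + y = ((a + c)%:C + 'i * (0 : R)%:C) *: u + ((b + d)%:C + 'i * (0 : R)%:C) *: v.
      by rewrite xE yE !rmorphD /=; lv.
    by rewrite Tx Ty !F; ly.
  - have -> : 'i *: x + 'i *: y = ((0 : R)%:C + 'i * (a + c)%:C) *: u + ((0 : R)%:C + 'i * (b + d)%:C) *: v.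
      by rewrite xE yE !rmorphD /=; lv.
    by rewrite Tix Tiy !F; ly.
  - have -> : x + 'i *: y = (a%:C + 'i * c%:C) *: u + (b%:C + 'i * d%:C) *: v.
      by rewrite xE yE; lv.
    by rewrite Tx Tiy !F; ly.
move=> hz hw.
have [z1 [z2 [hz1 hz2 zE _]]] := spin_parts JB me me' ee' hz.
have [w1 [w2 [hw1 hw2 wE _]]] := spin_parts JB me me' ee' hw.
have h1 := spin_realD JB me me' hz1 hw1; have h2 := spin_realD JB me me' hz2 hw2.
have [_ _ e1] := real2 _ _ 0 h1 h2; have [_ _ e2] := real2 _ _ 0 hz1 hz2.
have [_ _ e3] := real2 _ _ 0 hw1 hw2; have [e4 _ _] := real2 _ _ 0 hz1 hw1.
have [_ e5 _] := real2 _ _ 0 hz2 hw2.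
have -> : z + w = (z1 + w1) + 'i *: (z2 + w2) by rewrite zE wE; lv.
rewrite e1 zE wE e2 e3 e4 scalerDr e5; ly.
Qed.

Lemma T_pos (a : R) z : 0 <= a -> T (a%:C *: z) = a *: T z.
Proof. by move=> a0; have := @extZ_pos _ V Y nv HV D a z a0; rewrite real_scaleE. Qed.

Lemma T_spinZ (a : R) z : in_spin tp e e' z -> T (a%:C *: z) = a *: T z.
Proof.
move=> hz; have [a0|/ltW a0] := lerP 0 a; first exact: T_pos.
have hNz : in_spin tp e e' (- z) by rewrite -scaleN1r; exact: (in_spinZ JB).
have := T_spinD hz hNz; rewrite subrr (ext0 HV) => /esym/eqP; rewrite addr_eq0 => /eqP Tz.
have -> : a%:C *: z = (- a)%:C *: (- z) by rewrite rmorphN scalerN scaleNr opprK.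
by rewrite T_pos ?oppr_ge0 // Tz; ly.
Qed.

Lemma spin_support psi z : supports (V := V) nv ny (ephi tp) D e psi -> in_spin tp e e' z ->
  psi (T z) = ephi tp e z.
Proof.
move=> Sp hz; apply: (@support_of_additive _ V Y nv ny HV HY _ _ _ HA D D_sphere e psi z me Sp).
move=> t _; rewrite real_scaleE.
have he := in_spin_e JB me me' ee'.
have htz : in_spin tp e e' (t%:C *: z) by exact: (in_spinZ JB).
have Te : T e = D e by apply: (@ext_sphere _ V Y nv D); exact: (minimal_nrm JB me).
by rewrite -Te -(T_spinZ t hz); exact: (T_spinD he htz).
Qed.

End SpinExtension.
Lemma peirce_separate e x2 x1 x0 y2 y1 y0 : tp e e x2 = x2 -> tp e e x1 = 2^-1 *: x1 ->
  tp e e x0 = 0 -> tp e e y2 = y2 -> tp e e y1 = 2^-1 *: y1 -> tp e e y0 = 0 ->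
  x2 + x1 + x0 = y2 + y1 + y0 -> x1 = y1 /\ x0 = y0.
Proof.
move=> hx2 hx1 hx0 hy2 hy1 hy0 h.
have d1 : x2 + 2^-1 *: x1 = y2 + 2^-1 *: y1.
  by have := congr1 (tp e e) h; rewrite !(tpDr J) hx2 hx1 hx0 hy2 hy1 hy0 !addr0.
have d2 : x2 + 4^-1 *: x1 = y2 + 4^-1 *: y1.
  have := congr1 (tp e e) d1; rewrite !(tpDr J) !(tpZr J) hx2 hx1 hy2 hy1 !scalerA.
  by rewrite -invfM -natrM.
have e1 : x1 = y1.
  transitivity (y1 + 4 *: ((x2 + 2^-1 *: x1 - (y2 + 2^-1 *: y1)) - (x2 + 4^-1 *: x1 - (y2 + 4^-1 *: y1)))).
    lf.
  by rewrite d1 d2 !subrr scaler0 addr0.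
split=> //; rewrite e1 in d1 h; move: d1 h => /addIr -> ; exact: addrI.
Qed.

(* [{f,e',f}] is a multiple of [f]; compare the Peirce parts of both at [e]. *)
Lemma peirce0_partner e f : minimal e -> minimal f -> P0 tp e f <> 0 ->
  exists e' (l : R) f1, [/\ minimal e', orthogonal e e', 0 < l,
    half tp e e' f1 & f = coef e f *: e + f1 + l%:C *: e'].
Proof.
move=> me mf w0; have te := minimal_trip me.
have [h2 h1 h0] := peirce_pieces JB te f; have fE := peirce_dec J me f.
have [e' [me' oe' He']] := top_atom JB WC w0.
have ee' : orthogonal e e' by exact: He'.
have te' := minimal_trip me'; have l0 := nrm_gt0 w0.
move: (P1 tp e f) (P0 tp e f) h1 h0 fE w0 oe' l0 => f1 w h1 h0 fE w0 oe' l0.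
set l := nrm w in oe' l0; move: l oe' l0 => l oe' l0.
have [_ _ /(_ e')[c hc]] := mf; set al := coef e f in fE *.
have o1 z : tp e e' z = 0 by exact: (peirce0_l J te).
have o2 z : tp z e' e = 0 by rewrite (jt_sym J).
have hw z : tp w e' z = l%:C *: tp e' e' z.
  rewrite -[w](subrK (l%:C *: e')); move: (w - _) oe' => w' ow'.
  by rewrite (tpDl J) (peirce0_m J te' _ ow') add0r (tpZl J).
have hwr z : tp z e' w = l%:C *: tp z e' e' by rewrite (jt_sym J) hw (jt_sym J).
have fef : tp f e' f = tp f1 e' f1 + (2 * l%:C) *: tp e' e' f1 + (l%:C ^+ 2) *: e'.
  rewrite fE !(tpDl J) !(tpDr J) !(tpZl J) !(tpZr J) !o1 !o2 !hw !hwr te' [tp f1 e' e'](jt_sym J); lv.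
have D'1 : tp e e (tp e' e' f1) = 2^-1 *: tp e' e' f1.
  by rewrite (commute_orthogonal JB) // h1 (tpZr J).
have Q2 : tp e e (tp f1 e' f1) = tp f1 e' f1.
  rewrite (@peirce_tp _ _ _ J e 2^-1 0 2^-1) ?rmorph0 ?scale0r //.
  by rewrite (_ : _ + _ = 1) ?scale1r //; field.
have [s1 s0] : (2 * l%:C) *: tp e' e' f1 = c *: f1 /\ (l%:C ^+ 2) *: e' = c *: w.
  apply: (@peirce_separate e (tp f1 e' f1) _ _ ((c * al) *: e)) => //.
  - by rewrite (tpZr J) D'1; lv.
  - by rewrite (tpZr J) (ee' : tp e e e' = 0) scaler0.
  - by rewrite (tpZr J) te.
  - by rewrite (tpZr J) h1; lv.
  - by rewrite (tpZr J) h0 scaler0.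
  by rewrite -fef hc [in LHS]fE; lv.
have lc : l%:C != 0 :> R[i] by rewrite (inj_eq (@complexI R) l 0) gt_eqF.
have c0 : c != 0.
  apply/eqP => c0; move: s0; rewrite c0 scale0r => /eqP; rewrite scaler_eq0 expf_eq0 (negbTE lc) andbF /=.
  by move=> /eqP; exact: (minimal_neq0 me').
have wE : w = (l%:C ^+ 2 / c) *: e' by rewrite mulrC -scalerA s0 scalerA mulVf // scale1r.
(* By [oe'] the coefficient of [w] at [e'] is [l], while [wE] gives [l ^ 2 / c]. *)
have cl : c = l%:C.
  have : (l%:C ^+ 2 / c - l%:C) *: e' = 0.
    have := oe'; rewrite /orthogonal (tpDr J) (tpNr J) (tpZr J) te' {1}wE (tpZr J) te' => <-; lv.
  move=> /eqP; rewrite scaler_eq0 => /orP[|/eqP h]; last by case: (minimal_neq0 me').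
  rewrite subr_eq0 => /eqP h; have := congr1 (fun z : R[i] => z * c) h.
  by rewrite /= divfK // expr2 => /(mulfI lc) ->.
exists e', l, f1; split=> //.
- split=> //; have two0 : 2 != 0 :> R[i] by rewrite pnatr_eq0.
  have : (2 * l%:C) *: (tp e' e' f1 - 2^-1 *: f1) = 0 by rewrite scalerBr s1 cl; lf.
  move=> /eqP; rewrite scaler_eq0 mulf_eq0 (negbTE two0) (negbTE lc) /= subr_eq0 => /eqP //.
- by rewrite [LHS]fE {1}wE cl; congr (_ + _ *: _); rewrite expr2 mulfK.
Qed.

(** [e] contributes nothing at [e'], and for the Peirce 1-part [x1] of [x] at [e] the product
    [{e', x1, e'}] has weight [-1/2] at [e], hence vanishes. *)
Lemma coef_P0 e e' x : minimal e -> minimal e' -> orthogonal e e' ->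
  coef e' x = coef e' (P0 tp e x).
Proof.
move=> me me' ee'; have te := minimal_trip me.
have [h2 h1 h0] := peirce_pieces JB te x.
have xE := peirce_dec J me x; move: (P1 tp e x) (P0 tp e x) h1 h0 xE => x1 x0 h1 h0 xE.
rewrite [in LHS]xE !(mcoefD J me') (mcoefZ J me') (mcoef_peirce0 J me' (orth_sym J te ee')).
rewrite mulr0 add0r; suff -> : coef e' x1 = 0 by rewrite add0r.
apply: (scale_inj_min me'); rewrite -(mcoefP me') scale0r.
have -> : tp e' x1 e' = 0; last by rewrite (tp0m J).
apply: (peirce_eigen0 J te (a := - 2^-1)).
  rewrite (@peirce_tp _ _ _ J e 0 2^-1 0) ?conj_half ?scale0r //.
  by congr (_ *: _); ring.
have -> : 2 * (- 2^-1) ^+ 3 - 3 * (- 2^-1) ^+ 2 + (- 2^-1) = - (3 / 2) :> R[i] by field.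
by rewrite oppr_eq0 mulf_neq0 ?invr_neq0 ?pnatr_eq0.
Qed.

Lemma support_peirce0 e f psi : minimal e -> minimal f ->
  supports (V := V) nv ny (ephi tp) D e psi -> P0 tp e f <> 0 -> psi (T f) = ephi tp e f.
Proof.
move=> me mf Sp /(peirce0_partner me mf)[e' [l [f1 [me' ee' _ hf1 fE]]]].
apply: (spin_support me me' ee' Sp); rewrite fE; exact: (in_spin_coords JB me me' ee').
Qed.

(* [f = b + l k] in the spin factor of [e'] and [k], where [b] is in that of [e] and [e'].
   The sum [e' + k] is also the sum of two minimal tripotents [g] and [h] to which
   [support_peirce0] applies, and this settles [k]. *)
Lemma support_cross e f e' psi : minimal e -> minimal f -> supports (V := V) nv ny (ephi tp) D e psi ->
  P0 tp e f = 0 -> minimal e' -> orthogonal e e' -> ~ orthogonal e' f -> psi (T f) = ephi tp e f.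
Proof.
move=> me mf Sp P0f me' ee' ne'f; have te := minimal_trip me; have te' := minimal_trip me'.
have e'e : orthogonal e' e by exact: (orth_sym J te ee').
have [_ h1 _] := peirce_pieces JB te f.
have fE := peirce_dec J me f; rewrite P0f addr0 in fE.
set al := coef e f in fE; set f1 := P1 tp e f in fE h1.
have g1E : tp e' e' f = tp e' e' f1 by rewrite {1}fE (tpDr J) (tpZr J) (e'e : tp e' e' e = 0) scaler0 add0r.
have g1 : tp e e (tp e' e' f) = 2^-1 *: tp e' e' f.
  by rewrite g1E (commute_orthogonal JB) // h1 (tpZr J).
have cf : coef e' f = 0 by rewrite (coef_P0 f me me' ee') P0f (mcoef0 J me').
have two0 : 2 != 0 :> R[i] by rewrite pnatr_eq0.
(* In the first case [f] is in the Peirce 1/2-space of [e'] and, by [g1], in that of [e], so it is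
   itself in their spin factor. *)
have [P0f'|P0f'] := pselect (P0 tp e' f = 0).
  have h : tp e' e' f = 2^-1 *: f.
    have := peirce_dec J me' f; rewrite P0f' cf scale0r add0r addr0 => {1 2}->.
    exact: (D_P1 J te').
  apply: (spin_support me me' ee' Sp); apply: (half_in_spin JB me me' ee'); split=> //.
  by apply: (scalerI (invr_neq0 two0)); rewrite -(tpZr J) -h.
have [k [l [b [mk oe'k l0 hb fE']]]] := peirce0_partner me' mf P0f'.
rewrite cf scale0r add0r in fE'.
have bE : tp e' e' f = 2^-1 *: b.
  by rewrite fE' (tpDr J) (tpZr J) (oe'k : tp e' e' k = 0) scaler0 addr0; case: hb.
have b0 : b <> 0 by move=> b0; apply: ne'f; rewrite /orthogonal bE b0 scaler0.
have hb' : half tp e e' b.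
  split; last by case: hb.
  by apply: (scalerI (invr_neq0 two0)); rewrite -(tpZr J) -bE.
have sb := in_spin_coords JB me' mk oe'k.
have he' := in_spin_e JB me' mk oe'k; have hk := in_spin_e' JB me' mk oe'k.
have hbs := half_in_spin JB me' mk oe'k hb.
have Tf : psi (T f) = psi (T b) + l * psi (T k).
  rewrite fE' (T_spinD me' mk oe'k hbs); last exact: (in_spinZ JB).
  by rewrite T_pos ?ltW // (supD Sp); congr (_ + _); exact: (supZ Sp).
have Tb : psi (T b) = ephi tp e b.
  by apply: (spin_support me me' ee' Sp); exact: (half_in_spin JB me me' ee').
suff Tk : psi (T k) = ephi tp e k.
  rewrite Tf Tb Tk [in RHS]fE' [X in _ = ephi _ _ X]addrC; have := ephi_lin JB l k b me; rewrite real_scaleE => ->.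
  by rewrite addrC.
pose pl := plus tp e' k.
have hpl : half tp e' k (pl b) by exact: (half_plus J me' mk oe'k).
have plK : pl (pl b) = b by exact: (plusK J me' mk oe'k).
have real_half c : half tp e' k c -> pl c = - c -> spin_real tp e' k c.
  move=> hc pc; split; first exact: (half_in_spin JB).
  have [c1 c2 c3] := spin_coords JB me' mk oe'k 0 0 hc.
  rewrite !scale0r addr0 add0r in c1 c2 c3.
  by rewrite sbarE // c1 c2 c3 -/pl pc rmorph0 !scale0r addr0 add0r opprK.
(* A nonzero real vector orthogonal to [e' + k] for [sq]: [b - pl b], or ['i *: b] if [pl] fixes
   [b]. *)
have [d [d0 hd rd]] : exists d, [/\ d <> 0, half tp e' k d & spin_real tp e' k d].
  have [z|n0] := pselect (b - pl b = 0); last first.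
    have hd : half tp e' k (b - pl b).
      by rewrite addrC -scaleN1r; exact: (half_lin J).
    exists (b - pl b); split=> //; apply: real_half => //.
    have -> : b - pl b = (-1) *: pl b + b by lv.
    rewrite [in LHS]/pl (plus_conj JB) -/pl plK rmorphN1; lv.
  have hd : half tp e' k ('i *: b) by rewrite -[_ *: _]addr0; apply: (half_lin J) => //; exact: (half0 JB).
  exists ('i *: b); split=> //.
    by move=> /eqP; rewrite scaler_eq0 (negbTE (neq0Ci _)) => /eqP.
  apply: real_half => //; rewrite -[_ *: _ in LHS]addr0 /pl (plus_conj JB) // (plus0 JB) -/pl.
  by move/eqP: z; rewrite subr_eq0 => /eqP <-; rewrite conjCi addr0 scaleNr.
have [r r0 [qd rz]] := sq_pos JB WC me' mk oe'k rd.
have rp : 0 < r by rewrite lt_neqAle r0 andbT eq_sym; apply/eqP => /rz.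
pose s := Num.sqrt r; have s0 : 0 < s by rewrite sqrtr_gt0.
have ss : s * s = r by rewrite -expr2 sqr_sqrtr.
pose u := e' + k; pose v := (s^-1)%:C *: d.
have hu : spin_real tp e' k u.
  split; first exact: (in_spinD JB).
  have [c1 c2 c3] := spin_coords JB me' mk oe'k 1 1 (half0 JB e' k).
  rewrite !scale1r addr0 in c1 c2 c3.
  by rewrite sbarE // c1 c2 c3 (plus0 JB) rmorph1 subr0 !scale1r.
have hv : spin_real tp e' k v by exact: (spin_realZ JB).
have uu : sq tp e' k u u = 1.
  have [c1 c2 c3] := spin_coords JB me' mk oe'k 1 1 (half0 JB e' k).
  rewrite !scale1r addr0 in c1 c2 c3.
  rewrite /sq /spin_q c1 c2 c3 /spinS (tp0l J) (mcoef0 J mk); by field.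
have vv : sq tp e' k v v = 1.
  rewrite /v (sqZl JB) // (sqZr JB) // qd -!rmorphM /= (_ : s^-1 * (s^-1 * r) = 1) //.
  by rewrite -ss; field; rewrite gt_eqF.
have uv : sq tp e' k u v = 0.
  rewrite /v (sqZr JB) //; have [c1 c2 c3] := spin_coords JB me' mk oe'k 1 1 (half0 JB e' k).
  have [c4 c5 c6] := spin_coords JB me' mk oe'k 0 0 hd.
  rewrite !scale1r addr0 in c1 c2 c3; rewrite !scale0r addr0 add0r in c4 c5 c6.
  rewrite /sq /spin_q c1 c2 c3 c4 c5 c6 /spinS (tp0l J) (mcoef0 J mk).
  by rewrite !(mulr0, addr0, subr0).
have [hg gb g0 g1'] := real_pair_minimal JB me' mk oe'k hu hv uu vv uv.
have [mg _] := isotropic_minimal JB WC me' mk oe'k hg g0 g1'.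
have hgb := sbar_in_spin JB me' mk oe'k hg.
have gb0 := sbar_isotropic JB WC me' mk oe'k hg g0.
have [|mgb _] := isotropic_minimal JB WC me' mk oe'k hgb gb0.
  by rewrite (sbarK JB me' mk oe'k) // (sq_sym JB).
rewrite gb in hgb mgb.
set g := 2^-1 *: (u + 'i *: v) in hg mg; set h := 2^-1 *: (u - 'i *: v) in hgb mgb.
have coefu : coef e' u = 1.
  by rewrite /u (mcoefD J me') (mcoef_self me') (mcoef_peirce0 J me' oe'k) addr0.
have coefv : coef e' v = 0.
  by rewrite /v (mcoefZ J me') (mcoef_peirce1 J me' (proj1 hd)) mulr0.
have half_n0 : 2^-1 <> 0 :> R[i] by apply/eqP; rewrite invr_eq0.
(* The coefficient of [g] at [e'] is 1/2, and by [coef_P0] it is the coefficient of [P0 tp e g]. The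
   same holds for [h]. *)
have P0g : P0 tp e g <> 0.
  move=> h0; apply: half_n0; have := coef_P0 g me me' ee'; rewrite h0 (mcoef0 J me') => <-.
  by rewrite /g (mcoefZ J me') (mcoefD J me') (mcoefZ J me') coefu coefv mulr0 addr0 mulr1.
have P0h : P0 tp e h <> 0.
  move=> h0; apply: half_n0; have := coef_P0 h me me' ee'; rewrite h0 (mcoef0 J me') => <-.
  by rewrite /h -scaleNr (mcoefZ J me') (mcoefD J me') (mcoefZ J me') coefu coefv mulr0 addr0 mulr1.
have Tg := support_peirce0 me mg Sp P0g; have Th := support_peirce0 me mgb Sp P0h.
have uE : u = g + h by rewrite /g /h; lf.
have Te' := spin_support me me' ee' Sp (in_spin_e' JB me me' ee').
have phiD x y : ephi tp e (x + y) = ephi tp e x + ephi tp e y.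
  by have := ephi_lin JB 1 x y me; rewrite scale1r mul1r.
have := T_spinD me' mk oe'k he' hk; rewrite -/u uE (T_spinD me' mk oe'k hg hgb).
move=> /(congr1 psi); rewrite (supD Sp) Tg Th -phiD -uE (supD Sp) Te' /u phiD.
by move=> /addrI.
Qed.

(** If [e] has a Peirce 0-part at [p] or at [r], [peirce0_partner] puts it into a spin factor.
    Otherwise it is in both Peirce 1/2-spaces, hence in the spin factor of [p] and [r]. Either way
    its conjugate there is the partner. *)
Lemma orthogonal_minimal_exists p r e : minimal p -> minimal r -> orthogonal p r ->
  minimal e -> exists2 e', minimal e' & orthogonal e e'.
Proof.
move=> mp mr pr me.
have [P0p|P0p] := pselect (P0 tp p e = 0); last first.
  have [p' [l [f1 [mp' pp' _ hf1 eE]]]] := peirce0_partner mp me P0p.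
  apply: (spin_partner JB WC mp mp' pp' me); rewrite eE; exact: (in_spin_coords JB mp mp' pp').
have [P0r|P0r] := pselect (P0 tp r e = 0); last first.
  have [p' [l [f1 [mp' pp' _ hf1 eE]]]] := peirce0_partner mr me P0r.
  apply: (spin_partner JB WC mr mp' pp' me); rewrite eE; exact: (in_spin_coords JB mr mp' pp').
have rp := orth_sym J (minimal_trip mp) pr.
have half1 g : minimal g -> coef g e = 0 -> P0 tp g e = 0 -> tp g g e = 2^-1 *: e.
  move=> mg cg Pg; have := peirce_dec J mg e; rewrite cg Pg scale0r add0r addr0 => {1 2}->.
  exact: (D_P1 J (minimal_trip mg)).
apply: (spin_partner JB WC mp mr pr me); apply: (half_in_spin JB mp mr pr); split.
- by apply: half1 => //; rewrite (coef_P0 e mr mp rp) P0r (mcoef0 J mp).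
- by apply: half1 => //; rewrite (coef_P0 e mp mr pr) P0p (mcoef0 J mr).
Qed.

Lemma compatible_higher_rank p r : minimal p -> minimal r -> orthogonal p r ->
  compatible (V := V) nv ny minimal (ephi tp) D.
Proof.
move=> mp mr pr e f psi me mf Sp.
have Tf : D f = T f by apply/esym/(@ext_sphere _ V Y nv D); exact: (minimal_nrm JB mf).
have [P0f|P0f] := pselect (P0 tp e f = 0); last by rewrite Tf; exact: support_peirce0.
have [e' me' ee'] := orthogonal_minimal_exists mp mr pr me.
have [ef|nef] := pselect (orthogonal e' f).
  apply: (@support_of_common_orth _ V Y nv ny HV HY _ _ _ HA D D_sphere D_onto D_iso e f e' psi) => //.
  exact: (orth_sym J (minimal_trip me)).
by rewrite Tf; exact: (support_cross me mf Sp P0f me' ee' nef).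
Qed.

(* In rank one every cube is [{z,z,z} = |z|^2 z]; comparing coefficients in the cubes
   of [u + v], [u - v] and [u + 2 v] gives the parallelogram identity. *)
Lemma rank_one_parallelogram (u v : E) : (forall e z, minimal e -> orthogonal e z -> z = 0) ->
  nrm u = 1 -> nrm v = 1 -> nrm (u + v) ^+ 2 + nrm (u - v) ^+ 2 = 4.
Proof.
move=> r1 nu n1.
have cubeE z : tp z z z = (nrm z ^+ 2)%:C *: z.
  have [->|/eqP z0] := eqVneq z 0; first by rewrite (tp0r J) scaler0.
  have [e [me oe _]] := top_atom JB WC z0.
  move/eqP: (r1 _ _ me oe); rewrite subr_eq0 => /eqP zE.
  have te := minimal_trip me; move: zE; move: (nrm z) => l zE.
  by rewrite {1 2 3}zE (tpZl J) (tpZm J) (tpZr J) te conj_realC zE rmorphXn /=; lv.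
have u0 : u <> 0 by move=> u0; move: nu; rewrite u0 nrm0 => /esym/eqP; rewrite oner_eq0.
have [[r vE]|ind] := pselect (exists r : R, v = r%:C *: u).
  have rr : `|r| = 1 by move: n1; rewrite vE nrmZr nu mulr1.
  have -> : u + v = (1 + r)%:C *: u by rewrite vE rmorphD rmorph1; lv.
  have -> : u - v = (1 - r)%:C *: u by rewrite vE rmorphB rmorph1; lv.
  rewrite !nrmZr nu !mulr1 !real_normK ?num_real //.
  have r2 : r ^+ 2 = 1 by rewrite -real_normK ?num_real // rr expr1n.
  by transitivity (2 + 2 * r ^+ 2); [ring|rewrite r2; ring].
have indep (a b : R) : a%:C *: u + b%:C *: v = 0 -> a = 0 /\ b = 0.
  move=> h; have b0 : b = 0.
    apply/eqP; apply: contraT => bn; case: ind; exists (- (b^-1 * a)).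
    have -> : v = (b^-1)%:C *: (b%:C *: v) by rewrite scalerA -rmorphM /= mulVf // scale1r.
    have -> : b%:C *: v = - (a%:C *: u) by move/eqP: h; rewrite addrC addr_eq0 => /eqP.
    by rewrite scalerN scalerA -rmorphM rmorphN scaleNr.
  split=> //; move: h; rewrite b0 scale0r addr0 => /eqP; rewrite scaler_eq0 => /orP[|/eqP //].
  by rewrite (inj_eq (@complexI R) a 0) => /eqP.
pose C1 := 2 *: tp u u v + tp u v u; pose C2 := 2 *: tp u v v + tp v u v.
have expand (t : R) : tp (u + t%:C *: v) (u + t%:C *: v) (u + t%:C *: v) =
    u + t%:C *: C1 + (t ^+ 2)%:C *: C2 + (t ^+ 3)%:C *: v.
  rewrite !(tpDl J) !(tpDm J) !(tpDr J) !(tpZl J) !(tpZm J) !(tpZr J) conj_realC !cubeE nu n1.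
  rewrite /C1 /C2 [tp v u u](jt_sym J) [tp v v u](jt_sym J) !expr1n !rmorphXn rmorph1 /=; lv.
pose n t := nrm (u + (t : R)%:C *: v) ^+ 2.
have key t : u + t%:C *: C1 + (t ^+ 2)%:C *: C2 + (t ^+ 3)%:C *: v = (n t)%:C *: (u + t%:C *: v).
  by rewrite -expand cubeE.
(* The values 1 and -1 determine [C1] and [C2]. At 2 independence of [u] and [v] gives two
   equations, from which [d] and [n 2] cancel together, leaving [s = 4]. *)
have k1 := key 1; have k2 := key (- 1); have k3 := key 2.
pose s := n 1 + n (- 1); pose d := n 1 - n (- 1).
have C2E : C2 = (s / 2 - 1)%:C *: u + (d / 2)%:C *: v.
  transitivity (2^-1 *: ((u + (1 : R)%:C *: C1 + (1 ^+ 2 : R)%:C *: C2 + (1 ^+ 3 : R)%:C *: v) +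
    (u + (- 1 : R)%:C *: C1 + ((- 1) ^+ 2 : R)%:C *: C2 + ((- 1) ^+ 3 : R)%:C *: v)) - u); first by lf.
  rewrite k1 k2 /s /d; move: (n 1) (n (- 1)) => n1' n2'; lf.
have C1E : C1 = (d / 2)%:C *: u + (s / 2 - 1)%:C *: v.
  transitivity (2^-1 *: ((u + (1 : R)%:C *: C1 + (1 ^+ 2 : R)%:C *: C2 + (1 ^+ 3 : R)%:C *: v) -
    (u + (- 1 : R)%:C *: C1 + ((- 1) ^+ 2 : R)%:C *: C2 + ((- 1) ^+ 3 : R)%:C *: v)) - v); first by lf.
  rewrite k1 k2 /s /d; move: (n 1) (n (- 1)) => n1' n2'; lf.
have [h1 h2] : 1 + d + 2 * s - 4 - n 2 = 0 /\ s - 2 + 2 * d + 8 - 2 * n 2 = 0.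
  apply: indep; rewrite C1E C2E in k3; move/eqP: k3; rewrite -subr_eq0 => /eqP <-.
  move: (n 2) (d) (s) => m d' s'; lf.
have : s = 4 by lra.
by rewrite /s /n rmorphN1 scaleN1r rmorph1 scale1r.
Qed.

Lemma jb_compatible : compatible (V := V) nv ny minimal (ephi tp) D.
Proof.
have [[p [r [mp mr pr]]]|H] := pselect (exists p r, [/\ minimal p, minimal r & orthogonal p r]).
  exact: (compatible_higher_rank mp mr pr).
have r1 e z : minimal e -> orthogonal e z -> z = 0.
  move=> me ez; apply: contrapT => /(top_atom JB WC)[g [mg _ Hg]].
  by apply: H; exists e, g; split=> //; apply: Hg => //; exact: (minimal_trip me).
apply: (compatible_rank_one HV HY HA D_sphere D_onto D_iso) => //.
by move=> u v nu n1; exact: rank_one_parallelogram.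
Qed.

Lemma jb_ext_linear :
  [/\ forall (a : R) (x y : V), T (a *: x + y) = a *: T x + T y,
      forall x y : V, ny (T x - T y) = nv (x - y),
      forall y, exists x, T x = y & forall x, nv x = 1 -> T x = D x].
Proof.
apply: (@ext_linear _ V Y nv ny HV HY _ _ _ HA D D_sphere D_onto D_iso _ jb_compatible).
exact: (approximation JB WC).
Qed.

End Compatibility.

Local Open Scope complex_scope.

Theorem theorem5p4 (R : realType) (E : completeNormedModType R[i])
    (tp : E -> E -> E -> E) :
  JBstar_triple tp -> weakly_compact_triple tp -> Mazur_Ulam_property E.
Proof.
move=> JB WC Y f ffun fsurj fiso.
have sphereE (x : E) : nrm x = 1 <-> @unit_sphere _ E x.
  by rewrite /unit_sphere /mkset nrmE; split=> [->//|/complexI].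
have HY : @is_norm R Y (fun y : Y => `|y|).
  split; [exact: ler_normD|by move=> a x; rewrite normrZ|by move=> x /normr0_eq0].
have D_sphere (x : realify E) : nrm (x : E) = 1 -> `|f x| = 1 by move=> /sphereE/ffun.
have D_onto (y : Y) : `|y| = 1 -> exists2 x : realify E, nrm (x : E) = 1 & f x = y.
  by move=> /fsurj[x /sphereE nx <-]; exists x.
have D_iso (x y : realify E) : nrm (x : E) = 1 -> nrm (y : E) = 1 ->
    `|f x - f y| = nrm ((x : E) - y).
  move=> /sphereE sx /sphereE sy; apply: (@complexI R).
  by rewrite -nrmE; exact: fiso.
have [Tlin Tiso Tonto Tsphere] :=
  @jb_ext_linear R E tp JB WC Y (fun y => `|y|) HY f D_sphere D_onto D_iso.
set T := ext _ _ in Tlin Tiso Tonto Tsphere.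
exists (T : E -> Y); split.
  split.
  - by move=> r x y; rewrite -Tlin.
  - by move=> x y _ _; rewrite Tiso nrmE.
  - by move=> y _; have [x <-] := Tonto y; exists x.
  - by move=> x /sphereE; exact: Tsphere.
(* Uniqueness: every vector is a real multiple of a unit vector. *)
move=> T' [T'lin _ _ T'sphere]; apply/funext => x.
have T'0 : T' 0 = 0.
  by have := T'lin (-1) 0 0; rewrite scaler0 addr0 scaleN1r addNr.
have T'Z (r : R) (z : E) : T' (r%:C *: z) = r *: T' z.
  by have := T'lin r z 0; rewrite T'0 !addr0.
have [->|/eqP x0] := eqVneq x 0.
  by rewrite T'0; have := Tlin (-1) 0 0; rewrite scaler0 addr0 scaleN1r addNr.
have n0 := nrm_gt0 x0; have nz : nrm x != 0 by rewrite gt_eqF.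
have xE : x = (nrm x)%:C *: ((nrm x)^-1%:C *: x).
  by rewrite scalerA -rmorphM /= mulfV // scale1r.
have nu : nrm ((nrm x)^-1%:C *: x) = 1 by rewrite nrmZr ger0_norm ?invr_ge0 ?nrm_ge0 // mulVf.
have su := (sphereE _).1 nu.
have T0 : T 0 = 0 by have := Tlin (-1) 0 0; rewrite scaler0 addr0 scaleN1r addNr.
rewrite xE T'Z T'sphere //; have := Tlin (nrm x) ((nrm x)^-1%:C *: x) 0.
by rewrite T0 !addr0 => ->; rewrite Tsphere.
Qed.
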